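(* Let $\xi$ be a probability measure on $\{0,1,2,\dots\}$ with mean $1$ and $\xi(1)<1$. With respect to the topology of $d_{\mathrm{loc}}$, $\mathrm{GW}_\xi^n$ converges weakly to $\mathrm{GW}_\xi^\infty$ as $n\to\infty$ along the integers $n$ for which $\mathrm{GW}^n_\xi$ is defined, and $\mathrm{GW}_\xi^{\mathcal L,n}$ converges weakly to $\mathrm{GW}_\xi^\infty$ as $n\to\infty$ along the integers $n$ for which $\mathrm{GW}^{\mathcal L,n}_\xi$ is defined.
   Context: A tree is a rooted unordered tree (finite or infinite) in which every vertex has finitely many children; trees are identified if there is a bijection of their vertices preserving the root and the parent relation. Leaves are vertices without children. For an integer $R\ge0$, $t|_R$ is the subtree of vertices at graph distance at most $R$ from the root and $d_{\mathrm{loc}}(t,s)=\exp[-\inf\{R\ge0:t|_R\ne s|_R\}]$. $[\![t_1,\dots,t_d]\!]$ is obtained by attaching the roots of $t_1,\dots,t_d$ by edges to a new common root (the single-vertex tree if $d=0$). $\mathrm{GW}_\xi$ is the law of the unordered Galton–Watson tree with offspring distribution $\xi$, i.e. for a finite tree $t$, $\mathrm{GW}_\xi(t)=\sum_{t'}\prod_{u\in t'}\xi(c_u(t'))$, the sum being over plane (ordered) trees $t'$ whose underlying unordered tree is $t$ and $c_u(t')$ being the number of children of $u$. $\mathrm{GW}_\xi^n$ is $\mathrm{GW}_\xi$ conditioned on the set of trees with $n$ vertices, defined when this set has positive $\mathrm{GW}_\xi$-probability; $\mathrm{GW}_\xi^{\mathcal L,n}$ is $\mathrm{GW}_\xi$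 conditioned on the set of trees with $n$ leaves, defined when this set has positive probability. $\hat\xi(k)=k\,\xi(k)$ is the size-biased law. $\mathrm{GW}_\xi^\infty$ (Kesten's tree) is the law of the tree obtained as follows: $(X_n)_{n\ge0}$ are i.i.d. with $X_n+1\sim\hat\xi$; independently $(T_{n,k})_{n\ge0,k\ge1}$ are i.i.d. $\mathrm{GW}_\xi$ trees; on an infinite branch with vertices $v_0$ (root)$,v_1,v_2,\dots$, for each $n\ge0$ identify the root of $T_n=[\![T_{n,1},\dots,T_{n,X_n}]\!]$ with $v_n$. *)

(* Defs.v *)
From HB Require Import structures.
From mathcomp Require Import all_boot all_order all_algebra.
From mathcomp Require Import finmap.
From mathcomp Require Import all_classical all_reals all_analysis.

Set Implicit Arguments.
Unset Strict Implicit.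
Unset Printing Implicit Defensive.

Import Order.TTheory GRing.Theory Num.Theory.
Import numFieldNormedType.Exports.

Local Open Scope classical_set_scope.
Local Open Scope quotient_scope.

(* Plane (ordered) locally finite trees in Ulam-Harris-Neveu coding: the root
   is the empty word and [rcons u i] is the i-th child of [u]. *)
Record planeTree := PlaneTree {
  verts : set (seq nat) ;
  verts_root : verts [::] ;
  verts_parent : forall u i, verts (rcons u i) -> verts u ;
  verts_children : forall u, exists k, forall i, verts (rcons u i) -> (i < k)%N ;
  verts_older : forall u i j, (j <= i)%N -> verts (rcons u i) -> verts (rcons u j)
}.

HB.instance Definition _ := gen_eqMixin planeTree.
HB.instance Definition _ := gen_choiceMixin planeTree.

Definition nchildren (p : planeTree) (u : seq nat) : nat :=
  #|` fset_set [set i | verts p (rcons u i)]|.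

Definition leaves (p : planeTree) : set (seq nat) :=
  [set u | verts p u /\ forall i, ~ verts p (rcons u i)].

Definition is_child (u v : seq nat) : Prop := exists i, v = rcons u i.

Definition is_tree_iso (p q : planeTree) (f : seq nat -> seq nat) : Prop :=
  [/\ set_bij (verts p) (verts q) f, f [::] = [::] &
      forall u v, verts p u -> verts p v ->
        (is_child u v <-> is_child (f u) (f v))].

Definition tree_iso (p q : planeTree) : Prop := exists f, is_tree_iso p q f.

Lemma tree_iso_refl p : tree_iso p p.
Proof. by exists id; split=> //; split=> // u pu; exists u. Qed.

Lemma tree_iso_sym p q : tree_iso p q -> tree_iso q p.
Proof.
case=> f [bf f0 fc].
have [g [fg gf]] : exists g : seq nat -> seq nat,
    (forall v, verts q v -> verts p (g v) /\ f (g v) = v) /\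
    (forall u, verts p u -> g (f u) = u).
  pose g v := xget [::] [set u | verts p u /\ f u = v].
  have gP v : verts q v -> verts p (g v) /\ f (g v) = v.
    move=> qv; case: bf => _ _ /(_ _ qv)[u pu fu].
    by apply: (@xgetPex _ [::] [set u | verts p u /\ f u = v]); exists u.
  exists g; split => // u pu.
  case: bf => fun_f inj_f _.
  have [pg fg] := gP _ (fun_f _ pu).
  by apply: inj_f => //; rewrite inE.
exists g; split.
- split.
  + by move=> v /fg[].
  + move=> v w; rewrite !inE => qv qw gvw.
    by rewrite -(fg _ qv).2 -(fg _ qw).2 gvw.
  + move=> u pu; exists (f u); last exact: gf.
    by case: bf => + _ _; apply.
- by rewrite -{1}f0 gf//; exact: verts_root.
- move=> v w qv qw.
  have [pv fv] := fg _ qv; have [pw fw] := fg _ qw.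
  by apply: iff_sym; have := fc _ _ pv pw; rewrite fv fw.
Qed.

Lemma tree_iso_trans q p r : tree_iso p q -> tree_iso q r -> tree_iso p r.
Proof.
case=> f [[f1 f2 f3] f0 fc] [g [[g1 g2 g3] g0 gc]]; exists (g \o f); split.
- split.
  + by move=> u /f1 /g1.
  + move=> u v; rewrite !inE => pu pv /= /g2 h.
    by apply: f2; rewrite ?inE//; apply: h; rewrite inE; exact: f1.
  + move=> w rw; have [v qv <-] := g3 _ rw; have [u pu <-] := f3 _ qv.
    by exists u.
- by rewrite /= f0.
- by move=> u v pu pv; rewrite fc//; apply: gc; exact: f1.
Qed.

Definition tree_isob (p q : planeTree) : bool := `[< tree_iso p q >].

Lemma tree_isob_refl : reflexive tree_isob.
Proof. by move=> p; apply/asboolP; exact: tree_iso_refl. Qed.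

Lemma tree_isob_sym : symmetric tree_isob.
Proof. by move=> p q; apply/asbool_equiv_eq; split; exact: tree_iso_sym. Qed.

Lemma tree_isob_trans : transitive tree_isob.
Proof.
move=> q p r /asboolP pq /asboolP qr.
by apply/asboolP; exact: tree_iso_trans pq qr.
Qed.

Canonical tree_iso_equiv :=
  EquivRel tree_isob tree_isob_refl tree_isob_sym tree_isob_trans.

(* Rooted unordered locally finite trees: every such tree is isomorphic to a
   plane one, so isomorphism classes of trees are classes of plane trees. *)
Definition tree := {eq_quot tree_iso_equiv}.
HB.instance Definition _ := EqQuotient.on tree.
HB.instance Definition _ := Choice.on tree.

Definition shape (p : planeTree) : tree := \pi_tree p.

Lemma eq_shape p q : shape p = shape q <-> tree_iso p q.
Proof.
rewrite /shape; split.
  by move=> /eqmodP /asboolP.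
by move=> pq; apply/eqmodP; apply/asboolP.
Qed.

Definition finite_tree : set tree := [set t | finite_set (verts (repr t))].

Definition trees_with_vertices (n : nat) : set tree :=
  [set t | ((verts (repr t)) #= `I_n)%card].

Definition trees_with_leaves (n : nat) : set tree :=
  [set t | (leaves (repr t) #= `I_n)%card].

Section truncation.
Variables (k : nat) (p : planeTree).

Definition ptrunc_verts : set (seq nat) := [set u | verts p u /\ (size u <= k)%N].

Let ptrunc_root : ptrunc_verts [::].
Proof. by split => //; exact: verts_root. Qed.

Let ptrunc_parent u i : ptrunc_verts (rcons u i) -> ptrunc_verts u.
Proof.
by rewrite /ptrunc_verts /= size_rcons => -[/verts_parent pu /ltnW].
Qed.

Let ptrunc_children u :
  exists m, forall i, ptrunc_verts (rcons u i) -> (i < m)%N.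
Proof. by have [m pm] := verts_children p u; exists m => i [/pm]. Qed.

Let ptrunc_older u i j : (j <= i)%N ->
  ptrunc_verts (rcons u i) -> ptrunc_verts (rcons u j).
Proof.
rewrite /ptrunc_verts /= !size_rcons => ji [pi uk].
by split=> //; exact: verts_older pi.
Qed.

Definition ptrunc : planeTree :=
  PlaneTree ptrunc_root ptrunc_parent ptrunc_children ptrunc_older.

End truncation.

(* t|_k *)
Definition trunc (k : nat) (t : tree) : tree := shape (ptrunc k (repr t)).

Section bracket.
Variable ps : seq planeTree.

Definition pbracket_verts : set (seq nat) :=
  [set u | if u is i :: v then exists2 p, onth ps i = Some p & verts p v else True].

Let pbracket_root : pbracket_verts [::]. Proof. by []. Qed.

Let pbracket_parent u i : pbracket_verts (rcons u i) -> pbracket_verts u.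
Proof.
by case: u => // j v [p pj pv]; exists p => //; exact: verts_parent pv.
Qed.

Let pbracket_children u :
  exists m, forall i, pbracket_verts (rcons u i) -> (i < m)%N.
Proof.
case: u => [|j v].
  exists (size ps) => i [p + _].
  by case: ltnP => // ips; rewrite onthE nth_default ?size_map.
case ej : (onth ps j) => [p|]; last by exists 0 => i [p]; rewrite ej.
have [m pm] := verts_children p v.
by exists m => i [q]; rewrite ej => -[<-]; exact: pm.
Qed.

Let pbracket_older u i j : (j <= i)%N ->
  pbracket_verts (rcons u i) -> pbracket_verts (rcons u j).
Proof.
case: u => [|l v] ji [p pi pv]; last first.
  by exists p => //; exact: verts_older pv.
have ips : (i < size ps)%N.
  by case: ltnP => // ips; move: pi; rewrite onthE nth_default ?size_map.
have jps := leq_ltn_trans ji ips.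
exists (nth p ps j); last exact: verts_root.
by rewrite onthE (nth_map p).
Qed.

Definition pbracket : planeTree :=
  PlaneTree pbracket_root pbracket_parent pbracket_children pbracket_older.

End bracket.

(* [[t_1, ..., t_d]] *)
Definition bracket (ts : seq tree) : tree := shape (pbracket (map repr ts)).

Section spine_graft.

(* The spine vertex v_n is the word [nseq n 0]: the first child of v_n is
   v_(n+1), and its other children are those of the root of the n-th tree. *)
Fixpoint pspine_verts (ps : nat -> planeTree) (u : seq nat) : Prop :=
  match u with
  | [::] => True
  | 0 :: v => pspine_verts (fun n => ps n.+1) v
  | i.+1 :: v => verts (ps 0) (i :: v)
  end.

Let pspine_parent u :
  forall ps i, pspine_verts ps (rcons u i) -> pspine_verts ps u.
Proof.
elim: u => // -[|j] v IH ps i /=; first exact: IH.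
exact: (@verts_parent _ (j :: v)).
Qed.

Let pspine_children u :
  forall ps, exists m, forall i, pspine_verts ps (rcons u i) -> (i < m)%N.
Proof.
elim: u => [|[|j] v IH] ps /=; last 2 first.
- exact: IH.
- exact: (verts_children (ps 0) (j :: v)).
have [m pm] := verts_children (ps 0) [::].
by exists m.+1 => -[|i] // /pm.
Qed.

Let pspine_older u : forall ps i j, (j <= i)%N ->
  pspine_verts ps (rcons u i) -> pspine_verts ps (rcons u j).
Proof.
elim: u => [|[|l] v IH] ps i j ji /=; last 2 first.
- exact: IH.
- exact: (verts_older (u := l :: v)).
case: j i ji => // j [|i] // ji.
exact: (verts_older (u := [::])).
Qed.

Definition pspine (ps : nat -> planeTree) : planeTree :=
  @PlaneTree (pspine_verts ps) I (fun u => @pspine_parent u ps)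
    (fun u => pspine_children u ps) (fun u => @pspine_older u ps).

End spine_graft.

(* Infinite branch v_0, v_1, ... with the root of [ts n] identified with v_n *)
Definition spine_graft (ts : nat -> tree) : tree :=
  shape (pspine (fun n => repr (ts n))).

(* [T n k] stands for T_{n,k+1}, so that [mkseq (T n) (X n)] is
   T_{n,1}, ..., T_{n,X_n}. *)
Definition kesten_tree (X : nat -> nat) (T : nat -> nat -> tree) : tree :=
  spine_graft (fun n => bracket (mkseq (T n) (X n))).

Local Open Scope ring_scope.
Local Open Scope ereal_scope.

Section dloc.
Variable R : realType.
Implicit Types t s r : tree.

Definition radii t s : set (\bar R) :=
  [set (k%:R)%:E | k in [set k | trunc k t <> trunc k s]].

(* [ereal_inf set0 = +oo] and [expeR -oo = 0] *)
Definition dloc t s : R := fine (expeR (- ereal_inf (radii t s))).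

Let dloc_lt1 t s : - ereal_inf (radii t s) <= 0.
Proof.
rewrite leeNl oppe0; apply: le_ereal_inf_tmp => _ [k _ <-].
by rewrite lee_fin ler0n.
Qed.

Let dlocE t s : (dloc t s)%:E = expeR (- ereal_inf (radii t s)).
Proof.
rewrite /dloc fineK// ge0_fin_numE ?expeR_ge0//.
by apply: (@le_lt_trans _ _ 1); [rewrite -expeR0 lee_expeR|exact: ltry].
Qed.

Lemma dloc_ge0 t s : (0 <= dloc t s)%R.
Proof. by rewrite -lee_fin dlocE expeR_ge0. Qed.

Lemma dlocxx t : dloc t t = 0%R.
Proof.
apply: EFin_inj; rewrite dlocE (_ : radii t t = set0) ?ereal_inf0//=.
by rewrite -subset0 => x [k /=].
Qed.

Lemma dloc_sym t s : dloc t s = dloc s t.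
Proof.
apply: EFin_inj; rewrite !dlocE (_ : radii t s = radii s t)//.
by apply/seteqP; split=> _ [k /= ts <-]; exists k => //= /esym.
Qed.

Lemma dloc_ultra s t r : (dloc t r <= Num.max (dloc t s) (dloc s r))%R.
Proof.
rewrite -lee_fin EFin_max !dlocE le_max !lee_expeR.
have : radii t r `<=` radii t s `|` radii s r.
  move=> _ [k /= tr <-].
  have [ts|ts] := pselect (trunc k t = trunc k s).
    by right; exists k => //=; rewrite -ts.
  by left; exists k.
move=> sub.
have : ereal_inf (radii t s `|` radii s r) <= ereal_inf (radii t r).
  exact: le_ereal_inf.
move=> le_inf; rewrite !(leeN2 (ereal_inf (radii _ _))) -ge_min.
apply: le_trans le_inf.
apply: le_ereal_inf_tmp => x [] xin; rewrite ge_min.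
  by rewrite ereal_inf_lbound.
by rewrite (ereal_inf_lbound xin) orbT.
Qed.

Lemma dloc_triangle s t r : (dloc t r <= dloc t s + dloc s r)%R.
Proof.
apply: (le_trans (dloc_ultra s t r)).
by rewrite ge_max lerDl lerDr !dloc_ge0.
Qed.

Lemma dloc_trunc t s k :
  (dloc t s < expR (- k%:R))%R -> trunc k t = trunc k s.
Proof.
move=> d; apply: contrapT => ts; move: d; apply/negP; rewrite -leNgt.
rewrite -lee_fin dlocE -[X in X <= _]/(expeR (- (k%:R)%:E)) lee_expeR leeN2.
by apply: ereal_inf_lbound; exists k.
Qed.

End dloc.

(* [tree] with the topology of [dloc] (the parameter R only fixes the type of
   real numbers in which distances are taken) and its Borel sigma-algebra. *)
Definition locTree (R : realType) : Type := tree.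

HB.instance Definition _ R := Choice.copy (locTree R) tree.
HB.instance Definition _ R := isPointed.Build (locTree R) (bracket [::]).

Section locTree_topology.
Variable R : realType.
Local Notation M := (locTree R).

Let ball (t : M) (e : R) : set M := [set s | (dloc R t s < e)%R].

Let ent : set_system (M * M) := entourage_ ball.

HB.instance Definition _ := hasNbhs.Build M (nbhs_ ent).

Let nbhsE : nbhs = nbhs_ ent. Proof. by []. Qed.

Let ball_center (t : M) (e : R) : (0 < e)%R -> ball t e t.
Proof. by move=> e0; rewrite /ball /= dlocxx. Qed.

Let ball_sym (t s : M) (e : R) : ball t e s -> ball s e t.
Proof. by rewrite /ball /= dloc_sym. Qed.

Let ball_triangle (t s r : M) (e1 e2 : R) :
  ball t e1 s -> ball s e2 r -> ball t (e1 + e2)%R r.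
Proof.
move=> ts sr; rewrite /ball /=.
by rewrite (le_lt_trans (dloc_triangle _ s _ _))// ltrD.
Qed.

Let entourageE : ent = entourage_ ball. Proof. by []. Qed.

HB.instance Definition _ := @Nbhs_isPseudoMetric.Build R M
  ent nbhsE ball ball_center ball_sym ball_triangle entourageE.

HB.instance Definition _ :=
  @isMeasurable.Build (sigma_display (@open M)) M <<s @open M >>
    (@sigma_algebra0 _ setT (@open M)) (@sigma_algebraC M (@open M))
    (@sigma_algebra_bigcup _ setT (@open M)).

End locTree_topology.

Lemma locTree_ballE (R : realType) (t : locTree R) (e : R) :
  ball t e = [set s | (dloc R t s < e)%R].
Proof. by []. Qed.

Section measurable_tree_sets.
Variable R : realType.

(* A set of trees is open as soon as membership of a tree is witnessed by one
   of its truncations. *)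
Lemma open_trunc (A : set (locTree R)) :
  (forall t, A t -> exists k, forall s, trunc k t = trunc k s -> A s) -> open A.
Proof.
move=> HA; rewrite openE => t /HA[k Hk]; rewrite /interior -nbhs_ballE.
exists (expR (- k%:R)) => /=; first exact: expR_gt0.
by move=> s /dloc_trunc; exact: Hk.
Qed.

Lemma is_tree_iso_size p q f :
  is_tree_iso p q f -> forall u, verts p u -> size (f u) = size u.
Proof.
case=> bf f0 fc; elim/last_ind => [|u i IH] pu; first by rewrite f0.
have pu' := verts_parent pu.
have [|j ->] := (fc _ _ pu' pu).1; first by exists i.
by rewrite !size_rcons IH.
Qed.

Lemma is_tree_iso_leaves k p q f u :
  is_tree_iso (ptrunc k p) (ptrunc k q) f ->
  (size u < k)%N -> leaves p u -> leaves q (f u).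
Proof.
move=> isof uk [pu nochild].
have pku : verts (ptrunc k p) u by split => //; exact: ltnW.
have sfu := is_tree_iso_size isof pku.
case: isof => -[f1 f2 f3] f0 fc; split; first by have [] := f1 _ pku.
move=> i qi.
have [|v pkv fv] := f3 (rcons (f u) i).
  by split => //; rewrite size_rcons sfu.
have [|j vj] := (fc _ _ pku pkv).2; first by exists i.
by apply: (nochild j); rewrite -vj; case: pkv.
Qed.

(* Lower bounds on the number of vertices (resp. leaves) are open conditions. *)
Lemma open_card_ge (L : planeTree -> set (seq nat)) (n : nat) :
  (forall p, L p `<=` verts p) ->
  (forall k p q f u, is_tree_iso (ptrunc k p) (ptrunc k q) f ->
    (size u < k)%N -> L p u -> L q (f u)) ->
  open [set t : locTree R | (`I_n #<= L (repr (t : tree)))%card].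
Proof.
move=> Lv HL; apply: open_trunc => t /= /card_leP/unsquash g0.
pose g : {injfun `I_n >-> L (repr (t : tree))} := valLR [::] g0.
pose m := (\max_(i < n) size (g i)).+1.
exists m => s /eq_shape[f isof].
have gm i : `I_n i -> (size (g i) < m)%N.
  by move=> ni; rewrite ltnS (leq_bigmax (Ordinal ni)).
have gL i : `I_n i -> L (repr (t : tree)) (g i) by move=> ni; exact: funS.
have gv i : `I_n i -> verts (ptrunc m (repr (t : tree))) (g i).
  by move=> ni; split; [exact/Lv/gL|exact/ltnW/gm].
have inj_fg : {in `I_n &, injective (f \o g)}.
  move=> i j ni nj /= fij; apply: (@inj _ _ _ g) => //.
  by case: isof => -[_ f2 _] _ _; apply: f2 => //; rewrite inE; apply: gv;
    rewrite -in_setE.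
apply: (@card_le_trans _ _ _ ((f \o g) @` `I_n)).
  by rewrite (card_le_eqr (inj_card_eq inj_fg)) card_lexx.
apply: subset_card_le => _ [i ni <-].
exact: HL isof (gm _ ni) (gL _ ni).
Qed.

Lemma open_vertices_ge n :
  open [set t : locTree R | (`I_n #<= verts (repr (t : tree)))%card].
Proof.
apply: (@open_card_ge verts) => [p u //|k p q f u [[f1 _ _] _ _] uk pu].
by have [|] := f1 u; first by split => //; exact: ltnW.
Qed.

Lemma open_leaves_ge n :
  open [set t : locTree R | (`I_n #<= leaves (repr (t : tree)))%card].
Proof.
apply: (@open_card_ge leaves) => [p u []//|k p q f u].
exact: is_tree_iso_leaves.
Qed.

Lemma card_eqI_geP (T : Type) (A : set T) n :
  (A #= `I_n)%card <-> (`I_n #<= A)%card /\ ~ (`I_n.+1 #<= A)%card.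
Proof.
split.
  move=> An; split; first by rewrite (card_le_eqr An).
  by rewrite (card_le_eqr An) card_le_II ltnn.
case=> nA /negP nSA; rewrite card_eq_le nA andbT.
have /finite_setP[m Am] : finite_set A.
  apply/finite_setPn => infA; move/negP: nSA; apply.
  exact: card_le_trans (card_leT _) infA.
by move: nSA; rewrite !(card_le_eqr Am) (card_le_eql Am) !card_le_II -leqNgt.
Qed.

Lemma open_measurable_locTree (A : set (locTree R)) : open A -> measurable A.
Proof. exact: sub_sigma_algebra. Qed.

Lemma measurable_trees_with_vertices n :
  measurable (trees_with_vertices n : set (locTree R)).
Proof.
have -> : (trees_with_vertices n : set (locTree R)) =
    [set t : locTree R | (`I_n #<= verts (repr (t : tree)))%card] `\`
    [set t : locTree R | (`I_n.+1 #<= verts (repr (t : tree)))%card].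
  by apply/seteqP; split=> t /= /card_eqI_geP.
by apply: measurableD; apply: open_measurable_locTree; exact: open_vertices_ge.
Qed.

Lemma measurable_trees_with_leaves n :
  measurable (trees_with_leaves n : set (locTree R)).
Proof.
have -> : (trees_with_leaves n : set (locTree R)) =
    [set t : locTree R | (`I_n #<= leaves (repr (t : tree)))%card] `\`
    [set t : locTree R | (`I_n.+1 #<= leaves (repr (t : tree)))%card].
  by apply/seteqP; split=> t /= /card_eqI_geP.
by apply: measurableD; apply: open_measurable_locTree; exact: open_leaves_ge.
Qed.

End measurable_tree_sets.

Section galton_watson.
Variables (R : realType) (xi : probability nat R).

Definition plane_weight (p : planeTree) : \bar R :=
  \prod_(u <- fset_set (verts p)) xi [set nchildren p u].

Definition GW_mass (t : tree) : \bar R :=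
  \esum_(p in [set p | shape p = t]) plane_weight p.

Lemma GW_mass_ge0 t : 0 <= GW_mass t.
Proof.
by apply: esum_ge0 => p _; apply: prode_ge0 => u _; exact: measure_ge0.
Qed.

(* Discrete measure with the prescribed masses on finite trees. When the
   Galton-Watson tree is almost surely finite, in particular when xi has mean 1
   and xi(1) < 1, it has total mass 1 and is the law of that tree. *)
Definition GW (B : set (locTree R)) : \bar R :=
  \esum_(t in B `&` finite_tree) GW_mass t.

Let GW0 : GW set0 = 0.
Proof. by rewrite /GW set0I esum_set0. Qed.

Let GW_ge0 B : 0 <= GW B.
Proof. by apply: esum_ge0 => t _; exact: GW_mass_ge0. Qed.

Let GW_sigma_additive : semi_sigma_additive GW.
Proof.
move=> F mF tF mUF; rewrite /GW setI_bigcupl.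
rewrite esum_bigcupT; last 2 first.
- exact: trivIset_setIr.
- by move=> t; exact: GW_mass_ge0.
rewrite -nneseries_esumT; last first.
  by move=> n; apply: esum_ge0 => t _; exact: GW_mass_ge0.
by apply: is_cvg_ereal_nneg_natsum => n _; exact: GW_ge0.
Qed.

HB.instance Definition _ :=
  isMeasure.Build _ _ _ GW GW0 GW_ge0 GW_sigma_additive.

(* The default value of [mnormalize], used when the conditioning event is
   negligible, is the Dirac mass at the single-vertex tree. *)
Definition GW_vertices (n : nat) : probability (locTree R) R :=
  mnormalize (mrestr GW (@measurable_trees_with_vertices R n)) (dirac point).

Definition GW_leaves (n : nat) : probability (locTree R) R :=
  mnormalize (mrestr GW (@measurable_trees_with_leaves R n)) (dirac point).

End galton_watson.

Definition mutually_independent (R : realType) (d : measure_display)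
    (Omega : measurableType d) (P : probability Omega R) (I : choiceType)
    (F : I -> set_system Omega) : Prop :=
  forall (J : {fset I}) (E : I -> set Omega),
    (forall i, i \in J -> F i (E i)) ->
    P (\bigcap_(i in [set` J]) E i) = \prod_(i <- J) P (E i).

Definition size_biased (R : realType) (xi : probability nat R) (k : nat) :
  \bar R := (k%:R)%:E * xi [set k].

Definition kesten_law (R : realType) (xi : probability nat R)
    (mu : probability (locTree R) R) : Prop :=
  exists (d : measure_display) (Omega : measurableType d)
    (P : probability Omega R) (X : nat -> {RV P >-> nat})
    (T : nat -> nat -> {RV P >-> locTree R}),
    [/\ forall n k, P [set w | (X n w).+1 = k] = size_biased xi k,
        forall n k B, measurable B -> distribution P (T n k) B = GW xi B,
        mutually_independent P (fun i : nat + nat * nat => match i with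
          | inl n => g_sigma_algebra_preimage (X n)
          | inr nk => g_sigma_algebra_preimage (T nk.1 nk.2) end) &
        forall B, measurable B ->
          mu B = P [set w | B (kesten_tree (fun n => X n w)
                                           (fun n k => T n k w))]].

Definition converges_weakly (R : realType) (F : set_system nat)
    (mu_ : nat -> probability (locTree R) R)
    (mu : probability (locTree R) R) : Prop :=
  forall f : locTree R -> R, continuous f ->
    (exists M : R, forall t, (`|f t| <= M)%R) ->
    \int[mu_ n]_t (f t)%:E @[n --> F] --> \int[mu]_t (f t)%:E.

(* Main.v *)
From mathcomp Require Import all_boot all_order all_algebra.
From mathcomp Require Import finmap.
From mathcomp Require Import all_classical all_reals all_analysis.
From mathcomp Require Import measurable_realfun.
From mathcomp Require Import ring lra zify.
Require Import Defs.

(** Vertices and leaves are treated at once: for a predicate w on numbers of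
    children with w 0, the size N(t) counts the vertices of t whose number of
    children satisfies w. Let T be the Galton-Watson tree and a_n the
    probability that N(T) = n. Comparing the tree conditioned on N(T) = n with
    Kesten's tree takes two ingredients.

    Ratios of size probabilities. Decomposing T at its root gives an equation
    for the generating function A of (a_n), and solving it for the marked
    vertices turns it into A = X Phi(A) where Phi is again a probability
    distribution on the integers ([reduced_law_functional]). By Lagrange
    inversion n a_n = P(S_n = n - 1) for a random walk S with step law Phi
    ([lagrange_inversion]). Tilting exponentially the probability of the step
    j shows that, conditionally on S_m = s, the frequency of the step j stays
    close to its probability unless P(S_m = s) is exponentially small
    ([conv_pow_tilt]); as this conditional frequency is Phi_j times
    P(S_(m-1) = s - j) / P(S_m = s), the latter ratio tends to 1
    ([conv_pow_ratio]). The probabilities are not exponentially small: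
    criticality forces the mean of N(T) to be infinite ([mean_size_infty]), so
    a_n is subexponential along some subsequence, and concatenation of walks
    extends this to all large n with a_n > 0 ([u_subexp]). Hence
    a_(n-r) / a_n tends to 1 along these n whenever r is, with positive
    probability, the size contributed by the root and by all but one of the
    trees attached to it ([size_ratio]).

    Local limits. A set of trees is local when a truncation decides membership.
    If the size n is large and one of the trees attached to the root carries
    nearly all of it, the others form a bush of bounded size. Choosing the
    position of the big tree among k trees produces the factor k of the
    size-biased law, and the ratio theorem together with an induction on the
    radius shows that the conditional probability of a local set has a limit
    inferior at least [kesten_mass], the value computed from the bushes at the
    first spine vertices ([local_lower]). The law of Kesten's tree gives the
    set at most this value, since the bushes are almost surely finite
    ([kesten_local_le]). Lower bounds on local sets extend to open sets, which
    is enough for weak convergence ([local_liminf_weak]). *)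

Set Implicit Arguments.
Unset Strict Implicit.
Unset Printing Implicit Defensive.

Import Order.TTheory GRing.Theory Num.Theory.
Import numFieldNormedType.Exports.

Local Open Scope classical_set_scope.

(** * Subtrees of plane trees, isomorphisms and truncations *)

Lemma planeTree_eq p q : verts p = verts q -> p = q.
Proof.
case: p q => [P ? ? ? ?] [Q ? ? ? ?] /= PQ; subst Q.
by congr PlaneTree; exact: Prop_irrelevance.
Qed.

Lemma verts_prefix p u v : verts p (u ++ v) -> verts p u.
Proof.
elim/last_ind: v => [|v i IH]; first by rewrite cats0.
by rewrite -rcons_cat => /verts_parent.
Qed.

Lemma children_segment p u :
  [set i | verts p (rcons u i)] = `I_(nchildren p u).
Proof.
set D := [set i | _].
suff [n Dn] : exists n, D = `I_n.
  by rewrite Dn /nchildren -/D Dn (card_fset_set (n := n)).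
have [k Dk] := verts_children p u.
have [n /asboolP nD nmin] : exists2 n, `[< ~ D n >] & forall m, `[< ~ D m >] -> n <= m.
  have ex : exists n, `[< ~ D n >] by exists k; apply/asboolP => /Dk; rewrite ltnn.
  by exists (ex_minn ex); case: ex_minnP.
exists n; apply/seteqP; split=> i /=.
  move=> Di; rewrite ltnNge; apply/negP => ni; apply: nD.
  exact: verts_older ni Di.
by rewrite ltnNge => /negP i_n; apply: contrapT => Di; apply/i_n/nmin/asboolP.
Qed.

Lemma nchildrenP p u i : (i < nchildren p u) <-> verts p (rcons u i).
Proof. by have /seteqP[h1 h2] := children_segment p u; split; [apply: h2|apply: h1]. Qed.

Section Fringe.
Variables (p : planeTree) (i : nat).

(** The empty word is added so that [fringe p i] is a tree for every i, whether
    or not the root of p has an i-th child. *)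
Definition fringe_verts : set (seq nat) := [set v | v = [::] \/ verts p (i :: v)].

Let fringe_root : fringe_verts [::]. Proof. by left. Qed.

Let fringe_rcons u j : fringe_verts (rcons u j) <-> verts p (rcons (i :: u) j).
Proof. by split=> [[|//]|]; [case: u|right]. Qed.

Let fringe_parent u j : fringe_verts (rcons u j) -> fringe_verts u.
Proof. by move=> /fringe_rcons/verts_parent; right. Qed.

Let fringe_children u : exists k, forall j, fringe_verts (rcons u j) -> (j < k)%N.
Proof. by have [k pk] := verts_children p (i :: u); exists k => j /fringe_rcons/pk. Qed.

Let fringe_older u j l : (l <= j)%N -> fringe_verts (rcons u j) -> fringe_verts (rcons u l).
Proof. by move=> lj /fringe_rcons /(verts_older lj) ?; apply/fringe_rcons. Qed.

Definition fringe := PlaneTree fringe_root fringe_parent fringe_children fringe_older.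

End Fringe.

Definition children p := mkseq (fringe p) (nchildren p [::]).

Lemma onth_lt T (s : seq T) i x : onth s i = Some x -> (i < size s)%N.
Proof. by rewrite -onthTE => ->. Qed.

Lemma onth_nthP T (x0 : T) s i : (i < size s)%N -> onth s i = Some (nth x0 s i).
Proof. by move=> i_s; rewrite onthE (nth_map x0). Qed.

Lemma verts_pbracket_cons x0 ps i v :
  verts (pbracket ps) (i :: v) <-> (i < size ps)%N /\ verts (nth x0 ps i) v.
Proof.
split=> [[p pi pv]|[i_s pv]]; last by exists (nth x0 ps i) => //; exact: onth_nthP.
by split; [exact: onth_lt pi|rewrite (onth_nth _ _ _ _ pi)].
Qed.

Lemma pbracket_children p : pbracket (children p) = p.
Proof.
apply: planeTree_eq; apply/seteqP; split=> -[|i v] //.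
- by move=> _; exact: verts_root.
- move/(verts_pbracket_cons p); rewrite size_mkseq => -[i_n].
  rewrite nth_mkseq// => -[->|//].
  exact/(nchildrenP p [::]).
- move=> pv; apply/(verts_pbracket_cons p); rewrite size_mkseq.
  have i_n : (i < nchildren p [::])%N.
    by apply/nchildrenP; move: pv; rewrite -cat1s => /verts_prefix.
  by split => //; rewrite nth_mkseq//; right.
Qed.

Lemma nchildren_pbracket0 ps : nchildren (pbracket ps) [::] = size ps.
Proof.
apply/eqP; rewrite eqn_leq; apply/andP; split; rewrite leqNgt; apply/negP.
  by move=> /nchildrenP[p pn _]; have := onth_lt pn; rewrite ltnn.
case: ps => [|p0 ps'] //; set ps := p0 :: ps' => h.
have /nchildrenP : verts (pbracket ps) (rcons [::] (nchildren (pbracket ps) [::])).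
  by apply/(verts_pbracket_cons p0); split => //; exact: verts_root.
by rewrite ltnn.
Qed.

Lemma children_pbracket ps : children (pbracket ps) = ps.
Proof.
case: ps => [|p0 ps']; first by rewrite /children nchildren_pbracket0.
set ps := p0 :: ps'.
apply: (@eq_from_nth _ p0); rewrite size_mkseq nchildren_pbracket0// => i i_s.
rewrite nth_mkseq ?nchildren_pbracket0//; apply: planeTree_eq; apply/seteqP; split=> v /=.
  move=> [->|/(verts_pbracket_cons p0)[]//]; exact: verts_root.
by move=> pv; right; apply/(verts_pbracket_cons p0).
Qed.

Lemma nchildren_pbracket_cons x0 ps i v : (i < size ps)%N ->
  nchildren (pbracket ps) (i :: v) = nchildren (nth x0 ps i) v.
Proof.
move=> i_s; apply/eqP; rewrite eqn_leq; apply/andP; split; rewrite leqNgt; apply/negP.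
  move=> /nchildrenP /(verts_pbracket_cons x0)[_] /nchildrenP.
  by rewrite ltnn.
move=> /nchildrenP h.
suff /nchildrenP : verts (pbracket ps) (rcons (i :: v) (nchildren (pbracket ps) (i :: v))).
  by rewrite ltnn.
by apply/(verts_pbracket_cons x0).
Qed.

Definition finite_plane : set planeTree := [set p | finite_set (verts p)].

Definition all_in T (A : set T) : set (seq T) := [set s | forall i x, onth s i = Some x -> A x].

Lemma all_in_cons T (A : set T) x s : all_in A (x :: s) <-> A x /\ all_in A s.
Proof.
split=> [h|[Ax As]]; first by split; [exact: (h 0)|move=> i; exact: (h i.+1)].
by case=> [y [<-]|i]//; exact: As.
Qed.

Lemma all_in_nil T (A : set T) : all_in A [::].
Proof. by case. Qed.

Lemma finite_pbracket ps : finite_plane (pbracket ps) <-> all_in finite_plane ps.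
Proof.
split=> [fin i p pi|fin].
  rewrite /finite_plane /= (_ : verts p = cons i @^-1` verts (pbracket ps)).
    by apply: finite_preimage fin => u v _ _ [].
  apply/seteqP; split=> v /=; first by move=> pv; exists p.
  by case=> q; rewrite pi => -[<-].
pose p0 := pbracket [::].
have -> : finite_plane (pbracket ps) = finite_set ([set [::]] `|`
    \bigcup_(i in `I_(size ps)) (cons i @` verts (nth p0 ps i))).
  congr finite_set; apply/seteqP; split=> -[|i v].
  - by left.
  - by move=> /(verts_pbracket_cons p0)[i_s pv]; right; exists i => //; exists v.
  - by [].
  - by move=> [//|[j j_s [w pw [<- <-]]]]; apply/(verts_pbracket_cons p0).
rewrite finite_setU; split; first exact: finite_set1.
apply: bigcup_finite => // i i_s; apply: finite_image.
by apply: fin (onth_nthP _ _).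
Qed.

(** A single enumeration of the vertices of the bracket serves the weight of a
    tree, which is a product over vertices, and its size, which is a sum. *)
Lemma big_pbracket (T : Type) (idx : T) (op : Monoid.com_law idx) (f : nat -> T) ps :
  all_in finite_plane ps ->
  \big[op/idx]_(u <- fset_set (verts (pbracket ps))) f (nchildren (pbracket ps) u) =
  op (f (size ps))
     (\big[op/idx]_(p <- ps) \big[op/idx]_(u <- fset_set (verts p)) f (nchildren p u)).
Proof.
move=> fin; pose p0 := pbracket [::].
have finn i : (i < size ps)%N -> finite_set (verts (nth p0 ps i)).
  by move=> i_s; apply: fin (onth_nthP _ _).
pose s := [seq i :: v | i <- iota 0 (size ps), v <- fset_set (verts (nth p0 ps i))].
have ps_s : perm_eq (fset_set (verts (pbracket ps))) ([::] :: s).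
  apply: uniq_perm; first exact: fset_uniq.
    rewrite /=; apply/andP; split; first by apply/allpairsPdep => -[? [? []]].
    apply: allpairs_uniq_dep; first exact: iota_uniq.
      by move=> i _; exact: fset_uniq.
    by move=> [i u] [j v] _ _ /= [-> ->].
  move=> u; rewrite in_fset_set; last exact/finite_pbracket.
  rewrite in_cons; case: u => [|i v]; first by rewrite eqxx mem_set.
  apply/idP/idP; rewrite inE/=.
    move=> /(verts_pbracket_cons p0)[i_s pv].
    apply/allpairsPdep; exists i, v; rewrite mem_iota in_fset_set ?inE//.
    exact: finn.
  move=> /allpairsPdep[j [w [+ + [-> ->]]]]; rewrite mem_iota => /= j_s.
  rewrite in_fset_set ?inE => [pv|]; last exact: finn.
  by apply/(verts_pbracket_cons p0).
rewrite (perm_big _ ps_s) big_cons nchildren_pbracket0; congr (op _ _).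
rewrite big_allpairs_dep (big_nth p0) /index_iota subn0 big_seq [RHS]big_seq.
apply: eq_bigr => i; rewrite mem_iota => /= i_s; apply: eq_bigr => v _.
by rewrite (nchildren_pbracket_cons p0).
Qed.

Lemma is_child_nil u : ~ is_child u [::].
Proof. by case=> i; case: u. Qed.

Lemma is_child_nil_cons i v : is_child [::] (i :: v) <-> v = [::].
Proof. by split=> [[j [_ ->]]|->]//; exists i. Qed.

Lemma is_child_cons i j u v : is_child (i :: u) (j :: v) <-> i = j /\ is_child u v.
Proof. by split=> [[k [-> ->]]|[-> [k ->]]]; [split => //; exists k|exists k]. Qed.

Lemma pbracket_iso_gen x0 ps qs (s : nat -> nat) :
  set_bij `I_(size ps) `I_(size qs) s ->
  (forall i, (i < size ps)%N -> tree_iso (nth x0 ps i) (nth x0 qs (s i))) ->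
  tree_iso (pbracket ps) (pbracket qs).
Proof.
move=> [s1 s2 s3] iso.
have [f fP] : exists f : nat -> seq nat -> seq nat, forall i, (i < size ps)%N ->
    is_tree_iso (nth x0 ps i) (nth x0 qs (s i)) (f i).
  have /choice[f fP] : forall i, exists f, (i < size ps)%N ->
      is_tree_iso (nth x0 ps i) (nth x0 qs (s i)) f.
    move=> i; case: (ltnP i (size ps)) => [i_s|]; last by exists id.
    by have [f] := iso i i_s; exists f.
  by exists f.
exists (fun u => if u is i :: v then s i :: f i v else [::]); split => //.
- split.
  + move=> [|i v] // /(verts_pbracket_cons x0)[i_s pv].
    have [[f1 _ _] _ _] := fP i i_s.
    by apply/(verts_pbracket_cons x0); split; [exact: s1|exact: f1].
  + move=> [|i u] [|j v] //; rewrite !inE.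
    move=> /(verts_pbracket_cons x0)[i_s pu] /(verts_pbracket_cons x0)[j_s pv] [sij].
    have ij : i = j by apply: s2; rewrite ?inE.
    subst j => fuv; congr cons.
    have [[_ f2 _] _ _] := fP i i_s.
    by apply: f2; rewrite ?inE.
  + move=> [|j v]; first by exists [::].
    move=> /(verts_pbracket_cons x0)[j_s qv].
    have [i i_s ij] := s3 _ j_s; have [[_ _ f3] _ _] := fP i i_s.
    rewrite -ij in qv; have [u pu fu] := f3 _ qv.
    exists (i :: u); first exact/(verts_pbracket_cons x0).
    by rewrite ij fu.
- move=> [|i u] [|j v].
  + by [].
  + move=> _ /(verts_pbracket_cons x0)[j_s pv]; rewrite !is_child_nil_cons.
    have [[_ f2 _] f0 _] := fP j j_s; split=> [->//|fv].
    by apply: f2; rewrite ?inE ?f0//; exact: verts_root.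
  + by move=> _ _; split=> /is_child_nil.
  + move=> /(verts_pbracket_cons x0)[i_s pu] /(verts_pbracket_cons x0)[j_s pv].
    rewrite !is_child_cons; split=> -[ij uv].
      subst j; split=> //; have [_ _ fc] := fP i i_s; exact: (fc _ _ pu pv).1 uv.
    have e : i = j by apply: s2; rewrite ?inE.
    subst j; split=> //; have [_ _ fc] := fP i i_s; exact: (fc _ _ pu pv).2 uv.
Qed.

Lemma shape_pbracket ps : shape (pbracket ps) = bracket (map shape ps).
Proof.
apply/eq_shape; rewrite -map_comp; pose p0 := pbracket [::].
apply: (@pbracket_iso_gen p0 _ _ id); first by rewrite size_map; split => //; move=> i /= ?; exists i.
move=> i i_s; rewrite (nth_map p0)//; apply/eq_shape.
by rewrite /= /shape reprK.
Qed.

Lemma shape_repr t : shape (repr t) = t.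
Proof. by rewrite /shape reprK. Qed.

Lemma perm_bracket ts ss : perm_eq ts ss -> bracket ts = bracket ss.
Proof.
pose t0 := bracket [::]; pose p0 := repr t0.
move=> ts_ss; have sz := perm_size ts_ss.
move/(perm_iotaP t0) : ts_ss => [Is pIs tsE].
have szI : size Is = size ss by rewrite (perm_size pIs) size_iota.
have memI i : (i < size ts)%N -> (nth 0 Is i < size ss)%N.
  move=> i_s; have : nth 0 Is i \in Is by rewrite mem_nth// szI -sz.
  by rewrite (perm_mem pIs) mem_iota.
apply/eq_shape; apply: (@pbracket_iso_gen p0 _ _ (nth 0 Is)); rewrite !size_map.
  split.
  - by move=> i /= /memI.
  - move=> i j; rewrite !inE /= => i_s j_s ij.
    apply/eqP; rewrite -(@nth_uniq _ 0 Is)// ?szI -?sz//; first exact/eqP.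
    by rewrite (perm_uniq pIs) iota_uniq.
  - move=> j /= j_s; exists (index j Is); last first.
      by rewrite nth_index// (perm_mem pIs) mem_iota.
    by rewrite /= sz -szI index_mem (perm_mem pIs) mem_iota.
move=> i i_s; rewrite (nth_map t0)// (nth_map t0) ?memI//.
rewrite {1}tsE (nth_map 0) ?szI -?sz//.
exact: tree_iso_refl.
Qed.

(** Replacing the bush at the root of a spine by an isomorphic one keeps the
    first branch r; the words of the bush occur with their first letter
    increased by one because 0 is the letter of the spine. *)
Lemma graft_iso (r p q P Q : planeTree) :
  (forall v, verts P (0 :: v) <-> verts r v) ->
  (forall i v, verts P (i.+1 :: v) <-> verts p (i :: v)) ->
  (forall v, verts Q (0 :: v) <-> verts r v) ->
  (forall i v, verts Q (i.+1 :: v) <-> verts q (i :: v)) ->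
  tree_iso p q -> tree_iso P Q.
Proof.
move=> P0 PS Q0 QS [f [[f1 f2 f3] f0 fc]].
pose up u := if u is i :: v then i.+1 :: v else [::].
pose F u := match u with [::] => [::] | 0 :: v => 0 :: v | i.+1 :: v => up (f (i :: v)) end.
have fcons i v : verts p (i :: v) -> exists j w, f (i :: v) = j :: w.
  move=> pv; case E : (f (i :: v)) => [|j w]; last by exists j, w.
  have : i :: v = [::] by apply: f2; rewrite ?inE ?f0//; exact: verts_root.
  by [].
have FS i v : verts p (i :: v) -> exists j w, F (i.+1 :: v) = j.+1 :: w /\ f (i :: v) = j :: w.
  by move=> /fcons[j [w fE]]; exists j, w; rewrite /F fE.
exists F; split=> //.
- split.
  + move=> [|[|i] v]; first by move=> _; exact: verts_root.
      by move=> /P0 rv; apply/Q0.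
    move=> /PS pv; have [j [w [-> fE]]] := FS _ _ pv.
    by apply/QS; rewrite -fE; exact: f1.
  + move=> [|[|i] u] [|[|j] v] //; rewrite !inE.
    * by move=> _ /PS pv; have [k [w [-> _]]] := FS _ _ pv.
    * by move=> /P0 _ /PS pv; have [k [w [-> _]]] := FS _ _ pv.
    * by move=> /PS pv; have [k [w [-> _]]] := FS _ _ pv.
    * by move=> /PS pv; have [k [w [-> _]]] := FS _ _ pv.
    * move=> /PS pu /PS pv.
      have [k [w [-> fu]]] := FS _ _ pu; have [k' [w' [-> fv]]] := FS _ _ pv.
      move=> [kk ww]; have [-> -> //] : i :: u = j :: v.
      by apply: f2; rewrite ?inE// fu fv kk ww.
  + move=> [|[|j] v]; first by exists [::] => //; exact: verts_root.
      by move=> /Q0 rv; exists (0 :: v) => //; apply/P0.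
    move=> /QS qv; have [[|i u] pu fu] := f3 _ qv; first by rewrite f0 in fu.
    by exists (i.+1 :: u); [apply/PS|rewrite /F fu].
- have root_p : verts p [::] := verts_root p.
  move=> [|[|i] u] [|[|j] v].
  + by [].
  + by [].
  + move=> _ /PS pv; have [k [w [-> fE]]] := FS _ _ pv.
    rewrite !is_child_nil_cons; have := fc _ _ root_p pv.
    by rewrite f0 fE !is_child_nil_cons.
  + by move=> _ _; split=> /is_child_nil.
  + by [].
  + move=> _ /PS pv; have [k [w [-> fE]]] := FS _ _ pv.
    by rewrite !is_child_cons; split=> -[].
  + by move=> _ _; split=> /is_child_nil.
  + move=> /PS pv _; have [k [w [-> fE]]] := FS _ _ pv.
    by rewrite !is_child_cons; split=> -[].
  + move=> /PS pu /PS pv; have [k [w [-> fu]]] := FS _ _ pu.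
    have [k' [w' [-> fv]]] := FS _ _ pv; have := fc _ _ pu pv.
    rewrite fu fv !is_child_cons => h.
    by split=> -[[e] c]; [have [] := h.1 (conj e c)|have [] := h.2 (conj e c)] => -> ?.
Qed.

(** Self-similarity of Kesten's tree: above the first spine vertex it is built
    in the same way from the shifted data. The arguments on Kesten's tree are
    inductions along this identity. *)
Lemma kesten_treeE X T :
  kesten_tree X T = bracket (kesten_tree (X \o S) (T \o S) :: mkseq (T 0) (X 0)).
Proof.
set r := pspine (fun n => repr (bracket (mkseq (T n.+1) (X n.+1)))).
set ts := mkseq _ _.
transitivity (shape (pbracket (r :: map repr ts))); last first.
  rewrite shape_pbracket /= -map_comp; congr (bracket (_ :: _)).
  by rewrite -[RHS]map_id; apply: eq_map => t /=; rewrite shape_repr.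
apply/eq_shape.
apply: (@graft_iso r (repr (bracket ts)) (pbracket (map repr ts))) => //.
- move=> v; rewrite (verts_pbracket_cons r) /=; by split=> // -[].
- exact: (eq_shape _ _).1 (shape_repr _).
Qed.

Lemma tree_iso_ptrunc k p q : tree_iso p q -> tree_iso (ptrunc k p) (ptrunc k q).
Proof.
case=> f isof; have sz := is_tree_iso_size isof.
case: isof => -[f1 f2 f3] f0 fc; exists f; split => //.
- split.
  + by move=> u [pu uk]; split; [exact: f1|rewrite sz].
  + move=> u v; rewrite !inE => -[pu _] [pv _]; apply: f2; rewrite inE//.
  + move=> v [qv vk]; have [u pu fu] := f3 _ qv; exists u => //; split => //.
    by rewrite -(sz _ pu) fu.
- by move=> u v [pu _] [pv _]; exact: fc.
Qed.

Lemma trunc_shape k p : trunc k (shape p) = shape (ptrunc k p).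
Proof.
apply/eq_shape; apply: tree_iso_ptrunc; apply/eq_shape; exact: shape_repr.
Qed.

Lemma ptrunc_pbracket k ps :
  ptrunc k.+1 (pbracket ps) = pbracket (map (ptrunc k) ps).
Proof.
apply: planeTree_eq; apply/seteqP; split=> -[|i v] //=.
- by move=> [[p pi pv] vk]; exists (ptrunc k p) => //; rewrite onth_map pi.
- move=> [q]; rewrite onth_map; case E : (onth ps i) => [p|] //= [<-] [pv vk].
  by split=> //; exists p.
Qed.

(** This identity is what allows inductions on the radius of truncation. *)
Lemma trunc_bracket k ts : trunc k.+1 (bracket ts) = bracket (map (trunc k) ts).
Proof.
rewrite [bracket ts]/bracket trunc_shape ptrunc_pbracket shape_pbracket.
by rewrite -!map_comp.
Qed.

Lemma trunc_root t s : trunc 0 t = trunc 0 s.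
Proof.
congr shape; apply: planeTree_eq; apply/seteqP.
by split=> -[|i v] [] // _ _; split => //; exact: verts_root.
Qed.

Lemma trunc_trunc k t : trunc k (trunc k t) = trunc k t.
Proof.
rewrite {2}/trunc trunc_shape; congr shape; apply: planeTree_eq.
by apply/seteqP; split=> v [] // [].
Qed.

Lemma tree_iso_finite p q : tree_iso p q -> finite_plane p -> finite_plane q.
Proof.
case=> f [[_ _ f3] _ _] fin; apply: sub_finite_set (finite_image f fin) => v /f3.
by case=> u pu <-; exists u.
Qed.

Lemma finite_tree_shape p : finite_tree (shape p) <-> finite_plane p.
Proof.
have iso : tree_iso (repr (shape p)) p by apply/eq_shape; exact: shape_repr.
by split; apply: tree_iso_finite => //; exact: tree_iso_sym.
Qed.

Lemma finite_trunc k t : finite_tree (trunc k t).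
Proof.
rewrite -[t]shape_repr trunc_shape; apply/finite_tree_shape; move: (repr t) => {t}.
elim: k => [|k IH] p.
  apply: (@sub_finite_set _ _ [set [::]]); last exact: finite_set1.
  by move=> [|i v] [].
rewrite -[p]pbracket_children ptrunc_pbracket; apply/finite_pbracket => i q.
by rewrite onth_map; case: (onth _ _) => //= p' [<-].
Qed.

Lemma trunc_le k j t : (j <= k)%N -> trunc j (trunc k t) = trunc j t.
Proof.
move=> jk; rewrite {2}/trunc trunc_shape; congr (shape _); apply: planeTree_eq.
apply/seteqP; split=> v [] //; first by case.
by move=> pv vj; split => //; split => //; exact: leq_trans jk.
Qed.

Lemma all_inP (T : eqType) (A : set T) (s : seq T) :
  all_in A s <-> forall x, x \in s -> A x.
Proof.
split=> [h x /onthP[i] /h//|h i x ix]; apply: h.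
by apply/onthP; exists i.
Qed.

Lemma perm_all_in (T : eqType) (A : set T) (s t : seq T) :
  perm_eq s t -> all_in A s = all_in A t.
Proof.
move=> st; apply/propext; rewrite !all_inP; split=> h x.
  by rewrite -(perm_mem st); exact: h.
by rewrite (perm_mem st); exact: h.
Qed.

(** These sets are open and closed for the local topology. *)
Definition is_local k (B : set tree) :=
  forall t s, trunc k t = trunc k s -> B t -> B s.

(** Fixing all the trees attached to the root but one lowers by one the radius
    on which membership depends. *)
Definition extend (B : set tree) (ts : seq tree) : set tree :=
  [set t | B (bracket (t :: ts))].

Lemma is_local_extend k B ts : is_local k.+1 B -> is_local k (extend B ts).
Proof.
by move=> lB t s ts_eq; apply: lB; rewrite !trunc_bracket /= ts_eq.
Qed.

(** * Number of vertices with a marked number of children *)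

(** The number of vertices for [xpredT] and the number of leaves for
    [pred1 0]. *)
Definition marked_size (w : pred nat) p :=
  \sum_(u <- fset_set (verts p)) (w (nchildren p u) : nat).

Lemma marked_size_pbracket w ps : all_in finite_plane ps ->
  marked_size w (pbracket ps) = w (size ps) + \sum_(p <- ps) marked_size w p.
Proof. exact: (@big_pbracket _ _ addn (fun k => w k : nat)). Qed.

Lemma nchildren_iso p q f u : is_tree_iso p q f -> verts p u ->
  nchildren q (f u) = nchildren p u.
Proof.
case=> -[f1 f2 f3] f0 fc pu.
pose g i := last 0 (f (rcons u i)).
have gE i : verts p (rcons u i) -> f (rcons u i) = rcons (f u) (g i).
  move=> pui; have [|j fui] := (fc _ _ pu pui).1; first by exists i.
  by rewrite /g fui last_rcons.
have inj_g : {in `I_(nchildren p u) &, injective g}.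
  move=> i j; rewrite !inE => /nchildrenP pi /nchildrenP pj gij.
  have : rcons u i = rcons u j by apply: f2; rewrite ?inE// !gE// gij.
  by move=> /(congr1 (last 0)); rewrite !last_rcons.
have : (g @` `I_(nchildren p u) #= `I_(nchildren p u))%card by exact: inj_card_eq.
have -> : g @` `I_(nchildren p u) = `I_(nchildren q (f u)).
  apply/seteqP; split=> [_ [i /nchildrenP pi <-]|j /nchildrenP qj] /=.
    by apply/nchildrenP; rewrite -gE//; exact: f1.
  have [v pv fv] := f3 _ qj.
  have [|i vE] := (fc _ _ pu pv).2; first by exists j.
  subst v; exists i; first exact/nchildrenP.
  by rewrite /g fv last_rcons.
by rewrite card_eq_le !card_le_II => /andP[h1 h2]; apply/eqP; rewrite eqn_leq h1 h2.
Qed.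

Lemma marked_size_iso w p q : finite_plane p -> tree_iso p q ->
  marked_size w p = marked_size w q.
Proof.
move=> finp pq; have finq := tree_iso_finite pq finp.
case: pq => f isof; have := isof; case=> -[f1 f2 f3] _ _.
have pe : perm_eq (fset_set (verts q)) (map f (fset_set (verts p))).
  apply: uniq_perm; first exact: fset_uniq.
    rewrite map_inj_in_uniq ?fset_uniq// => u v.
    by rewrite !in_fset_set// => pu pv; exact: f2.
  move=> v; rewrite in_fset_set//; apply/idP/mapP => [|[u]].
    rewrite inE => /f3[u pu <-]; exists u => //.
    by rewrite in_fset_set// inE.
  by rewrite in_fset_set// !inE => pu ->; exact: f1.
rewrite /marked_size (perm_big _ pe) big_map big_seq [RHS]big_seq.
by apply: eq_bigr => u; rewrite in_fset_set// inE => pu; rewrite (nchildren_iso isof).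
Qed.

(** Finiteness is required because [fset_set] sends infinite sets to the empty
    set, so that [marked_size] is only meaningful for finite trees. *)
Definition sized (w : pred nat) n : set tree :=
  [set t | finite_tree t /\ marked_size w (repr t) = n].

Lemma sized_shape w n p :
  sized w n (shape p) <-> finite_plane p /\ marked_size w p = n.
Proof.
have iso : tree_iso p (repr (shape p)) by apply/eq_shape; rewrite shape_repr.
rewrite /sized /=; split=> -[h <-].
  by move/finite_tree_shape : h => h; split => //; rewrite (marked_size_iso _ h iso).
by split; [exact/finite_tree_shape|rewrite (marked_size_iso _ h iso)].
Qed.

Lemma card_II_fset (T : choiceType) (A : set T) n : finite_set A ->
  (A #= `I_n)%card <-> #|` fset_set A| = n.
Proof.
move=> finA; split=> [/card_fset_set//|An].
by apply/fcard_eq => //; rewrite An fset_set_II card_imfset /=; [rewrite size_enum_ord|exact: val_inj].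
Qed.

Lemma leaf_nchildren p u : leaves p u <-> verts p u /\ nchildren p u = 0.
Proof.
split=> -[pu h]; split=> //.
  apply/eqP; rewrite -leqn0 leqNgt; apply/negP => /nchildrenP; exact: h.
by move=> i /nchildrenP; rewrite h.
Qed.

Lemma trees_with_verticesE n : trees_with_vertices n `&` @finite_tree = sized xpredT n.
Proof.
apply/seteqP; split=> t; rewrite /trees_with_vertices /sized /=.
  move=> [/(card_fset_set) <- fin]; split => //.
  by rewrite /marked_size sum1_size.
by move=> [fin <-]; split => //; apply/card_II_fset => //; rewrite /marked_size sum1_size.
Qed.

Lemma trees_with_leavesE n : trees_with_leaves n `&` @finite_tree = sized (pred1 0) n.
Proof.
have cardL p : finite_plane p -> finite_set (leaves p) /\
    #|` fset_set (leaves p)| = marked_size (pred1 0) p.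
  move=> fin; have finL : finite_set (leaves p).
    by apply: sub_finite_set fin => u [].
  split => //; rewrite /marked_size.
  have -> : \sum_(u <- fset_set (verts p)) (pred1 0 (nchildren p u) : nat) =
      count (fun u => nchildren p u == 0) (fset_set (verts p)).
    by rewrite -sum1_count [RHS]big_mkcond; apply: eq_bigr => u _ /=; case: eqP.
  rewrite -size_filter; apply: perm_size; apply: uniq_perm.
  - exact: fset_uniq.
  - by rewrite filter_uniq// fset_uniq.
  move=> u; rewrite mem_filter !in_fset_set//.
  apply/idP/andP; rewrite !inE.
    by move=> /leaf_nchildren[pu ->].
  by move=> [/eqP n0 pu]; apply/leaf_nchildren.
apply/seteqP; split=> t; rewrite /trees_with_leaves /sized /=.
  move=> [h fin]; have [finL <-] := cardL _ fin; split => //; exact: card_fset_set.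
by move=> [fin <-]; have [finL <-] := cardL _ fin; split => //; exact/card_II_fset.
Qed.

Local Open Scope ring_scope.

(** * Lagrange inversion and the reduced offspring law *)

Section PowerSeries.
Variable F : numFieldType.
Implicit Types A P p q : {poly F}.

Lemma coef_exp_lt A k m : A`_0 = 0 -> (m < k)%N -> (A ^+ k)`_m = 0.
Proof.
move=> A0 mk.
have -> : A = drop_poly 1 A * 'X.
  by apply/polyP => -[|i]; rewrite coefMX ?coef_drop_poly ?addn1.
by rewrite exprMn coefMXn mk.
Qed.

Lemma coefM_agree (N : nat) p p' q q' :
  (forall i, (i <= N)%N -> p`_i = p'`_i) ->
  (forall i, (i <= N)%N -> q`_i = q'`_i) ->
  forall i, (i <= N)%N -> (p * q)`_i = (p' * q')`_i.
Proof.
move=> pp qq i iN; rewrite !coefM; apply: eq_bigr => -[j /= ji] _.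
by rewrite pp ?qq//; lia.
Qed.

Lemma coef_exp_agree (N : nat) p p' k :
  (forall i, (i <= N)%N -> p`_i = p'`_i) ->
  forall i, (i <= N)%N -> (p ^+ k)`_i = (p' ^+ k)`_i.
Proof.
move=> pp; elim: k => [|k IH] i iN; first by rewrite !expr0.
by rewrite !exprS; apply: (coefM_agree pp IH).
Qed.

(** Polynomials stand for power series known up to the order N. For a step law
    P this is the hitting time theorem: the coefficient on the left is the
    probability that a forest of k trees has total size m, the one on the right
    that m independent steps sum to m - k. The induction on m removes the first
    step; the sum over its value is evaluated by exchangeability of the steps,
    that is by differentiating a power of P. *)
Lemma lagrange_inversion A P N :
  A`_0 = 0 -> (forall i, (i < N)%N -> A`_i.+1 = (P \Po A)`_i) ->
  forall m k, (k <= m)%N -> (m <= N)%N ->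
    (A ^+ k)`_m *+ m = (P ^+ m)`_(m - k) *+ k.
Proof.
move=> A0 AP.
have shiftA k m : (m < N)%N -> (A ^+ k.+1)`_m.+1 = (A ^+ k * (P \Po A))`_m.
  move=> mN; rewrite exprS mulrC [RHS]coefM coefM big_ord_recr /= subnn A0 mulr0 addr0.
  apply: eq_bigr => -[i /= im] _; rewrite subSn// AP//.
  by apply: leq_ltn_trans mN; exact: leq_subr.
elim=> [|m IH] [|k] // km mN; first by rewrite expr0 coef1 mul0rn mulr0n.
rewrite shiftA//; case: m IH km mN => [|m] IH km mN.
  have -> : k = 0%N by lia.
  rewrite expr0 mul1r expr1 subnn coef_comp_poly !mulr1n.
  case sP : (size P) => [|n]; first by rewrite big_ord0 nth_default ?sP.
  rewrite big_ord_recl expr0 coef1 mulr1 big1 ?addr0// => i _.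
  by rewrite coef_exp_lt ?mulr0.
set M := m.+1 in IH km mN *.
rewrite subSS; set s := (M - k)%N.
have eqF : (A ^+ k * (P \Po A))`_M = \sum_(i < size P) P`_i * (A ^+ (k + i))`_M.
  rewrite comp_polyE mulr_sumr coef_sum; apply: eq_bigr => i _.
  by rewrite -scalerAr coefZ exprD.
(* The first step takes the value i; the factor k + i given by the induction
     hypothesis splits into a convolution power and a first moment. *)
have eqmF : (A ^+ k * (P \Po A))`_M *+ M =
    (P ^+ M.+1)`_s *+ k + ('X * P^`() * P ^+ M)`_s.
  rewrite eqF -sumrMnl.
  rewrite (eq_bigr (fun i : 'I_(size P) =>
      if (i < s.+1)%N then (P`_i * (P ^+ M)`_(s - i)) *+ (k + i) else 0)); last first.
    move=> i _; case: ifPn => is_; last first.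
      by rewrite coef_exp_lt ?mulr0 ?mul0rn//; lia.
    rewrite -[LHS]mulrnAr IH; [|lia|exact: ltnW].
    by rewrite mulrnAr; have -> : (M - (k + i) = s - i)%N by lia.
  rewrite -big_mkcond /=.
  transitivity (\sum_(i < s.+1) (P`_i * (P ^+ M)`_(s - i)) *+ (k + i)).
    pose G i := (P`_i * (P ^+ M)`_(s - i)) *+ (k + i).
    have E n : (size P <= n)%N ->
        \sum_(i < size P | (i < s.+1)%N) G i = \sum_(i < n | (i < s.+1)%N) G i.
      move=> Pn; rewrite (big_ord_widen_cond n (fun i => i < s.+1)%N G)//.
      rewrite big_mkcondr /=; apply: eq_bigr => i _.
      by case: ltnP => // Pi; rewrite /G nth_default// mul0r mul0rn.
    rewrite (E (size P + s.+1)%N) ?leq_addr//.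
    by rewrite [RHS](big_ord_widen (size P + s.+1) G) ?leq_addl.
  rewrite exprS coefM.
  have -> : ('X * P^`() * P ^+ M)`_s = \sum_(i < s.+1) (P`_i * (P ^+ M)`_(s - i)) *+ i.
    rewrite coefM; apply: eq_bigr => i _; rewrite coefXM.
    case: i => -[|i] //= is_; first by rewrite mul0r mulr0n.
    by rewrite coef_deriv mulrnAl.
  rewrite -sumrMnl -big_split /=; apply: eq_bigr => i _.
  by rewrite mulrnDr.
(* The first moment is read off the derivative of P ^+ M.+1. *)
have eqD : ('X * P^`() * P ^+ M)`_s *+ M.+1 = (P ^+ M.+1)`_s *+ s.
  rewrite -mulrA -coefMn -mulrnAr -[M in P ^+ M]/(M.+1.-1) -deriv_exp coefXM.
  by case: (s) => [|s'] //=; rewrite coef_deriv.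
have M0 : (M%:R : F) != 0 by rewrite pnatr_eq0.
have sE : (s%:R : F) = M%:R - k%:R by rewrite -natrB//; lia.
have cancelM (X Q D : F) : X *+ M = Q *+ k + D -> D *+ M.+1 = Q *+ s ->
    X *+ M.+1 = Q *+ k.+1.
  rewrite -(mulr_natl X M) -(mulr_natl Q k) -(mulr_natl D M.+1) -(mulr_natl Q s).
  rewrite -(mulr_natl X M.+1) -(mulr_natl Q k.+1) sE -(natr1 M) -(natr1 k) => h1 h2.
  by apply: (mulfI M0); rewrite mulrCA h1 mulrDr h2; ring.
exact: cancelM eqmF eqD.
Qed.

Lemma coef_comp_val A p i : A`_0 = 0 ->
  (p \Po A)`_i = \sum_(j < i.+1) p`_j * (A ^+ j)`_i.
Proof.
move=> A0; rewrite coef_comp_poly.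
pose G j := p`_j * (A ^+ j)`_i.
have big n : (n <= size p + i.+1)%N -> (forall j : nat, (n <= j)%N -> G j = 0) ->
    \sum_(j < n) G j = \sum_(j < (size p + i.+1)%N) G j.
  move=> nK h; rewrite (big_ord_widen _ G nK) big_mkcond.
  by apply: eq_bigr => j _; case: ltnP => // /h.
rewrite (big _ (leq_addr _ _)) => [|j pj]; last by rewrite /G nth_default ?mul0r.
by rewrite [RHS](big _ (leq_addl _ _)) => [//|j pj]; rewrite /G coef_exp_lt ?mulr0.
Qed.

Lemma coef_cancel (N : nat) p p' q : q`_0 != 0 ->
  (forall i, (i <= N)%N -> (p * q)`_i = (p' * q)`_i) ->
  forall i, (i <= N)%N -> p`_i = p'`_i.
Proof.
move=> q0 pq; elim/ltn_ind => i IH iN.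
have := pq i iN; rewrite !coefM !big_ord_recr /= subnn.
rewrite (eq_bigr (fun j : 'I_i => p'`_j * q`_(i - j))) => [/addrI/mulIf->//|j _].
by rewrite IH// (leq_trans (ltnW (ltn_ord j))).
Qed.

End PowerSeries.

Section Reduced.
Variables (F : numFieldType) (xi : nat -> F) (w : pred nat).

Definition marked_coef k := if w k then xi k else 0.
Definition unmarked_coef k := if w k.+1 then 0 else xi k.+1.

(** The coefficients of M / (1 - U), where M has the coefficients [marked_coef]
    and U the coefficients [unmarked_coef], that is the sum of xi_k X^(k-1) over
    the k > 0 that are not marked. The list of the first n coefficients is
    computed because each coefficient depends on all the previous ones. *)
Fixpoint reduced_prefix n : seq F :=
  if n is m.+1 then
    let l := reduced_prefix m in
    rcons l ((marked_coef m + \sum_(i < m) l`_i * unmarked_coef (m - i)) /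
             (1 - unmarked_coef 0))
  else [::].

(** The offspring law of the tree spanned by the marked vertices: unmarked
    vertices are merged with a marked descendant, and an unmarked vertex with
    k children brings k - 1 new subtrees. *)
Definition reduced_law n := (reduced_prefix n.+1)`_n.

Lemma size_reduced_prefix n : size (reduced_prefix n) = n.
Proof. by elim: n => //= n IH; rewrite size_rcons IH. Qed.

Lemma nth_reduced_prefix n i : (i < n)%N -> (reduced_prefix n)`_i = reduced_law i.
Proof.
elim: n => // n IH; rewrite ltnS leq_eqVlt => /predU1P[->//|i_n].
by rewrite /= nth_rcons size_reduced_prefix i_n IH.
Qed.

Hypothesis unmarked0 : unmarked_coef 0 != 1.

Lemma reduced_lawE n : reduced_law n =
  marked_coef n + \sum_(i < n.+1) reduced_law i * unmarked_coef (n - i).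
Proof.
have u0 : 1 - unmarked_coef 0 != 0 by rewrite subr_eq0 eq_sym.
rewrite big_ord_recr /= subnn.
have : reduced_law n * (1 - unmarked_coef 0) = 
       marked_coef n + \sum_(i < n) reduced_law i * unmarked_coef (n - i).
  rewrite {1}/reduced_law /= nth_rcons size_reduced_prefix ltnn eqxx divfK//.
  by congr (_ + _); apply: eq_bigr => i _; rewrite nth_reduced_prefix.
by rewrite mulrBr mulr1 => /eqP; rewrite subr_eq -addrA => /eqP.
Qed.

(** Separating marked and unmarked roots, the equation for A reads
    A = X M(A) + A U(A). As the reduced law satisfies Phi (1 - U) = M,
    composing with A and cancelling 1 - U(A), whose constant coefficient does
    not vanish, leaves A = X Phi(A). *)
Lemma reduced_law_functional a N : w 0 -> a 0 = 0 ->
  (forall n, (n <= N)%N -> a n = \sum_(k < N.+1)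
     xi k * ('X^(w k) * (\poly_(i < N.+1) a i) ^+ k)`_n) ->
  forall i, (i < N)%N -> (\poly_(i < N.+1) a i)`_i.+1 =
    (\poly_(i < N.+1) reduced_law i \Po \poly_(i < N.+1) a i)`_i.
Proof.
move=> w0 a0; set A := \poly_(i < N.+1) a i; set P := \poly_(i < _) _ => aE.
have A0 : A`_0 = 0 by rewrite coef_poly.
pose M := \poly_(i < N.+1) marked_coef i.
pose U := \poly_(i < N.+1) unmarked_coef i.
have PU i : (i <= N)%N -> (P * (1 - U))`_i = M`_i.
  move=> iN; rewrite mulrBr mulr1 coefB !coef_poly ltnS iN reduced_lawE.
  rewrite coefM -addrA -sumrB big1 ?addr0// => -[j /= ji] _.
  by rewrite !coef_poly !ifT ?subrr//; lia.
have AE i : (i <= N)%N -> A`_i = ('X * (M \Po A) + A * (U \Po A))`_i.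
  move=> iN; rewrite coef_poly ltnS iN aE// coefD.
  have -> : 'X * (M \Po A) = \sum_(k < N.+1) marked_coef k *: ('X * A ^+ k).
    rewrite [M]poly_def raddf_sum mulr_sumr /=; apply: eq_bigr => k _.
    by rewrite linearZ /= comp_Xn_poly -scalerAr.
  have -> : (A * (U \Po A))`_i =
      (\sum_(k < N.+1) (if w k then 0 else xi k) *: A ^+ k)`_i.
    rewrite [U]poly_def raddf_sum mulr_sumr /= !coef_sum big_ord_recr /=.
    rewrite [RHS]big_ord_recl w0 scale0r coef0 add0r.
    rewrite linearZ /= comp_Xn_poly -scalerAr coefZ -exprS coef_exp_lt//.
    rewrite mulr0 addr0; apply: eq_bigr => k _.
    by rewrite linearZ /= comp_Xn_poly -scalerAr -exprS.
  rewrite !coef_sum -big_split; apply: eq_bigr => k _ /=.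
  rewrite !coefZ /marked_coef; case: (w k) => /=.
    by rewrite expr1 mul0r addr0.
  by rewrite expr0 mul1r mul0r add0r.
have U0 : (1 - (U \Po A))`_0 != 0.
  rewrite coefB coef1 coef_comp_val// big_ord1 expr0 coef1 mulr1 coef_poly /=.
  by rewrite subr_eq0 eq_sym.
have AP i : (i <= N)%N -> A`_i = ('X * (P \Po A))`_i.
  move: i; apply: (coef_cancel U0) => i iN.
  rewrite mulrBr mulr1 coefB AE// coefD addrK -mulrA.
  apply: (coefM_agree (N := N)) => // j jN.
  have -> : (P \Po A) * (1 - (U \Po A)) = (P * (1 - U)) \Po A.
    by rewrite comp_polyM comp_polyB comp_polyC.
  rewrite !coef_comp_val//; apply: eq_bigr => -[k /= kj] _.
  by rewrite PU//; lia.
by move=> i iN; rewrite AP// coefXM.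
Qed.

End Reduced.

Lemma le_sum_coef_horner (F : realFieldType) (p : {poly F}) N :
  (forall i, 0 <= p`_i) -> \sum_(i < N) p`_i <= p.[1].
Proof.
move=> p0; rewrite horner_coef.
rewrite [leRHS](eq_bigr (fun i : 'I_(size p) => p`_i)); last first.
  by move=> i _; rewrite expr1n mulr1.
have h n : (n <= N + size p)%N -> \sum_(i < n) p`_i <= \sum_(i < N + size p) p`_i.
  move=> nK; rewrite (big_ord_widen _ _ nK) big_mkcond; apply: ler_sum => i _.
  by case: ifP.
apply: le_trans (h _ (leq_addr _ _)) _.
rewrite [leRHS](big_ord_widen (N + size p) _ (leq_addl _ _)).
rewrite [leRHS]big_mkcond; apply: ler_sum => i _.
by case: ltnP => // Pi; rewrite nth_default.
Qed.

Lemma horner1_poly (F : realFieldType) (f : nat -> F) N :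
  (\poly_(i < N) f i).[1] = \sum_(i < N) f i.
Proof.
by rewrite horner_poly; apply: eq_bigr => i _; rewrite expr1n mulr1.
Qed.

Section ReducedLaw.
Variables (F : realFieldType) (xi : nat -> F) (w : pred nat).
Hypothesis w0 : w 0%N.
Hypothesis xi_ge0 : forall k, 0 <= xi k.
Hypothesis xi_sum : forall n, \sum_(k < n) xi k <= 1.
Hypothesis xi0_gt0 : 0 < xi 0%N.

Local Notation phi := (reduced_law xi w).
Local Notation marked := (marked_coef xi w).
Local Notation unmarked := (unmarked_coef xi w).

Lemma marked_ge0 k : 0 <= marked k.
Proof. by rewrite /marked_coef; case: ifP. Qed.

Lemma unmarked_ge0 k : 0 <= unmarked k.
Proof. by rewrite /unmarked_coef; case: ifP. Qed.

Lemma sum_unmarked n : \sum_(k < n) unmarked k <= 1 - xi 0%N.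
Proof.
have := xi_sum n.+1; rewrite big_ord_recl addrC -lerBrDr; apply: le_trans.
by apply: ler_sum => i _; rewrite /unmarked_coef; case: ifP.
Qed.

Lemma unmarked0_neq1 : unmarked 0%N != 1.
Proof.
have := sum_unmarked 1; rewrite big_ord1 => h.
by apply/negP => /eqP e; move: xi0_gt0 h; rewrite e; lra.
Qed.

Let phiE := reduced_lawE unmarked0_neq1.

Lemma reduced_law_ge0 n : 0 <= phi n.
Proof.
elim/ltn_ind: n => n IH.
have u1 : 0 < 1 - unmarked 0%N.
  by have := sum_unmarked 1; rewrite big_ord1; move: xi0_gt0; lra.
rewrite -(pmulr_lge0 _ u1) mulrBr mulr1 subr_ge0 {2}phiE.
rewrite big_ord_recr /= subnn addrA lerDr addr_ge0 ?marked_ge0//.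
by apply: sumr_ge0 => i _; rewrite mulr_ge0 ?IH ?unmarked_ge0.
Qed.

Lemma reduced_law_ge_marked n : marked n <= phi n.
Proof.
rewrite phiE lerDl; apply: sumr_ge0 => i _.
by rewrite mulr_ge0 ?reduced_law_ge0 ?unmarked_ge0.
Qed.

Lemma reduced_law_ge_unmarked n i : phi n * unmarked i <= phi (n + i)%N.
Proof.
have nin : (n < (n + i).+1)%N by rewrite ltnS leq_addr.
rewrite [leRHS]phiE (bigD1 (Ordinal nin)) //= addKn.
rewrite addrCA lerDl addr_ge0 ?marked_ge0//; apply: sumr_ge0 => j _.
by rewrite mulr_ge0 ?reduced_law_ge0 ?unmarked_ge0.
Qed.

(** Summing the recursive equation bounds a partial sum s by m + s b, where
    m + b <= 1 and b < 1 are partial sums of the two families of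
    coefficients. *)
Lemma reduced_law_sum n : \sum_(k < n) phi k <= 1.
Proof.
set s := \sum_(k < n) phi k; set b := \sum_(k < n) unmarked k.
set m := \sum_(k < n) marked k.
have s0 : 0 <= s by apply: sumr_ge0 => i _; exact: reduced_law_ge0.
have b1 : b <= 1 - xi 0%N := sum_unmarked n.
have mb : m + b <= 1.
  have := xi_sum n.+1; apply: le_trans.
  rewrite /m /b (le_trans (y := marked 0%N + \sum_(k < n) (marked k.+1 + unmarked k)))//.
    rewrite big_split /= addrA lerD2r -(big_ord_recl n (fun k => marked k)).
    by rewrite big_ord_recr lerDl marked_ge0.
  rewrite big_ord_recl lerD//; first by rewrite /marked_coef w0.
  apply: ler_sum => i _; rewrite /marked_coef /unmarked_coef /=.
  by case: (w _); rewrite ?addr0 ?add0r.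
have ssb : s <= m + s * b.
  rewrite {1}/s (eq_bigr _ (fun (i : 'I_n) _ => phiE i)) big_split lerD2l /=.
  rewrite /s /b -!horner1_poly -hornerM.
  apply: le_trans (@le_sum_coef_horner _ _ n _) => [|i].
    apply: ler_sum => i _; rewrite coefM; apply: ler_sum => -[j /= ji] _.
    by rewrite !coef_poly !ifT//; have := ltn_ord i; lia.
  rewrite coefM; apply: sumr_ge0 => j _; rewrite !coef_poly.
  by rewrite mulr_ge0//; case: ifP => _ //; rewrite ?reduced_law_ge0 ?unmarked_ge0.
have b1' : 0 < 1 - b by move: b1 xi0_gt0; lra.
by rewrite -(ler_pM2r b1') mul1r; move: ssb mb; lra.
Qed.

Lemma reduced_law_marked_gt0 k : w k -> 0 < xi k -> 0 < phi k.
Proof.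
move=> wk /lt_le_trans; apply.
by have := reduced_law_ge_marked k; rewrite /marked_coef wk.
Qed.

Lemma reduced_law_unmarked_gt0 k : ~~ w k.+1 -> 0 < xi k.+1 -> 0 < phi k.
Proof.
move=> wk xk; apply: lt_le_trans (reduced_law_ge_unmarked 0 k).
by rewrite mulr_gt0 ?reduced_law_marked_gt0// /unmarked_coef (negbTE wk).
Qed.

(** When j is unmarked it only yields the value j - 1, possibly 1, of the
    reduced law; merging two such vertices yields 2 (j - 1). *)
Lemma reduced_law_big j : (2 <= j)%N -> 0 < xi j -> exists2 i, (2 <= i)%N & 0 < phi i.
Proof.
case: j => // j j2 xj; have [wj|wj] := boolP (w j.+1).
  by exists j.+1; rewrite ?reduced_law_marked_gt0.
exists (j + j)%N; first by lia.
apply: lt_le_trans (reduced_law_ge_unmarked j j).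
by rewrite mulr_gt0 ?reduced_law_unmarked_gt0// /unmarked_coef (negbTE wj).
Qed.

End ReducedLaw.

(** * Exponential tilting of convolution powers *)

Lemma expR_le_quadratic (R : realType) (t : R) :
  `|t| <= 2^-1 -> expR t <= 1 + t + 2 * t ^+ 2.
Proof.
move=> t2; have := expR_ge1Dx (- t); rewrite expRN => h.
have t1 : 0 < 1 - t by move: t2; rewrite ler_norml; lra.
have : expR t <= (1 - t)^-1.
  by rewrite -[expR t]invrK lef_pV2 ?posrE ?invr_gt0 ?expR_gt0.
move/le_trans; apply.
rewrite -(ler_pM2r t1) mulVf ?gt_eqF// -subr_ge0.
have -> : (1 + t + 2 * t ^+ 2) * (1 - t) - 1 = t ^+ 2 * (1 - 2 * t) by ring.
by rewrite mulr_ge0 ?sqr_ge0//; move: t2; rewrite ler_norml; lra.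
Qed.

(** The first moment of the binomial expansion, obtained by applying y d/dy. *)
Lemma sum_binomial_mulrn (S : comPzRingType) (x y : S) n :
  \sum_(i < n.+2) ((x ^+ (n.+1 - i) * y ^+ i) *+ 'C(n.+1, i)) *+ i =
  (y * (x + y) ^+ n) *+ n.+1.
Proof.
rewrite exprDn mulr_sumr -sumrMnl big_ord_recl mulr0n add0r.
apply: eq_bigr => i _; rewrite lift0 subSS exprS mulrCA -[in RHS]mulrnAr.
by rewrite -!mulrnAr -!mulrnA mulnC -mul_bin_diag mulnC.
Qed.

Section Convolution.
Variables (R : realType) (phi : nat -> R).
Hypothesis phi_ge0 : forall k, 0 <= phi k.
Hypothesis phi_sum : forall n, \sum_(k < n) phi k <= 1.

(** The probability that m independent steps of law phi have sum s; larger
    steps than s cannot contribute, which makes the truncation harmless. *)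
Definition conv_pow m s := ((\poly_(i < s.+1) phi i) ^+ m)`_s.
Local Notation b := conv_pow.

Lemma conv_powE N m s : (s < N)%N -> b m s = ((\poly_(i < N) phi i) ^+ m)`_s.
Proof.
move=> sN; apply: (coef_exp_agree (N := s)) => // i i_s.
by rewrite !coef_poly !ifT//; lia.
Qed.

Lemma coef_exp_ge0 (p : {poly R}) m s : (forall i, 0 <= p`_i) -> 0 <= (p ^+ m)`_s.
Proof.
move=> p0; elim: m s => [|m IH] s; first by rewrite expr0 coef1 ler0n.
by rewrite exprS coefM sumr_ge0// => i _; rewrite mulr_ge0.
Qed.

Lemma poly_law_ge0 N i : 0 <= (\poly_(i < N) phi i)`_i.
Proof. by rewrite coef_poly; case: ifP. Qed.

Lemma conv_pow_ge0 m s : 0 <= b m s.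
Proof. by apply: coef_exp_ge0 => i; exact: poly_law_ge0. Qed.

Lemma conv_pow1 s : b 1 s = phi s.
Proof. by rewrite /b expr1 coef_poly leqnn. Qed.

Lemma conv_powD m m' s s' : b m s * b m' s' <= b (m + m') (s + s').
Proof.
rewrite !(@conv_powE (s + s').+1) ?ltnS ?leq_addr ?leq_addl// exprD coefM.
have ss : (s < (s + s').+1)%N by rewrite ltnS leq_addr.
rewrite (bigD1 (Ordinal ss))//= addKn lerDl; apply: sumr_ge0 => i _.
by rewrite mulr_ge0//; apply: coef_exp_ge0 => ?; exact: poly_law_ge0.
Qed.

Lemma conv_powX m s k : b m s ^+ k <= b (k * m) (k * s).
Proof.
elim: k => [|k IH]; first by rewrite /b !mul0n !expr0 coef1.
rewrite exprS !mulSn; apply: le_trans (conv_powD _ _ _ _).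
by rewrite ler_wpM2l ?conv_pow_ge0.
Qed.

(** Let K be the number of steps equal to j among m + 1 steps. Conditionally on
    the sum being s + j, the mean of K is (m + 1) phi_j times the ratio on the
    left. Jensen's inequality for exp (t K) under this conditional law bounds
    the left-hand side by the expectation of exp (t K) on the event that the
    sum is s + j, a fortiori by the whole exponential moment of K. *)
Lemma conv_pow_tilt j m s t : 0 < b m.+1 (s + j) ->
  b m.+1 (s + j) * expR (t * (m.+1%:R * phi j * (b m s / b m.+1 (s + j)))) <=
  expR (m.+1%:R * (phi j * (expR t - 1))).
Proof.
set S := (s + j)%N; set p := phi j; set M := m.+1; move=> b0.
set mu := M%:R * p * _.
pose P := \poly_(i < S.+1) phi i.
(* The step j, which gets tilted, is separated from the other steps. *)
pose Y : {poly R} := p *: 'X^j.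
pose X : {poly R} := P - Y.
have Y0 i : 0 <= Y`_i.
  by rewrite coefZ coefXn; apply: mulr_ge0; rewrite ?ler0n /p.
have X0 i : 0 <= X`_i.
  rewrite coefB coefZ coefXn coef_poly; have [->|ij] := eqVneq i j.
    by rewrite mulr1 ltnS leq_addl subrr.
  by rewrite mulr0 subr0; case: ifP.
have PXY : P = X + Y by rewrite subrK.
pose W i := ((X ^+ (M - i) * Y ^+ i) *+ 'C(M, i))`_S.
have W0 i : 0 <= W i.
  rewrite /W coefMn mulrn_wge0// coefM sumr_ge0// => k _.
  by rewrite mulr_ge0// coef_exp_ge0.
have sumW : \sum_(i < M.+1) W i = b M S.
  by rewrite (@conv_powE S.+1)// -/P PXY exprDn coef_sum.
have sumiW : \sum_(i < M.+1) W i *+ i = b M S * mu.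
  under eq_bigr do rewrite -coefMn.
  rewrite -coef_sum sum_binomial_mulrn -PXY coefMn -scalerAl coefZ coefXnM.
  rewrite ltnNge leq_addl /= addnK -(@conv_powE S.+1) ?ltnS ?leq_addr//.
  by rewrite -mulr_natl -/M /mu; field; rewrite gt_eqF.
pose Q := X + expR t *: Y.
have Q0 i : 0 <= Q`_i by rewrite coefD coefZ addr_ge0// mulr_ge0// expR_ge0.
have QE : (Q ^+ M)`_S = \sum_(i < M.+1) expR (t *+ i) * W i.
  rewrite exprDn coef_sum; apply: eq_bigr => i _.
  by rewrite exprZn -scalerAr scalerMnr coefZ -(mulr_natl t i) expRM_natl.
have QM : (Q ^+ M)`_S <= expR (M%:R * (p * (expR t - 1))).
  apply: (@le_trans _ _ (Q ^+ M).[1]).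
    have := @le_sum_coef_horner _ (Q ^+ M) S.+1 (fun i => coef_exp_ge0 _ _ Q0).
    apply: le_trans; rewrite big_ord_recr lerDr sumr_ge0// => i _.
    exact: coef_exp_ge0.
  rewrite horner_exp mulrC expRM_natr lerXn2r ?nnegrE ?expR_ge0//.
    by apply: le_trans (le_sum_coef_horner 0 Q0); rewrite big_ord0.
  apply: le_trans (expR_ge1Dx _).
  rewrite /Q /X !(hornerD, hornerN, hornerZ, hornerXn) expr1n !mulr1 horner1_poly.
  have := phi_sum S.+1. lra.
apply: le_trans QM; rewrite QE.
(* The exponential lies above its tangent at the conditional mean. *)
have : \sum_(i < M.+1) expR (t * mu) * (1 + (t * i%:R - t * mu)) * W i <=
       \sum_(i < M.+1) expR (t *+ i) * W i.
  apply: ler_sum => i _; rewrite ler_wpM2r//.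
  rewrite -(mulr_natr t i) -[in leRHS](subrK (t * mu) (t * i%:R)) expRD mulrC.
  by rewrite ler_wpM2r ?expR_ge0 ?expR_ge1Dx.
apply: le_trans; rewrite mulrC.
under eq_bigr do rewrite -mulrA.
rewrite -mulr_sumr ler_wpM2l ?expR_ge0//.
under eq_bigr => i _ do rewrite mulrDl mul1r mulrBl -mulrA mulr_natl.
rewrite big_split sumrB /= -mulr_sumr -mulr_sumr sumiW sumW.
by rewrite -mulrA (mulrC mu) subrr addr0.
Qed.

(** Tilting with t = h and t = - h gives the upper and the lower bound. A
    conditioning event of probability exp (- c h^2 m) costs an error of the
    same order h as the quadratic term of the exponential. *)
Lemma conv_pow_ratio j m s (h : R) : 0 < h -> h <= 2^-1 -> 0 < phi j ->
  expR (- (phi j * h ^+ 2) *+ m.+1) <= b m.+1 (s + j) ->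
  `|b m s / b m.+1 (s + j) - 1| <= 3 * h.
Proof.
move=> h0 h2 p0 lb.
have b0 : 0 < b m.+1 (s + j) by apply: lt_le_trans lb; rewrite expR_gt0.
set r := _ / _; set p := phi j in p0 lb *.
have key t : `|t| = h -> t * r <= t + 3 * h ^+ 2.
  move=> th; have := @conv_pow_tilt j m s t b0; rewrite -/p -/r => H.
  have {H} : expR (- (p * h ^+ 2) *+ m.+1 + t * (m.+1%:R * p * r)) <=
      expR (m.+1%:R * (p * (expR t - 1))).
    by apply: le_trans H; rewrite expRD ler_wpM2r ?expR_ge0.
  rewrite ler_expR -mulr_natr.
  have := @expR_le_quadratic _ t; rewrite th => /(_ h2) Q.
  have t2 : t ^+ 2 = h ^+ 2 by rewrite -th real_normK ?num_real.
  rewrite {}t2 in Q.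
  set M : R := m.+1%:R; have M0 : 0 < M * p by rewrite mulr_gt0 ?ltr0n.
  move=> H; rewrite -(ler_pM2l M0).
  have : M * p * (expR t - 1) <= M * p * (t + 2 * h ^+ 2).
    by rewrite ler_pM2l//; move: Q; lra.
  move: H; lra.
have := key h; rewrite gtr0_norm// => /(_ erefl) k1.
have := key (- h); rewrite normrN gtr0_norm// => /(_ erefl) k2.
have h2E : h ^+ 2 = h * h by rewrite expr2.
rewrite ler_norml; apply/andP; split; rewrite -(ler_pM2l h0); move: k1 k2; rewrite h2E; lra.
Qed.

End Convolution.

(** * Ratios of size probabilities *)

Lemma near_forall_finite (I : choiceType) (X : set I) (T : Type) (F : set_system T)
    (FF : Filter F) (P : I -> T -> Prop) : finite_set X ->
  (forall i, X i -> \forall t \near F, P i t) ->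
  \forall t \near F, forall i, X i -> P i t.
Proof.
move=> /finite_seqP[s ->]; elim: s => [|i s IH] h.
  by apply: filterE => t j; rewrite /= in_nil.
have h1 := h i (mem_head _ _).
have h2 : \forall t \near F, forall j, [set` s] j -> P j t.
  by apply: IH => j js; apply: h; rewrite /= in_cons js orbT.
apply: filterS2 h1 h2 => t Pi Ps j /=; rewrite in_cons => /predU1P[->//|]; exact: Ps.
Qed.

Lemma expR_eventually_le (R : realType) (e c : R) : 0 < e -> 0 < c ->
  exists M : nat, forall n, (M <= n)%N -> expR (- (e * n%:R)) <= c.
Proof.
move=> e0 c0; exists (Num.trunc (`|ln c| / e)).+1 => n Mn.
rewrite -[leRHS]lnK ?posrE// ler_expR lerNl.
apply: (@le_trans _ _ `|ln c|); first by rewrite -normrN ler_norm.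
rewrite mulrC -ler_pdivrMr//; apply: le_trans (ltW (truncnS_gt _)) _.
by rewrite ler_nat.
Qed.

Lemma cvg_near_ext (T : Type) (F : set_system T) (FF : Filter F) (U : topologicalType)
    (f g : T -> U) (l : U) :
  f @ F --> l -> (\forall x \near F, f x = g x) -> g @ F --> l.
Proof.
move=> fl fg; apply: cvg_trans fl; apply: near_eq_cvg.
by apply: filterS fg => x ->.
Qed.

Section RatioStable.
Variables (R : realType) (a : nat -> R).
Local Notation F := (within [set n : nat | 0 < a n] \oo).

Let FF : Filter F. Proof. exact: within_filter. Qed.

Lemma near_posP (P : set nat) : (\forall n \near F, P n) <->
  exists M, forall n, (M <= n)%N -> 0 < a n -> P n.
Proof. by split=> -[M]; [move=> _ h; exists M => n /h|exists M]. Qed.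

Lemma pos_near M : \forall n \near F, (M <= n)%N.
Proof. by apply/near_posP; exists M. Qed.

Lemma a_near : \forall n \near F, 0 < a n.
Proof. by apply/near_posP; exists 0%N. Qed.

Lemma natr_shift_cvg j : n%:R / (n - j)%:R @[n --> F] --> (1 : R).
Proof.
apply/cvgrPdist_le => e e0.
have je : 0 <= j%:R / e by rewrite divr_ge0// ltW.
near=> n.
have jn : (j + (Num.trunc (j%:R / e)).+1 <= n)%N by near: n; exact: pos_near.
have nj : (0 < n - j)%N by lia.
have nj' : 0 < ((n - j)%:R : R) by rewrite ltr0n.
have -> : 1 - n%:R / (n - j)%:R = - (j%:R / (n - j)%:R) :> R.
  have -> : (n%:R : R) = (n - j)%:R + j%:R by rewrite -natrD subnK//; lia.
  by field; rewrite gt_eqF.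
rewrite normrN ger0_norm ?divr_ge0// ler_pdivrMr// mulrC -ler_pdivrMr//.
apply: le_trans (ltW (truncnS_gt _)) _; rewrite ler_nat.
by rewrite leq_subRL//; apply: leq_trans jn; rewrite leq_addr.
Unshelve. all: by end_near. Qed.

(** The limit is taken along the n with a n > 0. The set of these r is stable
    under addition. *)
Definition ratio_stable r := a (n - r)%N / a n @[n --> F] --> (1 : R).

Lemma ratio_stable0 : ratio_stable 0.
Proof.
apply: (@cvg_near_ext _ F FF _ (fun=> 1 : R)); first exact: cvg_cst.
near=> n; rewrite subn0 divff// gt_eqF//.
by near: n; exact: a_near.
Unshelve. all: by end_near. Qed.

Lemma ratio_stable_gt0 r : ratio_stable r -> \forall n \near F, 0 < a (n - r)%N.
Proof.
move=> /cvgrPdist_lt/(_ _ ltr01) rn; near=> n.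
have : `|1 - a (n - r)%N / a n| < 1 by near: n.
rewrite ltr_norml => /andP[_]; rewrite ltrBlDr ltrDl.
by rewrite pmulr_lgt0// invr_gt0; near: n; exact: a_near.
Unshelve. all: by end_near. Qed.

Lemma ratio_stable_shift r : ratio_stable r -> (n - r)%N @[n --> F] --> F.
Proof.
move=> /ratio_stable_gt0 rn P /near_posP[M HM]; rewrite /nbhs /=.
near=> n; apply: HM.
  by have : (M + r <= n)%N by [near: n; exact: pos_near]; lia.
by near: n.
Unshelve. all: by end_near. Qed.

Lemma ratio_stableD r r' : ratio_stable r -> ratio_stable r' -> ratio_stable (r + r').
Proof.
move=> hr hr'.
have := cvgM (FF := FF) (cvg_comp _ _ (ratio_stable_shift hr) hr') hr.
rewrite mulr1 => /(cvg_near_ext FF); apply.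
have pr := ratio_stable_gt0 hr; near=> n.
have : 0 < a (n - r)%N by near: n.
by move=> anr; rewrite /= mulrA divfK ?gt_eqF// subnDA.
Unshelve. all: by end_near. Qed.

End RatioStable.

Section RatioLimit.
Variables (R : realType) (phi a : nat -> R).
Hypothesis phi_ge0 : forall k, 0 <= phi k.
Hypothesis phi_sum : forall n, \sum_(k < n) phi k <= 1.
Hypothesis phi0 : 0 < phi 0%N.
Hypothesis phi_big : exists2 J, (2 <= J)%N & 0 < phi J.
Hypothesis a0 : a 0%N = 0.
Local Notation b := (conv_pow phi).
Hypothesis kemperman : forall n, (0 < n)%N -> n%:R * a n = b n n.-1.
Hypothesis subexp : forall (e : R) (M : nat), 0 < e ->
  exists2 n, (M <= n)%N & expR (- (e * n%:R)) <= a n.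

Local Notation F := (within [set n : nat | 0 < a n] \oo).
Local Notation u := (fun n => b n n.-1).

Let FF : Filter F. Proof. exact: within_filter. Qed.

Lemma u_pos n : (0 < n)%N -> (0 < u n) = (0 < a n).
Proof. by move=> n0; rewrite /= -kemperman// pmulr_rgt0 ?ltr0n. Qed.

(** A walk which is at n - 1 after n steps comes back to the diagonal by one
    step J >= 2 followed by J - 2 steps equal to 0. *)
Lemma return_subexp (e : R) : 0 < e ->
  exists2 m, (0 < m)%N & expR (- (e * m%:R)) <= b m m.
Proof.
move=> e0; have [J J2 pJ] := phi_big.
have c0 : 0 < phi J * phi 0%N ^+ (J - 2) by rewrite mulr_gt0 ?exprn_gt0.
have e20 : 0 < e / 2 by rewrite divr_gt0.
have [M HM] := expR_eventually_le e20 c0.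
have [n Mn an] := subexp (maxn M 1) e20.
have n0 : (0 < n)%N by lia.
exists (n + (1 + (J - 2)))%N; first by lia.
apply: (@le_trans _ _ (a n * (phi J * phi 0%N ^+ (J - 2)))).
  apply: (@le_trans _ _ (expR (- (e / 2 * n%:R)) * expR (- (e / 2 * n%:R)))).
    rewrite -expRD ler_expR -opprD lerN2 -mulrDl -splitr ler_pM2l// ler_nat.
    by rewrite leq_addr.
  by rewrite ler_pM ?expR_ge0// HM//; lia.
have -> : b (n + (1 + (J - 2))) (n + (1 + (J - 2))) =
    b (n + (1 + (J - 2))) (n.-1 + (J + (J - 2) * 0)).
  by congr conv_pow; lia.
apply: le_trans (conv_powD phi_ge0 _ _ _ _).
apply: ler_pM.
- by apply: le_trans an; rewrite expR_ge0.
- exact: ltW.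
- rewrite -kemperman// ler_peMl ?ler1n//.
  by apply: le_trans an; rewrite expR_ge0.
- apply: le_trans (conv_powD phi_ge0 _ _ _ _); rewrite conv_pow1 ler_pM2l//.
  by rewrite -(conv_pow1 phi 0) -{2}[(J - 2)%N]muln1; exact: conv_powX.
Qed.

(** A subexponential lower bound for one return time m propagates to the
    whole support: in each residue class modulo m that meets the support, n is
    reached from a fixed element n0 of the class by adding returns of length
    m. *)
Lemma u_subexp (e : R) : 0 < e -> \forall n \near F, expR (- (e * n%:R)) <= u n.
Proof.
move=> e0; apply/near_posP; have e20 : 0 < e / 2 by rewrite divr_gt0.
have [m m0 zm] := return_subexp e20.
(* Residue classes modulo m are treated one after the other. *)
suff [M HM] : exists M, forall n, (M <= n)%N -> (n %% m < m)%N -> 0 < a n ->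
    expR (- (e * n%:R)) <= u n.
  by exists M => n Mn; apply: HM; rewrite // ltn_mod.
elim: {2}m => [|k [M IH]]; first by exists 0%N.
have [[n0 [n0k an0]]|none] := pselect (exists n0, (n0 %% m = k)%N /\ 0 < a n0); last first.
  exists M => n Mn; rewrite ltnS leq_eqVlt => /predU1P[nk|]; last exact: IH.
  by move=> an; exfalso; apply: none; exists n.
have n0_gt0 : (0 < n0)%N by case: n0 an0 {n0k} => //; rewrite a0 ltxx.
have un0 : 0 < u n0 by rewrite u_pos.
have [M' HM'] := expR_eventually_le e20 un0.
exists (maxn M (maxn n0 M')) => n; rewrite !geq_max => /and3P[Mn n0n M'n].
rewrite ltnS leq_eqVlt => /predU1P[nk an|]; last exact: IH.
have [q nE] : exists q, n = (n0 + q * m)%N.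
  exists ((n - n0) %/ m)%N; rewrite divnK ?subnKC//.
  by rewrite -eqn_mod_dvd// nk n0k.
have -> : u n = b (n0 + q * m) (n0.-1 + q * m) by rewrite /= nE; congr conv_pow; lia.
apply: le_trans (conv_powD phi_ge0 _ _ _ _).
apply: le_trans (ler_wpM2l (ltW un0) (conv_powX phi_ge0 m m q)).
apply: (@le_trans _ _ (expR (- (e / 2 * n%:R)) * expR (- (e / 2 * m%:R)) ^+ q)).
  rewrite -expRM_natl -expRD ler_expR mulrN -opprD lerN2 mulrCA -natrM.
  rewrite [in leRHS](splitr e) mulrDl lerD2l ler_pM2l// ler_nat nE.
  exact: leq_addl.
apply: ler_pM; rewrite ?expR_ge0 ?exprn_ge0 ?expR_ge0//; first exact: HM'.
by rewrite lerXn2r ?nnegrE ?expR_ge0// (le_trans _ zm) ?expR_ge0.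
Qed.

Lemma subexp_equiv (v : nat -> R) : v n / u n @[n --> F] --> (1 : R) ->
  forall e : R, 0 < e -> \forall n \near F, expR (- (e * n%:R)) <= v n.
Proof.
move=> vu e e0; have e20 : 0 < e / 2 by rewrite divr_gt0.
have h0 : (0 : R) < 2^-1 by rewrite invr_gt0.
have [M HM] := expR_eventually_le e20 h0.
move/cvgrPdist_le : vu => /(_ _ h0) vu.
near=> n.
have un : 0 < u n by rewrite u_pos; near: n; [exact: a_near|exact: (pos_near a 1)].
apply: (@le_trans _ _ (expR (- (e / 2 * n%:R)) * expR (- (e / 2 * n%:R)))).
  by rewrite -expRD -opprD -mulrDl -splitr.
apply: (@le_trans _ _ (2^-1 * u n)).
  apply: ler_pM; rewrite ?expR_ge0//; first by apply: HM; near: n; exact: pos_near.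
  by near: n; exact: u_subexp.
have : `|1 - v n / u n| <= 2^-1 by near: n.
rewrite ler_norml => /andP[_]; rewrite -ler_pdivlMr//.
lra.
Unshelve. all: by end_near. Qed.

Lemma conv_pow_step j (m s : nat -> nat) : 0 < phi j ->
  (forall e : R, 0 < e -> \forall n \near F, expR (- (e * n%:R)) <= b (m n) (s n)) ->
  (\forall n \near F, [&& n <= 2 * m n, 0 < m n & j <= s n]%N) ->
  b (m n).-1 (s n - j) / b (m n) (s n) @[n --> F] --> (1 : R).
Proof.
move=> pj lb geom; apply/cvgrPdist_le => e e0.
pose h := Num.min 2^-1 (e / 3).
have h0 : 0 < h by rewrite lt_min invr_gt0 ltr0n divr_gt0.
have h2 : h <= 2^-1 by rewrite ge_min lexx.
have h3 : 3 * h <= e.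
  by rewrite mulrC -ler_pdivlMr// ge_min lexx orbT.
have c0 : 0 < phi j * h ^+ 2 / 2 by rewrite divr_gt0 ?mulr_gt0 ?exprn_gt0.
have {}lb := lb _ c0.
near=> n.
have /and3P[n2m m0 js] : [&& n <= 2 * m n, 0 < m n & j <= s n]%N by near: n.
have lbn : expR (- (phi j * h ^+ 2 / 2 * n%:R)) <= b (m n) (s n) by near: n.
rewrite distrC (le_trans _ h3)//.
have -> : b (m n) (s n) = b (m n).-1.+1 (s n - j + j) by rewrite prednK// subnK.
apply: conv_pow_ratio => //; rewrite prednK// subnK//; apply: le_trans lbn.
rewrite ler_expR mulNrn lerN2 -(mulr_natr _ (m n)) -mulrA ler_pM2l ?mulr_gt0 ?exprn_gt0//.
by rewrite ler_pdivrMl// -natrM ler_nat.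
Unshelve. all: by end_near. Qed.

(** One step j is removed first, then steps equal to 0, one at a time. After
    j - 1 of them the walk is again in a position of the form (n, n - 1), with
    n - j in place of n. *)
Lemma u_ratio_chain j i : (i < j)%N -> 0 < phi j ->
  b (n.-1 - i) (n.-1 - j) / u n @[n --> F] --> (1 : R).
Proof.
move=> ij pj; elim: i ij => [|i IH] ij.
  under eq_fun do rewrite subn0.
  apply: (@conv_pow_step j id predn) => //; first exact: u_subexp.
  near=> n; have : (j.+1 <= n)%N by near: n; exact: pos_near.
  by lia.
have {}IH := IH (ltnW ij).
have st : b (n.-1 - i).-1 (n.-1 - j - 0) / b (n.-1 - i) (n.-1 - j) @[n --> F] --> (1 : R).
  apply: (@conv_pow_step 0 (fun n => n.-1 - i)%N (fun n => n.-1 - j)%N) => //.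
    exact: subexp_equiv.
  near=> n; have : (j.+2 + j.+2 <= n)%N by near: n; exact: pos_near.
  by lia.
have := cvgM (FF := FF) st IH; rewrite mulr1 => /(cvg_near_ext FF); apply.
have lb := subexp_equiv IH ltr01.
near=> n.
have : expR (- (1 * n%:R)) <= b (n.-1 - i) (n.-1 - j) by near: n.
move=> /(lt_le_trans (expR_gt0 _)) => bn.
by rewrite /= subn0 subnS mulrA divfK ?gt_eqF.
Unshelve. all: by end_near. Qed.

Lemma ratio_stable_law j : (0 < j)%N -> 0 < phi j -> ratio_stable a j.
Proof.
case: j => // j _ pj.
have := cvgM (FF := FF) (u_ratio_chain (ltnSn j) pj) (natr_shift_cvg a j.+1).
rewrite mulr1 => /(cvg_near_ext FF); apply; near=> n.
have an : 0 < a n by near: n; exact: a_near.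
have jn : (j.+2 <= n)%N by near: n; exact: pos_near.
have e1 : (n.-1 - j = n - j.+1)%N by lia.
have e2 : (n.-1 - j.+1 = (n - j.+1).-1)%N by lia.
rewrite /= e1 e2.
have n1 : (n - j.+1)%:R != 0 :> R by rewrite pnatr_eq0; lia.
have n2 : n%:R != 0 :> R by rewrite pnatr_eq0; lia.
rewrite -!kemperman; [|lia|lia].
by field; rewrite n1 n2 gt_eqF.
Unshelve. all: by end_near. Qed.

Hypothesis a_ge0 : forall n, 0 <= a n.
Hypothesis functional : forall N i, (i < N)%N -> (\poly_(i < N.+1) a i)`_i.+1 =
    (\poly_(i < N.+1) phi i \Po \poly_(i < N.+1) a i)`_i.

(** The equation A = X Phi(A) provides a j with phi_j > 0 such that m - 1 is the
    sum of j and of the m_i - 1 for j smaller sizes m_i of positive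
    probability. *)
Lemma ratio_stable_size m : 0 < a m -> ratio_stable a m.-1.
Proof.
elim/ltn_ind: m => -[|m] IH /=; first by rewrite a0 ltxx.
pose A := \poly_(i < m.+2) a i.
have A0 i : 0 <= A`_i by rewrite coef_poly; case: ifP.
have -> : a m.+1 = A`_m.+1 by rewrite coef_poly ltnSn.
rewrite functional// coef_comp_val ?coef_poly//= => sum_gt0.
have pos_sum n (f : nat -> R) : (forall i, 0 <= f i) -> 0 < \sum_(j < n) f j ->
    exists2 j, (j < n)%N & 0 < f j.
  move=> f0 s0; apply: contrapT => none; move: s0; rewrite big1 ?ltxx// => i _.
  apply/eqP; rewrite eq_le f0 andbT leNgt; apply/negP => fi; apply: none.
  by exists i.
have AX j l : (l <= m)%N -> 0 < (A ^+ j)`_l -> (j <= l)%N /\ ratio_stable a (l - j).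
  elim: j l => [|j IHj] l lm.
    rewrite expr0 coef1 subn0; case: l lm => [|l] lm; last by rewrite ltxx.
    by split => //; exact: ratio_stable0.
  rewrite exprS coefM => /(pos_sum _ (fun i => A`_i * (A ^+ j)`_(l - i)))[i|i il].
    by rewrite mulr_ge0// coef_exp_ge0.
  rewrite coef_poly ifT; last by lia.
  move=> p0.
  have ai : 0 < a i.
    rewrite lt_neqAle a_ge0 andbT; apply: contraTN p0 => /eqP <-.
    by rewrite mul0r ltxx.
  rewrite pmulr_rgt0// in p0.
  have [jli sli] := IHj (l - i)%N (leq_trans (leq_subr _ _) lm) p0.
  have i0 : (0 < i)%N by case: (i) ai => //; rewrite a0 ltxx.
  split; first by lia.
  have -> : (l - j.+1 = i.-1 + (l - i - j))%N by lia.
  by apply: ratio_stableD sli; apply: IH => //; lia.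
have [j|j jm] := pos_sum _ (fun j => (\poly_(i < m.+2) phi i)`_j * (A ^+ j)`_m) _ sum_gt0.
  by rewrite mulr_ge0 ?coef_exp_ge0// coef_poly; case: ifP.
rewrite coef_poly ifT; last by lia.
move=> p0.
have pj : 0 < phi j.
  rewrite lt_neqAle phi_ge0 andbT; apply: contraTN p0 => /eqP <-.
  by rewrite mul0r ltxx.
rewrite pmulr_rgt0// in p0; have [jm' smj] := AX j m (leqnn m) p0.
rewrite -(subnKC jm'); apply: ratio_stableD smj.
by case: j pj {jm jm' p0} => [_|j pj]; [exact: ratio_stable0|exact: ratio_stable_law].
Qed.

Lemma ratio_stable_forest (ms : seq nat) : (forall m, m \in ms -> 0 < a m) ->
  ratio_stable a (sumn ms - size ms) /\ (size ms <= sumn ms)%N.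
Proof.
elim: ms => [|m ms IH] h; first by split => //; exact: ratio_stable0.
have [|sr sz] := IH; first by move=> i im; apply: h; rewrite inE im orbT.
have am : 0 < a m by apply: h; rewrite mem_head.
have m0 : (0 < m)%N by case: (m) am => //; rewrite a0 ltxx.
split; last by rewrite /=; lia.
have -> : (sumn (m :: ms) - size (m :: ms) = m.-1 + (sumn ms - size ms))%N.
  by rewrite /=; lia.
by apply: ratio_stableD sr; exact: ratio_stable_size.
Qed.

End RatioLimit.

Section SizeRatio.
Variables (R : realType) (xi a : nat -> R) (w : pred nat).
Hypothesis w0 : w 0%N.
Hypothesis xi_ge0 : forall k, 0 <= xi k.
Hypothesis xi_sum : forall n, \sum_(k < n) xi k <= 1.
Hypothesis xi0 : 0 < xi 0%N.
Hypothesis xi_big : exists2 j, (2 <= j)%N & 0 < xi j.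
Hypothesis a_ge0 : forall n, 0 <= a n.
Hypothesis a0 : a 0%N = 0.
Hypothesis aE : forall N n, (n <= N)%N -> a n = \sum_(k < N.+1)
  xi k * ('X^(w k) * (\poly_(i < N.+1) a i) ^+ k)`_n.
Hypothesis a_subexp : forall (e : R) (M : nat), 0 < e ->
  exists2 n, (M <= n)%N & expR (- (e * n%:R)) <= a n.

(** The root with k children contributes w k + (k - 1), which is 0 or in the
    support of the reduced law, and each of the k - 1 subtrees contributes its
    size minus 1. *)
Lemma size_ratio_cvg (ms : seq nat) :
  0 < xi (size ms).+1 -> (forall m, m \in ms -> 0 < a m) ->
  ratio_stable a (w (size ms).+1 + sumn ms).
Proof.
move=> xk msa; set k := (size ms).+1 in xk *.
pose phi := reduced_law xi w.
have phi_ge0 := reduced_law_ge0 w xi_ge0 xi_sum xi0.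
have phi_sum := reduced_law_sum w0 xi_ge0 xi_sum xi0.
have phi0 : 0 < phi 0%N := reduced_law_marked_gt0 xi_ge0 xi_sum xi0 w0 xi0.
have phi_big : exists2 J, (2 <= J)%N & 0 < phi J.
  by have [j j2 xj] := xi_big; exact: reduced_law_big xj.
have functional N i : (i < N)%N -> (\poly_(i < N.+1) a i)`_i.+1 =
    (\poly_(i < N.+1) phi i \Po \poly_(i < N.+1) a i)`_i.
  by have := reduced_law_functional (unmarked0_neq1 w xi_ge0 xi_sum xi0) w0 a0 (@aE N); apply.
have kemperman n : (0 < n)%N -> n%:R * a n = conv_pow phi n n.-1.
  move=> n0; rewrite (@conv_powE _ _ n.+1); last by lia.
  have := @lagrange_inversion _ (\poly_(i < n.+1) a i) (\poly_(i < n.+1) phi i) n.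
  rewrite coef_poly /= => /(_ a0 (functional n) n 1%N n0 (leqnn n)).
  by rewrite expr1 coef_poly ltnSn mulr1n subn1 mulr_natl.
have [sms szms] := ratio_stable_forest phi_ge0 phi_sum phi0 phi_big a0
  kemperman a_subexp a_ge0 functional msa.
have stable_law := ratio_stable_law phi_ge0 phi_sum phi0 phi_big a0 kemperman a_subexp.
have -> : (w k + sumn ms = (w k + size ms) + (sumn ms - size ms))%N by lia.
apply: ratio_stableD sms; rewrite /k; have [wk|wk] := boolP (w (size ms).+1).
  rewrite /= ?add1n; apply: stable_law => //.
  exact: reduced_law_marked_gt0.
rewrite /= ?add0n; move: xk wk; rewrite /k; case: (size ms) => [|l] xk wk; first exact: ratio_stable0.
by apply: stable_law => //; exact: reduced_law_unmarked_gt0.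
Qed.

End SizeRatio.

(** * Weak convergence from lower bounds on local sets *)

Lemma count_levels (R : realType) (v : R) N : 0 <= v ->
  \sum_(i < N) ((i.+1%:R < v)%R : nat)%:R <= v.
Proof.
move=> v0; elim: N => [|N IH]; first by rewrite big_ord0.
rewrite big_ord_recr /=; case: ltP => [Nv|_]; last by rewrite addr0.
apply: le_trans (ltW Nv); rewrite -natr1 lerD2r.
apply: (@le_trans _ _ (\sum_(i < N) (1 : R))); last by rewrite sumr_const card_ord.
by apply: ler_sum => i _; case: (_ < _).
Qed.

Lemma le_count_levels (R : realType) (v : R) N : v <= N%:R ->
  v <= \sum_(i < N) ((i.+1%:R < v)%R : nat)%:R + 1.
Proof.
elim: N => [|N IH] vN; first by rewrite big_ord0 add0r (le_trans vN).
rewrite big_ord_recr /= [(_ < v)%R]ltNge vN addr0.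
have [/IH//|Nv] := leP v N%:R.
rewrite (eq_bigr (fun=> 1)); first by rewrite sumr_const card_ord natr1.
by move=> i _; rewrite (le_lt_trans _ Nv)// ler_nat.
Qed.

Section Topology.
Variable R : realType.
Local Notation M := (locTree R).

Lemma dloc_le_expR k (t s : tree) : trunc k t = trunc k s ->
  dloc R t s <= expR (- k%:R).
Proof.
move=> ts.
have le_inf : ((k%:R)%:E <= ereal_inf (@radii R t s))%E.
  apply: le_ereal_inf_tmp => _ [j /= nj <-]; rewrite lee_fin ler_nat leqNgt.
  apply/negP => jk; apply: nj.
  by rewrite -(trunc_le t (ltnW jk)) ts trunc_le// ltnW.
have le_exp : (expeR (- ereal_inf (@radii R t s)) <= (expR (- k%:R))%:E)%E.
  by rewrite -[leRHS]/(expeR (- (k%:R)%:E)%E) lee_expeR leeN2.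
have ge0 := expeR_ge0 (- ereal_inf (@radii R t s))%E.
rewrite /dloc; move: le_exp ge0; case: (expeR _) => [r| |] //=.
Qed.

(** The largest subset of G which is decided by the truncation at k. *)
Definition local_core k (G : set M) : set M :=
  [set t | forall s, trunc k (t : tree) = trunc k s -> G s].

Lemma is_local_core k G : is_local k (local_core k G).
Proof. by move=> t s ts Gt r sr; apply: Gt; rewrite ts. Qed.

Lemma local_open k (B : set tree) : is_local k B -> open (B : set M).
Proof.
by move=> lB; apply: open_trunc => t Bt; exists k => s ts; exact: (lB t s ts Bt).
Qed.

Lemma open_local_core (G : set M) : open G -> G = \bigcup_k local_core k G.
Proof.
move=> oG; apply/seteqP; split=> [t Gt|t [k _]]; last exact.
have : nbhs t G by exact: open_nbhs_nbhs.
rewrite -nbhs_ballE => -[e /= e0 eG].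
exists (Num.trunc (e^-1)).+1 => // s ts; apply: eG; rewrite locTree_ballE /=.
apply: le_lt_trans (dloc_le_expR ts) _.
rewrite expRN -[ltRHS]invrK ltf_pV2 ?posrE ?invr_gt0 ?expR_gt0//.
apply: lt_le_trans (truncnS_gt _) _.
by apply: le_trans (expR_ge1Dx _); rewrite lerDr.
Qed.

Lemma local_core_mono (G : set M) : {homo (local_core^~ G) : k l / (k <= l)%N >-> (k <= l)%O}.
Proof.
move=> k l kl; apply/subsetPset => t Gt s ts; apply: Gt.
by rewrite -(trunc_le t kl) ts trunc_le.
Qed.

Lemma continuous_measurable_locTree (f : M -> R) : continuous f -> measurable_fun setT f.
Proof.
move=> cf; apply: (measurability _ (RGenOInfty.measurableE R)).
move=> /= _ [_ [a ->] <-]; apply: measurableI => //.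
apply: open_measurable_locTree; apply: open_comp; first by move=> t _; exact: cf.
exact: interval_open.
Qed.

End Topology.

Section Portmanteau.
Variable R : realType.
Local Notation M := (locTree R).

Definition level_sum (nu : probability M R) (g : M -> R) (d : R) N :=
  \sum_(i < N) d * fine (nu [set t | (i.+1%:R * d < g t)%R]).

(** The number of multiples of d below g t approximates g t / d up to one. *)
Lemma level_bounds (nu : probability M R) (g : M -> R) (d : R) N :
  measurable_fun setT g -> 0 < d -> (forall t, 0 <= g t <= N%:R * d) ->
  level_sum nu g d N <= fine (\int[nu]_t (g t)%:E)%E <= level_sum nu g d N + d.
Proof.
move=> mg d0 gb; set S := level_sum _ _ _ _; pose U i := [set t | (i.+1%:R * d < g t)%R].
have mU i : measurable (U i).
  rewrite /U -[X in measurable X]setTI.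
  have -> : [set t | (i.+1%:R * d < g t)%R] = g @^-1` `]i.+1%:R * d, +oo[%classic.
    by apply/seteqP; split=> t /=; rewrite in_itv /= andbT.
  by apply: mg => //; exact: measurable_itv.
pose s t := (\sum_(i < N) d * \1_(U i) t)%R.
have ms : measurable_fun setT s.
  apply: measurable_sum => i.
  by apply: measurable_funM; [exact: measurable_cst|exact: measurable_indic].
have intS : (\int[nu]_t (s t)%:E = S%:E)%E.
  rewrite /s; under eq_integral do rewrite -sumEFin.
  rewrite (@ge0_integral_sum _ _ _ nu setT _ 'I_N (fun i t => (d * \1_(U i) t)%:E))//; last 2 first.
  - move=> i; apply/measurable_EFinP.
    by apply: measurable_funM; [exact: measurable_cst|exact: measurable_indic].
  - by move=> i t _; rewrite lee_fin mulr_ge0 ?(ltW d0).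
  rewrite -sumEFin; apply: eq_bigr => i _.
  under eq_integral do rewrite EFinM.
  rewrite ge0_integralZl_EFin ?(ltW d0)//; last first.
    by apply/measurable_EFinP; exact: measurable_indic.
  rewrite integral_indic// setIT EFinM fineK//. exact: (fin_num_measure nu _ (mU i)).
have g0 t : 0 <= g t by have /andP[] := gb t.
have sE t : s t = d * \sum_(i < N) ((i.+1%:R < g t / d)%R : nat)%:R.
  rewrite mulr_sumr; apply: eq_bigr => i _; congr (_ * _).
  rewrite ltr_pdivlMr// indicE; congr (_%:R); congr nat_of_bool.
  by apply/idP/idP; rewrite inE.
have sg t : s t <= g t.
  by rewrite sE mulrC -ler_pdivlMr// count_levels// divr_ge0// ltW.
have gs t : g t <= s t + d.
  rewrite sE -[X in _ + X]mulr1 -mulrDr mulrC -ler_pdivrMr//.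
  by apply: le_count_levels; rewrite ler_pdivrMr//; have /andP[] := gb t.
have s0 t : 0 <= s t by apply: sumr_ge0 => i _; rewrite mulr_ge0 ?(ltW d0).
have le1 : (S%:E <= \int[nu]_t (g t)%:E)%E.
  rewrite -intS; apply: ge0_le_integral => //; try exact/measurable_EFinP.
  - by move=> t _; rewrite lee_fin.
  - by move=> t _; rewrite lee_fin.
have le2 : (\int[nu]_t (g t)%:E <= (S + d)%:E)%E.
  have -> : ((S + d)%:E = \int[nu]_t ((s t)%:E + d%:E))%E.
    rewrite ge0_integralD//; last 3 first.
    - by move=> t _; rewrite lee_fin.
    - exact/measurable_EFinP.
    - by move=> t _; rewrite lee_fin ltW.
    rewrite intS integral_cst// [X in (_ + _ * X)%E](_ : _ = 1%E); last exact: probability_setT.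
    by rewrite mule1 EFinD.
  apply: ge0_le_integral => //.
  - by move=> t _; rewrite lee_fin.
  - exact/measurable_EFinP.
  - by apply: emeasurable_funD => //; exact/measurable_EFinP.
  - by move=> t _; rewrite -EFinD lee_fin.
have fin : (\int[nu]_t (g t)%:E)%E \is a fin_num.
  rewrite ge0_fin_numE; first exact: le_lt_trans le2 (ltry _).
  by apply: integral_ge0 => t _; rewrite lee_fin.
by rewrite -(fineK fin) !lee_fin in le1 le2; rewrite le1 le2.
Qed.

(** Lower bounds pass from local sets to open sets, which are increasing unions
    of local sets, then to the integral of a bounded continuous f through the
    open sets where f exceeds a level. The upper bound comes from - f. *)
Lemma local_liminf_weak (F : set_system nat) (FF : Filter F)
    (mu_ : nat -> probability M R) (mu : probability M R) :
  (forall k (B : set tree), is_local k B -> forall e : R, 0 < e ->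
     \forall n \near F, fine (mu (B : set M)) - e <= fine (mu_ n (B : set M))) ->
  converges_weakly F mu_ mu.
Proof.
move=> loc.
have opn (G : set M) : open G -> forall e : R, 0 < e ->
    \forall n \near F, fine (mu G) - e <= fine (mu_ n G).
  move=> oG e e0; have e20 : 0 < e / 2 by rewrite divr_gt0.
  have mC k : measurable (local_core k G).
    by apply: open_measurable_locTree; apply: local_open; exact: is_local_core.
  have GE := open_local_core oG.
  have mG : measurable G by exact: open_measurable_locTree.
  have [k hk] : exists k, fine (mu G) - e / 2 <= fine (mu (local_core k G)).
    have cvgG : mu (local_core k G) @[k --> \oo] --> (fine (mu G))%:E.
      rewrite fineK ?fin_num_measure// [X in _ --> mu X]GE.
      apply: nondecreasing_cvg_mu => //; first by rewrite -GE.
      exact: local_core_mono.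
    have [_ /cvgrPdist_le/(_ _ e20)] := (fine_cvgP _ _).1 cvgG.
    move=> [k _ /(_ k (leqnn k))] /=; rewrite ler_norml => /andP[_ h].
    by exists k; move: h; rewrite /=; lra.
  have := loc k _ (@is_local_core _ k G) _ e20; apply: filterS => n h.
  have : fine (mu_ n (local_core k G)) <= fine (mu_ n G).
    apply: fine_le; rewrite ?fin_num_measure//; apply: le_measure; rewrite ?inE//.
    by move=> t; apply.
  by move: h hk; lra.
have low (f : M -> R) (K : R) : continuous f -> (forall t, `|f t| <= K) ->
    forall e : R, 0 < e -> \forall n \near F,
    fine (\int[mu]_t (f t)%:E)%E - e <= fine (\int[mu_ n]_t (f t)%:E)%E.
  move=> cf fK e e0.
  have mf := continuous_measurable_locTree cf.
  have K0 : 0 <= K := le_trans (normr_ge0 _) (fK point).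
  (* The levels cost an error d, and each of the N level sets may lose 1 / N, for
     a total of 2 d = e. *)
  pose d := e / 2; have d0 : 0 < d by rewrite divr_gt0.
  pose N := (Num.trunc (2 * K / d)).+1.
  have KN : 2 * K <= N%:R * d by rewrite -ler_pdivrMr// ltW// truncnS_gt.
  pose g t := f t + K.
  have mg : measurable_fun setT g by apply: measurable_funD => //; exact: measurable_cst.
  have gb t : 0 <= g t <= N%:R * d.
    have := fK t; rewrite ler_norml /g => /andP[h1 h2]; apply/andP; split; lra.
  have intg (nu : probability M R) :
      fine (\int[nu]_t (g t)%:E)%E = fine (\int[nu]_t (f t)%:E)%E + K.
    have intf : nu.-integrable setT (EFin \o f).
      apply: measurable_bounded_integrable => //; first by rewrite ?(le_lt_trans (probability_le1 _ _)) ?ltry.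
      exists K; split; first exact: num_real.
      by move=> L KL t _; exact: le_trans (fK t) (ltW KL).
    have intK : nu.-integrable setT (EFin \o cst K) by exact: finite_measure_integrable_cst.
    rewrite /g; under eq_integral do rewrite EFinD.
    rewrite integralD// integral_cst//= probability_setT mule1 fineD//=.
    exact: integrable_fin_num.
  pose U i := [set t | (i.+1%:R * d < g t)%R].
  have oU i : open (U i).
    have -> : U i = f @^-1` [set y | (i.+1%:R * d - K < y)%R].
      by apply/seteqP; split=> t /=; rewrite /U /g /= ltrBlDr.
    apply: open_comp; first by move=> t _; exact: cf.
    exact: open_gt.
  have N0 : (0 : R) < N%:R by rewrite ltr0n.
  have nearU : \forall n \near F, forall i, `I_N i ->
      fine (mu (U i)) - N%:R^-1 <= fine (mu_ n (U i)).
    apply: (@near_forall_finite _ _ _ _ FF (fun i n => fine (mu (U i)) - N%:R^-1 <= fine (mu_ n (U i)))%R).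
    - exact: finite_II.
    - by move=> i _; apply: opn => //; rewrite invr_gt0.
  apply: filterS nearU => n hn.
  have /andP[_ up] := level_bounds mu mg d0 gb.
  have /andP[lo _] := level_bounds (mu_ n) mg d0 gb.
  have sums : level_sum mu g d N - d <= level_sum (mu_ n) g d N.
    rewrite /level_sum; have dE : d = \sum_(i < N) d * N%:R^-1.
      by rewrite sumr_const card_ord -[RHS]mulr_natr divfK// gt_eqF.
    rewrite {3}dE -sumrB; apply: ler_sum => i _.
    rewrite -mulrBr; rewrite ler_wpM2l ?(ltW d0)//.
    exact: (hn i (ltn_ord i)).
  rewrite !intg in up lo.
  have eE : e = d + d by rewrite -splitr.
  by rewrite eE; move: up lo sums; lra.
move=> f cf [K fK].
have intf (nu : probability M R) : nu.-integrable setT (EFin \o f).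
  apply: measurable_bounded_integrable => //.
  - by rewrite (le_lt_trans (probability_le1 _ _)) ?ltry.
  - exact: continuous_measurable_locTree.
  - exists K; split; first exact: num_real.
    by move=> L KL t _; exact: le_trans (fK t) (ltW KL).
have fin (nu : probability M R) : (\int[nu]_t (f t)%:E)%E \is a fin_num.
  exact: (integrable_fin_num measurableT (intf nu)).
have intN (nu : probability M R) :
    fine (\int[nu]_t (- f t)%:E)%E = - fine (\int[nu]_t (f t)%:E)%E.
  transitivity (fine (\int[nu]_t ((-1)%:E * (f t)%:E))%E).
    by congr fine; apply: eq_integral => t _; rewrite -EFinM mulN1r.
  by rewrite (integralZl measurableT (intf nu)) EFinN mulN1e fineN.
rewrite -[X in _ --> X]fineK//; apply/fine_cvgP; split; first exact: nearW.
apply/cvgrPdist_le => e e0.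
have cNf : continuous (fun t => - f t) by move=> t; apply: continuousN; exact: cf.
have NfK t : `|- f t| <= K by rewrite normrN.
have lo := low f K cf fK e e0.
have up := low (fun t => - f t) K cNf NfK e e0.
apply: filterS2 lo up => n /=; rewrite !intN => lo up.
by rewrite ler_norml; apply/andP; split; lra.
Qed.

End Portmanteau.

Local Open Scope ereal_scope.

(** * Sums over finite plane trees *)

Section Esum.
Variable R : realType.

Lemma esumZl (T : choiceType) (D : set T) (a : T -> \bar R) (c : R) :
  (0 <= c)%R -> (forall i, 0 <= a i) ->
  \esum_(i in D) (c%:E * a i) = c%:E * \esum_(i in D) a i.
Proof.
move=> c0 a0; rewrite /esum -ereal_supZl//; last first.
  by apply/set0P; exists 0; exists set0; [exact: fsets_set0|rewrite fsbig_set0].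
congr ereal_sup; apply/seteqP; split=> _ [X XD <-] /=.
  by exists (\sum_(x \in X) a x); [exists X|rewrite ge0_mule_fsumr].
by case: XD => A AD <-; exists A => //; rewrite ge0_mule_fsumr.
Qed.

Lemma esumZr (T : choiceType) (D : set T) (a : T -> \bar R) (c : R) :
  (0 <= c)%R -> (forall i, 0 <= a i) ->
  \esum_(i in D) (a i * c%:E) = (\esum_(i in D) a i) * c%:E.
Proof.
move=> c0 a0; rewrite [RHS]muleC -esumZl//.
by apply: eq_esum => i _; rewrite muleC.
Qed.

Lemma esum_subset (T : choiceType) (A B : set T) (a : T -> \bar R) :
  A `<=` B -> \esum_(i in A) a i <= \esum_(i in B) a i.
Proof.
move=> AB; apply: le_ereal_sup => _ [X [finX XA] <-].
by exists X => //; split => // i /XA/AB.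
Qed.

(** Summation by fibres of f. *)
Lemma esum_partition (T I : choiceType) (D : set T) (E : set I) (f : T -> I)
    (a : T -> \bar R) : (forall x, D x -> E (f x)) -> (forall x, D x -> 0 <= a x) ->
  \esum_(x in D) a x = \esum_(i in E) \esum_(x in D `&` [set x | f x = i]) a x.
Proof.
move=> DE a0; rewrite esum_esum; last by move=> i x _ [Dx _]; exact: a0.
apply/esym; apply: (@reindex_esum _ _ _ D _ (fun x => (f x, x)) (fun k => a k.2)); split.
- by move=> x Dx /=; split; [exact: DE|].
- by move=> x y _ _ [].
- by move=> [i x] /= [Ei [Dx fx]]; exists x => //; rewrite fx.
Qed.

Lemma esum_ord (n : nat) (a : nat -> \bar R) : (forall i, 0 <= a i) ->
  \esum_(i in `I_n) a i = \sum_(i < n) a i.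
Proof.
by move=> a0; rewrite esum_fset// ?fsbig_ord//; exact: finite_II.
Qed.

End Esum.

Lemma esum_support (R : realType) (T : choiceType) (D E : set T) (a : T -> \bar R) :
  (forall i, D i -> ~ E i -> a i = 0) -> \esum_(i in D) a i = \esum_(i in D `&` E) a i.
Proof.
move=> a0; rewrite esum_mkcondr; apply: eq_esum => i Di.
by case: ifPn => //; rewrite notin_setE => /a0->.
Qed.

Section GaltonWatson.
Variables (R : realType) (xi : probability nat R).
Local Notation W := (plane_weight xi).

Definition offspring k : R := fine (xi [set k]).
Local Notation x := offspring.

Definition forest_weight ps := \prod_(p <- ps) W p.

Definition forests k : set (seq planeTree) :=
  [set ps | all_in finite_plane ps /\ size ps = k].

Lemma offspringE k : xi [set k] = (x k)%:E.
Proof. by rewrite fineK// fin_num_measure. Qed.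

Lemma offspring_ge0 k : (0 <= x k)%R.
Proof. by rewrite -lee_fin -offspringE. Qed.

Lemma plane_weight_ge0 p : 0 <= W p.
Proof. by apply: prode_ge0 => u _; exact: measure_ge0. Qed.

Lemma plane_weightE p : W p = (fine (W p))%:E.
Proof.
by rewrite fineK// prode_fin_num// => u _; rewrite offspringE.
Qed.

Lemma fine_plane_weight_ge0 p : (0 <= fine (W p))%R.
Proof. by rewrite -lee_fin -plane_weightE plane_weight_ge0. Qed.

Lemma forest_weight_ge0 ps : 0 <= forest_weight ps.
Proof. by apply: prode_ge0 => p _; exact: plane_weight_ge0. Qed.

Lemma forest_weightE ps : forest_weight ps = (fine (forest_weight ps))%:E.
Proof.
by rewrite fineK// prode_fin_num// => p _; rewrite plane_weightE.
Qed.

Lemma forest_weight_cons p ps : forest_weight (p :: ps) = W p * forest_weight ps.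
Proof. by rewrite /forest_weight big_cons. Qed.

Lemma plane_weight_pbracket ps : all_in finite_plane ps ->
  W (pbracket ps) = (x (size ps))%:E * forest_weight ps.
Proof.
move=> fin; rewrite -offspringE.
exact: (@big_pbracket _ _ mule (fun k => xi [set k])).
Qed.

Lemma GW_esum B : GW xi B = \esum_(p in finite_plane `&` [set p | B (shape p)]) W p.
Proof.
rewrite (@esum_partition _ _ _ _ (B `&` @finite_tree) shape).
- apply: eq_esum => t [Bt ft]; rewrite /GW_mass; congr esum.
  apply/seteqP; split=> [p /= pt|p [_ //]]; move: Bt ft; rewrite -pt => Bt ft.
  by split=> //; split=> //; exact/finite_tree_shape.
- by move=> p [fp Bp]; split => //; exact/finite_tree_shape.
- by move=> p _; exact: plane_weight_ge0.
Qed.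

Lemma esum_forests0 (f : seq planeTree -> \bar R) : 0 <= f [::] ->
  \esum_(ps in forests 0) f ps = f [::].
Proof.
move=> f0; rewrite -(esum_set1 f0); congr esum; apply/seteqP; split=> ps /=.
  by move=> [_ /size0nil].
by move=> ->; split => //; exact: all_in_nil.
Qed.

Lemma esum_forestsS k (f : seq planeTree -> \bar R) : (forall ps, 0 <= f ps) ->
  \esum_(ps in forests k.+1) f ps =
  \esum_(p in finite_plane) \esum_(ps in forests k) f (p :: ps).
Proof.
move=> f0; rewrite esum_esum//.
apply: (@reindex_esum _ _ _ _ _ (fun k => k.1 :: k.2)); split.
- by move=> [p ps] /= [fp [fps <-]]; split => //; exact/all_in_cons.
- by move=> [p ps] [q qs] _ _ /= [-> ->].
- by move=> [|p ps] [] // /all_in_cons[fp fps] [sz]; exists (p, ps).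
Qed.

(** The branching property: a finite plane tree is the same thing as the finite
    sequence of the subtrees of its root. *)
Lemma esum_finite_plane (f : planeTree -> \bar R) : (forall p, 0 <= f p) ->
  \esum_(p in finite_plane) f p =
  \esum_(k in setT) \esum_(ps in forests k) f (pbracket ps).
Proof.
move=> f0; rewrite (@reindex_esum _ _ _ (all_in finite_plane) _ pbracket).
  rewrite (@esum_partition _ _ _ _ setT size)//.
by split=> [ps /finite_pbracket//|ps qs _ _ e|p fp];
  [rewrite -(children_pbracket ps) e children_pbracket
  |exists (children p); rewrite ?pbracket_children//; apply/finite_pbracket;
   rewrite pbracket_children].
Qed.

Hypothesis mass1 : \esum_(p in finite_plane) W p = 1.

Lemma forest_mass1 k : \esum_(ps in forests k) forest_weight ps = 1.
Proof.
elim: k => [|k IH]; first by rewrite esum_forests0 /forest_weight ?big_nil.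
rewrite esum_forestsS; last exact: forest_weight_ge0.
rewrite -[RHS]mass1; apply: eq_esum => p _.
under eq_esum do rewrite forest_weight_cons.
rewrite plane_weightE esumZl ?fine_plane_weight_ge0//; last exact: forest_weight_ge0.
by rewrite IH mule1.
Qed.

Section Size.
Variable w : pred nat.
Hypothesis w0 : w 0%N.
Local Notation msize := (marked_size w).

Definition forest_size ps := (\sum_(p <- ps) msize p)%N.
Local Notation fsize := forest_size.

Definition size_mass n : R := fine (GW xi (sized w n)).
Local Notation a := size_mass.

Lemma GW_sized n :
  GW xi (sized w n) = \esum_(p in finite_plane `&` [set p | msize p = n]) W p.
Proof.
rewrite GW_esum; congr esum; apply/seteqP; split=> p /= [fp].
  by move=> /sized_shape[].
by move=> sp; split => //; exact/sized_shape.
Qed.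

Lemma GW_le1 B : GW xi B <= 1.
Proof. by rewrite GW_esum -mass1; apply: esum_subset => p []. Qed.

Lemma GW_fin B : GW xi B \is a fin_num.
Proof. by rewrite ge0_fin_numE ?measure_ge0// (le_lt_trans (GW_le1 B)) ?ltry. Qed.

Lemma size_massE n : GW xi (sized w n) = (a n)%:E.
Proof. by rewrite /a fineK// GW_fin. Qed.

Lemma size_mass_ge0 n : (0 <= a n)%R.
Proof. by rewrite -lee_fin -size_massE measure_ge0. Qed.

(** A vertex of maximal depth has no child. *)
Lemma has_leaf p : finite_plane p -> exists2 u, verts p u & nchildren p u = 0%N.
Proof.
move=> fin; pose M := (\max_(u <- fset_set (verts p)) size u)%N.
have le_M u : verts p u -> (size u <= M)%N.
  by move=> pu; apply: leq_bigmax_seq; rewrite // in_fset_set// inE.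
pose P k := `[< exists2 u, verts p u & size u = k >].
have exP : exists k, P k by exists 0%N; apply/asboolP; exists [::] => //; exact: verts_root.
have bP k : P k -> (k <= M)%N by move=> /asboolP[u pu <-]; exact: le_M.
case: (ex_maxnP exP bP) => k /asboolP[u pu su] maxk; exists u => //.
apply/eqP; rewrite -leqn0 leqNgt; apply/negP => /nchildrenP pu0.
have /maxk : P k.+1 by apply/asboolP; exists (rcons u 0%N); rewrite // size_rcons su.
by rewrite ltnn.
Qed.

Lemma marked_size_gt0 p : finite_plane p -> (0 < msize p)%N.
Proof.
move=> fin; have [u pu u0] := has_leaf fin.
rewrite /marked_size (big_rem u) ?in_fset_set ?inE//= u0 w0.
by rewrite addn_gt0.
Qed.

Lemma size_mass0 : a 0%N = 0%R.
Proof.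
rewrite /a GW_sized esum1//= => p [fp /= p0].
by have := marked_size_gt0 fp; rewrite p0.
Qed.

Lemma forest_size_cons p ps : fsize (p :: ps) = (msize p + fsize ps)%N.
Proof. by rewrite /forest_size big_cons. Qed.

(** Sizes of independent trees add up, hence their generating functions
    multiply. *)
Lemma forest_size_mass N k m : (m <= N)%N ->
  \esum_(ps in forests k) (if fsize ps == m then forest_weight ps else 0) =
  (((\poly_(i < N.+1) a i) ^+ k)%R`_m)%:E.
Proof.
elim: k m => [|k IH] m mN.
  rewrite esum_forests0; last by case: ifP => // _; exact: forest_weight_ge0.
  by rewrite expr0 coef1 /forest_size /forest_weight !big_nil eq_sym; case: eqP.
rewrite esum_forestsS; last by move=> ps; case: ifP => // _; exact: forest_weight_ge0.
pose c i : R := (((\poly_(i < N.+1) a i) ^+ k)%R`_(m - i)).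
have c0 i : (0 <= c i)%R.
  by apply: coef_exp_ge0 => j; rewrite coef_poly; case: ifP => // _; exact: size_mass_ge0.
transitivity (\esum_(p in finite_plane `&` [set p | (msize p < m.+1)%N])
    W p * (c (msize p))%:E).
  rewrite esum_mkcondr; apply: eq_esum => p fp; case: ifPn; rewrite ?notin_setE ?inE /= => pm.
    rewrite -(IH (m - msize p)%N); last by rewrite (leq_trans (leq_subr _ _)).
    rewrite plane_weightE -esumZl ?fine_plane_weight_ge0//; last first.
      by move=> ps; case: ifP => // _; exact: forest_weight_ge0.
    apply: eq_esum => ps _; rewrite forest_size_cons forest_weight_cons -plane_weightE.
    by rewrite -(eqn_add2l (msize p) (fsize ps)) subnKC//; case: ifP; rewrite ?mule0.
  rewrite esum1// => ps _; rewrite forest_size_cons ifF//.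
  by apply/negbTE/eqP => e; apply: pm; rewrite -e ltnS leq_addr.
rewrite (@esum_partition _ _ _ _ `I_m.+1 msize); last 2 first.
- by move=> p [].
- by move=> p _; rewrite mule_ge0 ?plane_weight_ge0// lee_fin.
rewrite esum_ord; last first.
  by move=> i; apply: esum_ge0 => p _; rewrite mule_ge0 ?plane_weight_ge0// lee_fin.
rewrite exprS coefM -sumEFin; apply: eq_bigr => -[i /= im] _.
transitivity (\esum_(p in finite_plane `&` [set p | msize p = i]) W p * (c i)%:E).
  rewrite (_ : _ `&` _ `&` _ = finite_plane `&` [set p | msize p = i]); last first.
    apply/seteqP; split=> p /= => [[[]]//|[fp pi]]; do ! split => //.
    by rewrite pi.
  by apply: eq_esum => p [_ /= ->].
rewrite esumZr//; last exact: plane_weight_ge0.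
rewrite -GW_sized size_massE coef_poly ifT ?EFinM//; by lia.
Qed.

(** Since every finite tree has positive size, a root with more than N children
    cannot have size at most N, which makes the sum finite. *)
Lemma size_mass_rec N n : (n <= N)%N -> a n = (\sum_(k < N.+1)
  x k * ('X^(w k) * (\poly_(i < N.+1) a i) ^+ k)`_n)%R.
Proof.
move=> nN; apply: EFin_inj; rewrite -size_massE GW_sized.
have A0 : ((\poly_(i < N.+1) a i)`_0 = 0)%R by rewrite coef_poly /= size_mass0.
pose g k : R := (x k * ('X^(w k) * (\poly_(i < N.+1) a i) ^+ k)`_n)%R.
have coef0 i (k : nat) : (0 <= ((\poly_(i < N.+1) a i) ^+ k)%R`_i)%R.
  by apply: coef_exp_ge0 => j; rewrite coef_poly; case: ifP => // _; exact: size_mass_ge0.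
have g0 k : (0 <= g k)%R.
  by rewrite mulr_ge0 ?offspring_ge0// coefXnM; case: ifP.
transitivity (\esum_(p in finite_plane) if msize p == n then W p else 0).
  rewrite esum_mkcondr; apply: eq_esum => p _.
  by have -> : (p \in [set p | msize p = n]) = (msize p == n) by apply/idP/eqP; rewrite inE.
rewrite esum_finite_plane; last by move=> p; case: ifP => // _; exact: plane_weight_ge0.
transitivity (\esum_(k in setT) (g k)%:E).
  apply: eq_esum => k _; rewrite /g coefXnM EFinM.
  transitivity (\esum_(ps in forests k)
      (x k)%:E * (if (w k + fsize ps == n)%N then forest_weight ps else 0)).
    apply: eq_esum => ps [fps sz]; rewrite marked_size_pbracket// sz -/(forest_size ps).
    by rewrite plane_weight_pbracket// sz; case: ifP; rewrite ?mule0.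
  rewrite esumZl ?offspring_ge0//; last first.
    by move=> ps; case: ifP => // _; exact: forest_weight_ge0.
  congr (_ * _); case: ltnP => nw.
    rewrite esum1// => ps _; rewrite ifF//; apply/negbTE; rewrite neq_ltn orbC.
    by rewrite (leq_trans nw)// leq_addr.
  rewrite -(@forest_size_mass N k (n - w k)); last by rewrite (leq_trans (leq_subr _ _)).
  by apply: eq_esum => ps _; rewrite -{1}(subnKC nw) eqn_add2l.
rewrite (@esum_support _ _ _ `I_N.+1); last first.
  move=> k _ /= /negP; rewrite -leqNgt => Nk; congr EFin.
  rewrite /g coefXnM; case: ltnP => _; first by rewrite mulr0.
  by rewrite coef_exp_lt ?mulr0//; lia.
by rewrite setTI esum_ord ?sumEFin// => k; rewrite lee_fin.
Qed.

End Size.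
End GaltonWatson.

(** * Consequences of criticality *)

Lemma esum_nat_le (R : realType) (f : nat -> \bar R) (C : \bar R) :
  (forall i, 0 <= f i) -> (forall K, \sum_(i < K) f i <= C) ->
  \esum_(i in setT) f i <= C.
Proof.
move=> f0 fC; rewrite -nneseries_esumT//; apply: lime_le.
  by apply: is_cvg_nneseries => i _ _; exact: f0.
by apply: nearW => n; rewrite big_mkord.
Qed.

Lemma esum_ge_sum (R : realType) (f : nat -> \bar R) K :
  (forall i, 0 <= f i) -> \sum_(i < K) f i <= \esum_(i in setT) f i.
Proof. by move=> f0; rewrite -esum_ord//; exact: esum_subset. Qed.

Lemma esum_ge_term (R : realType) (f : nat -> \bar R) k :
  (forall i, 0 <= f i) -> f k <= \esum_(i in setT) f i.
Proof.
move=> f0; rewrite -[leLHS](esum_set1 (f0 k)); exact: esum_subset.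
Qed.

Section Critical.
Variables (R : realType) (xi : probability nat R).
Local Notation W := (plane_weight xi).
Local Notation x := (offspring xi).
Hypothesis mass1 : \esum_(p in finite_plane) W p = 1.
Hypothesis mean_xi : \int[xi]_k (k%:R)%:E = 1.
Hypothesis xi1_lt1 : xi [set 1%N] < 1.

Lemma esum_offspring : \esum_(k in setT) (x k)%:E = 1.
Proof.
rewrite -[RHS]mass1 esum_finite_plane; last exact: plane_weight_ge0.
apply: eq_esum => k _.
transitivity (\esum_(ps in forests k) (x k)%:E * forest_weight xi ps).
  rewrite esumZl ?offspring_ge0//; last exact: forest_weight_ge0.
  by rewrite forest_mass1// mule1.
by apply: eq_esum => ps [fps sz]; rewrite plane_weight_pbracket// sz.
Qed.

Lemma esum_mean : \esum_(k in setT) (k%:R * x k)%:E = 1.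
Proof.
have TE : [set: nat] = \bigcup_k [set k] by apply/seteqP; split=> k // _; exists k.
rewrite -[RHS]mean_xi [in RHS]TE ge0_integral_bigcup//; last first.
  by move=> i j _ _ [k [-> ->]].
rewrite nneseries_esumT; last by move=> k; apply: integral_ge0 => ? _; rewrite lee_fin.
apply: eq_esum => k _.
rewrite (@eq_integral _ _ _ _ _ (cst (k%:R)%:E)).
  by rewrite integral_cst//= offspringE.
by move=> i; rewrite inE => ->.
Qed.

Lemma sum_offspring_le1 n : (\sum_(k < n) x k <= 1)%R.
Proof.
rewrite -lee_fin -sumEFin -esum_offspring.
by apply: (esum_ge_sum (f := fun k => (x k)%:E)) => k; rewrite lee_fin offspring_ge0.
Qed.

Lemma offspring1_lt1 : (x 1%N < 1)%R.
Proof. by rewrite -lte_fin -offspringE. Qed.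

Lemma offspring_big : exists2 j, (2 <= j)%N & (0 < x j)%R.
Proof.
apply: contrapT => none.
have x0 j : (2 <= j)%N -> x j = 0%R.
  move=> j2; apply/eqP; rewrite eq_le offspring_ge0 andbT leNgt.
  by apply/negP => xj; apply: none; exists j.
have : \esum_(k in setT) (k%:R * x k)%:E <= (x 1%N)%:E.
  apply: esum_nat_le => [k|K]; first by rewrite lee_fin mulr_ge0 ?offspring_ge0.
  rewrite sumEFin lee_fin; elim: K => [|[|[|K]] IH].
  - by rewrite big_ord0 offspring_ge0.
  - by rewrite big_ord1 mul0r offspring_ge0.
  - by rewrite !big_ord_recr big_ord0 /= mul0r mul1r !add0r.
  - by rewrite big_ord_recr /= [X in (_ + _ * X)%R]x0// mulr0 addr0.
by rewrite esum_mean lee_fin leNgt offspring1_lt1.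
Qed.

(** With no mass at 0, the mean 1 would leave no mass above 1. *)
Lemma offspring0_gt0 : (0 < x 0%N)%R.
Proof.
rewrite lt_neqAle offspring_ge0 andbT; apply/negP => /eqP/esym x0.
have [j j2 xj] := offspring_big.
have : \esum_(k in setT) (k%:R * x k)%:E =
    \esum_(k in setT) (x k)%:E + \esum_(k in setT) ((k.-1)%:R * x k)%:E.
  rewrite -esumD => [|k _|k _]; rewrite ?lee_fin ?mulr_ge0 ?offspring_ge0//.
  apply: eq_esum => -[|k] _; first by rewrite x0 !mulr0 adde0.
  by rewrite -EFinD -{2}[x k.+1]mul1r -mulrDl -natr1 addrC.
rewrite esum_mean esum_offspring.
have := @esum_ge_term _ (fun k => (k.-1%:R * x k)%:E) j _.
move=> h e; have {}h : ((j.-1)%:R * x j)%:E <= \esum_(k in setT) ((k.-1)%:R * x k)%:E.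
  by apply: h => i; rewrite lee_fin mulr_ge0 ?offspring_ge0.
have : 0 < ((j.-1)%:R * x j)%:E by rewrite lte_fin mulr_gt0// ltr0n; lia.
move=> /lt_le_trans/(_ h) s0.
have : (1 : \bar R) < 1 + \esum_(k in setT) ((k.-1)%:R * x k)%:E.
  by rewrite lteDl.
by rewrite -e ltxx.
Qed.

Section Size.
Variable w : pred nat.
Hypothesis w0 : w 0%N.
Local Notation msize := (marked_size w).
Local Notation fsize := (forest_size w).
Local Notation a := (size_mass xi w).

Definition mean_size := \esum_(p in finite_plane) (W p * ((msize p)%:R)%:E).

Lemma weight_size_ge0 p : 0 <= W p * ((msize p)%:R)%:E.
Proof. by rewrite mule_ge0 ?plane_weight_ge0// lee_fin. Qed.

Lemma forest_mean_size (e : R) k : mean_size = e%:E ->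
  \esum_(ps in forests k) (forest_weight xi ps * ((fsize ps)%:R)%:E) = (k%:R * e)%:E.
Proof.
move=> me; have e0 : (0 <= e)%R.
  by rewrite -lee_fin -me esum_ge0// => p _; exact: weight_size_ge0.
elim: k => [|k IH].
  rewrite esum_forests0; last by rewrite mule_ge0 ?forest_weight_ge0 ?lee_fin.
  by rewrite /forest_size big_nil mule0 mul0r.
rewrite esum_forestsS; last first.
  by move=> ps; rewrite mule_ge0 ?forest_weight_ge0 ?lee_fin.
transitivity (\esum_(p in finite_plane)
    (W p * ((msize p)%:R)%:E + W p * (k%:R * e)%:E)).
  apply: eq_esum => p fp.
  transitivity (\esum_(ps in forests k)
      ((fine (W p * ((msize p)%:R)%:E))%:E * forest_weight xi ps +
       (fine (W p))%:E * (forest_weight xi ps * ((fsize ps)%:R)%:E))).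
    apply: eq_esum => ps _; rewrite forest_weight_cons forest_size_cons.
    rewrite plane_weightE forest_weightE /= -!EFinM -EFinD natrD; congr EFin; ring.
  have fw ps : 0 <= forest_weight xi ps * ((fsize ps)%:R)%:E.
    by rewrite mule_ge0 ?forest_weight_ge0 ?lee_fin.
  rewrite esumD; last 2 first.
  - move=> ps _; rewrite mule_ge0 ?forest_weight_ge0// lee_fin fine_ge0//.
    exact: weight_size_ge0.
  - by move=> ps _; rewrite mule_ge0// lee_fin fine_plane_weight_ge0.
  rewrite esumZl ?fine_ge0 ?weight_size_ge0//; last exact: forest_weight_ge0.
  rewrite esumZl ?fine_plane_weight_ge0// IH forest_mass1// mule1 -plane_weightE.
  by rewrite fineK// plane_weightE -EFinM.
have ke : (0 <= k%:R * e)%R by rewrite mulr_ge0.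
rewrite esumD; last 2 first.
- by move=> p _; exact: weight_size_ge0.
- by move=> p _; rewrite mule_ge0 ?plane_weight_ge0// lee_fin.
rewrite -/mean_size me esumZr//; last exact: plane_weight_ge0.
by rewrite mass1 mul1e -EFinD; congr EFin; rewrite -natr1; ring.
Qed.

(** A finite mean e would satisfy e = E + e, where E > 0 is the probability
    that the root is marked, because the mean number of children is 1. *)
Lemma mean_size_infty : mean_size = +oo.
Proof.
have m0 : 0 <= mean_size by apply: esum_ge0 => p _; exact: weight_size_ge0.
case: (leP +oo mean_size) => [|fin]; first by rewrite leye_eq => /eqP.
have [e me] : exists e : R, mean_size = e%:E.
  by exists (fine mean_size); rewrite fineK// ge0_fin_numE.
have e0 : (0 <= e)%R by rewrite -lee_fin -me.
have : mean_size = \esum_(k in setT) ((w k)%:R * x k)%:E + e%:E.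
  rewrite /mean_size esum_finite_plane; last exact: weight_size_ge0.
  transitivity (\esum_(k in setT) (((w k)%:R * x k)%:E + e%:E * (k%:R * x k)%:E)).
    apply: eq_esum => k _.
    transitivity (\esum_(ps in forests k)
      ((x k * (w k)%:R)%:E * forest_weight xi ps +
       (x k)%:E * (forest_weight xi ps * ((fsize ps)%:R)%:E))).
      apply: eq_esum => ps [fps sz]; rewrite plane_weight_pbracket// sz.
      rewrite marked_size_pbracket// sz -/(forest_size w ps) natrD.
      by rewrite forest_weightE -!EFinM -EFinD; congr EFin; ring.
    have fw ps : 0 <= forest_weight xi ps * ((fsize ps)%:R)%:E.
      by rewrite mule_ge0 ?forest_weight_ge0 ?lee_fin.
    rewrite esumD; last 2 first.
    - by move=> ps _; rewrite mule_ge0 ?forest_weight_ge0// lee_fin mulr_ge0 ?offspring_ge0.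
    - by move=> ps _; rewrite mule_ge0// lee_fin offspring_ge0.
    rewrite (@esumZl _ _ _ _ (x k * (w k)%:R)%R); [|by rewrite mulr_ge0 ?offspring_ge0|exact: forest_weight_ge0].
    rewrite esumZl ?offspring_ge0// forest_mass1// (forest_mean_size _ me) mule1.
    by rewrite -!EFinM -!EFinD; congr EFin; ring.
  have kx k : 0 <= (k%:R * x k)%:E by rewrite lee_fin mulr_ge0 ?offspring_ge0.
  rewrite esumD; last 2 first.
  - by move=> k _; rewrite lee_fin mulr_ge0 ?offspring_ge0.
  - by move=> k _; rewrite mule_ge0// lee_fin.
  by rewrite esumZl// esum_mean mule1.
rewrite me => /eqP; rewrite eq_sym addeC.
have s0 : 0 < \esum_(k in setT) ((w k)%:R * x k)%:E.
  apply: lt_le_trans (esum_ge_term (f := fun k => ((w k)%:R * x k)%:E) 0 _).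
    by rewrite w0 mul1r lte_fin offspring0_gt0.
  by move=> k; rewrite lee_fin mulr_ge0 ?offspring_ge0.
have : e%:E < e%:E + \esum_(k in setT) ((w k)%:R * x k)%:E by rewrite lteDl.
by rewrite lt_neqAle eq_sym => /andP[/negbTE ->].
Qed.

Lemma mean_sizeE : mean_size = \esum_(n in setT) (n%:R * a n)%:E.
Proof.
rewrite /mean_size (@esum_partition _ _ _ _ setT msize)//; last first.
  by move=> p _; exact: weight_size_ge0.
apply: eq_esum => n _.
transitivity (\esum_(p in finite_plane `&` [set p | msize p = n]) W p * (n%:R)%:E).
  by apply: eq_esum => p [_ /= ->].
rewrite esumZr//; last exact: plane_weight_ge0.
by rewrite -GW_sized size_massE// EFinM muleC.
Qed.

Lemma size_mass_le1 n : (a n <= 1)%R.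
Proof. by rewrite -lee_fin -size_massE// GW_le1. Qed.

(** An exponential bound on size_mass would make the mean size finite. *)
Lemma size_mass_subexp (e : R) (M : nat) : (0 < e)%R ->
  exists2 n, (M <= n)%N & (expR (- (e * n%:R)) <= a n)%R.
Proof.
move=> e0; apply: contrapT => none.
have small n : (M <= n)%N -> (a n <= expR (- (e * n%:R)))%R.
  by move=> Mn; rewrite leNgt; apply/negP => /ltW h; apply: none; exists n.
pose q := expR (- (e / 2)).
have e20 : (0 < e / 2)%R by rewrite divr_gt0.
have q0 : (0 < q)%R by exact: expR_gt0.
have q1 : (q < 1)%R by rewrite expR_lt1 oppr_lt0.
have qn n : (q ^+ n = expR (- (e / 2 * n%:R)))%R.
  by rewrite -expRM_natl mulrN mulrC.
(* The first term of C is for n < M, the second one for n >= M and comes from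
   the bound of y by exp y. *)
pose C := (M%:R / q ^+ M + 2 / e)%R.
have C0 : (0 <= C)%R by rewrite addr_ge0// divr_ge0// ?exprn_ge0// ltW.
have bound n : (n%:R * a n <= C * q ^+ n)%R.
  rewrite mulrDl; case: (ltnP n M) => [nM|Mn].
    apply: (@le_trans _ _ (M%:R / q ^+ M * q ^+ n)%R); last first.
      by rewrite lerDl mulr_ge0 ?divr_ge0 ?exprn_ge0// ltW.
    rewrite -mulrA; apply: ler_pM => //; first by rewrite size_mass_ge0.
      by rewrite ler_nat ltnW.
    apply: le_trans (size_mass_le1 n) _.
    rewrite mulrC ler_pdivlMr ?exprn_gt0// mul1r.
    exact: (ler_wiXn2l (ltW q0) (ltW q1) (ltnW nM)).
  apply: (@le_trans _ _ (2 / e * q ^+ n)%R); last first.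
    by rewrite lerDr mulr_ge0 ?divr_ge0 ?exprn_ge0// ltW.
  apply: (@le_trans _ _ (n%:R * (q ^+ n * q ^+ n))%R).
    rewrite ler_wpM2l//; apply: le_trans (small _ Mn) _.
    by rewrite qn -expRD -opprD -mulrDl -splitr.
  rewrite mulrA ler_wpM2r ?exprn_ge0 ?(ltW q0)// qn expRN.
  rewrite ler_pdivrMr ?expR_gt0//.
  have nE : (n%:R = 2 / e * (e / 2 * n%:R))%R by field; rewrite gt_eqF.
  rewrite [leLHS]nE.
  rewrite ler_wpM2l ?divr_ge0 ?(ltW e0)//.
  by apply: le_trans (expR_ge1Dx _); rewrite lerDr.
have : mean_size <= (C / (1 - q))%:E.
  rewrite mean_sizeE; apply: esum_nat_le => [n|K].
    by rewrite lee_fin mulr_ge0 ?size_mass_ge0.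
  rewrite sumEFin lee_fin.
  apply: (@le_trans _ _ (\sum_(i < K) C * q ^+ i)%R); first by apply: ler_sum.
  rewrite -mulr_sumr ler_wpM2l// -[leRHS]mul1r ler_pdivlMr ?subr_gt0//.
  rewrite -opprB mulrN mulrC -subrX1 opprB lerBlDr lerDl exprn_ge0//; exact: ltW.
by rewrite mean_size_infty leye_eq.
Qed.

Lemma size_ratio (ms : seq nat) :
  (0 < x (size ms).+1)%R -> (forall m, m \in ms -> (0 < a m)%R) ->
  ratio_stable a (w (size ms).+1 + sumn ms).
Proof.
apply: size_ratio_cvg => //.
- exact: offspring_ge0.
- exact: sum_offspring_le1.
- exact: offspring0_gt0.
- exact: offspring_big.
- by move=> n; exact: size_mass_ge0.
- exact: size_mass0.
- by move=> N n; exact: size_mass_rec.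
- exact: size_mass_subexp.
Qed.

End Size.
End Critical.

(** * Lower bound for the conditioned trees *)

Lemma find_insert (T : Type) (a : pred T) (i : nat) (s : seq T) x :
  (i <= size s)%N -> ~~ has a s -> a x -> find a (take i s ++ x :: drop i s) = i.
Proof.
move=> i_s; rewrite -{1}(cat_take_drop i s) has_cat negb_or => /andP[ht _] ax.
by rewrite find_cat (negbTE ht) /= ax addn0 size_takel.
Qed.

Section KestenMass.
Variables (R : realType) (xi : probability nat R).
Local Notation W := (plane_weight xi).
Local Notation x := (offspring xi).

(** The probability that the bush at a given spine vertex consists of the trees
    ts, in this order. *)
Definition spine_weight (ts : seq tree) : \bar R :=
  size_biased xi (size ts).+1 * \prod_(t <- ts) GW_mass xi t.

(** The probability of a k-local set for Kesten's tree, exploring the bushes at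
    the first k spine vertices. At radius 0 membership is the same for all
    trees, and the single-vertex tree serves as a representative. *)
Fixpoint kesten_mass k (B : set tree) : \bar R :=
  if k is k'.+1 then
    \esum_(ts in all_in finite_tree) spine_weight ts * kesten_mass k' (extend B ts)
  else if `[< B (bracket [::]) >] then 1 else 0.

Definition plane_spine_weight (ps : seq planeTree) : R :=
  ((size ps).+1%:R * x (size ps).+1 * fine (forest_weight xi ps))%R.

Lemma plane_spine_weight_ge0 ps : (0 <= plane_spine_weight ps)%R.
Proof.
by rewrite !mulr_ge0 ?offspring_ge0 ?fine_ge0 ?forest_weight_ge0.
Qed.

Lemma spine_weight_ge0 ts : 0 <= spine_weight ts.
Proof.
rewrite mule_ge0//; first by rewrite /size_biased mule_ge0// lee_fin.
by apply: prode_ge0 => t _; exact: GW_mass_ge0.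
Qed.

Lemma kesten_mass_ge0 k B : 0 <= kesten_mass k B.
Proof.
elim: k B => [|k IH] B /=; first by case: ifP.
by apply: esum_ge0 => ts _; rewrite mule_ge0 ?spine_weight_ge0.
Qed.

Hypothesis mass1 : \esum_(p in finite_plane) W p = 1.

Lemma GW_set1 t : finite_tree t -> GW xi [set t] = GW_mass xi t.
Proof.
move=> ft; rewrite /GW (_ : _ `&` _ = [set t]).
  by rewrite esum_set1// GW_mass_ge0.
by apply/seteqP; split=> s /= => [[]|->].
Qed.

Lemma GW_massE t : finite_tree t -> GW_mass xi t = (fine (GW_mass xi t))%:E.
Proof. by move=> ft; rewrite fineK// -GW_set1// GW_fin. Qed.

Lemma prod_GW_massE ts : all_in finite_tree ts ->
  \prod_(t <- ts) GW_mass xi t = (fine (\prod_(t <- ts) GW_mass xi t))%:E.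
Proof.
move=> fts; rewrite fineK//.
elim: ts fts => [|t ts IH]; first by rewrite big_nil.
by move=> /all_in_cons[ft fts]; rewrite big_cons fin_numM ?IH// GW_massE.
Qed.

Lemma esum_forest_shapes ts : all_in finite_tree ts ->
  \esum_(ps in all_in finite_plane `&` [set ps | map shape ps = ts])
    forest_weight xi ps = \prod_(t <- ts) GW_mass xi t.
Proof.
elim: ts => [|t ts IH] fts.
  rewrite big_nil (_ : _ `&` _ = [set [::]]).
    by rewrite esum_set1 /forest_weight big_nil.
  by apply/seteqP; split=> [[|? ?] []//|ps /= ->]; split => //; exact: all_in_nil.
have /all_in_cons[ft {}fts] := fts.
rewrite big_cons.
transitivity (\esum_(p in [set p | shape p = t]) \esum_(ps in all_in finite_plane
    `&` [set ps | map shape ps = ts]) (W p * forest_weight xi ps)).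
  rewrite esum_esum; last first.
    by move=> p ps _ _; rewrite mule_ge0 ?plane_weight_ge0 ?forest_weight_ge0.
  rewrite (@reindex_esum _ _ _ ([set p | shape p = t] `*`` (fun=> all_in finite_plane
    `&` [set ps | map shape ps = ts])) _ (fun k => k.1 :: k.2)).
    by apply: eq_esum => -[p ps] _; rewrite forest_weight_cons.
  split.
  - move=> [p ps] /= [pt [fps <-]]; split; last by rewrite pt.
    by apply/all_in_cons; split=> //; apply/finite_tree_shape; rewrite pt.
  - by move=> [p ps] [q qs] _ _ /= [-> ->].
  - by move=> [|p ps] [] // /all_in_cons[fp fps] [pt pts]; exists (p, ps).
rewrite (prod_GW_massE fts) -esumZr.
- apply: eq_esum => p _; rewrite plane_weightE esumZl ?fine_plane_weight_ge0//.
    by rewrite IH// -prod_GW_massE.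
  exact: forest_weight_ge0.
- by apply/fine_ge0/prode_ge0 => s _; exact: GW_mass_ge0.
- exact: plane_weight_ge0.
Qed.

(** Sums over bushes are computed on plane representatives: the mass of a tree
    is the sum of the weights of the plane trees of that shape. *)
Lemma esum_spine_weight (H : seq tree -> R) : (forall ts, 0 <= H ts)%R ->
  \esum_(ts in all_in finite_tree) spine_weight ts * (H ts)%:E =
  \esum_(ps in all_in finite_plane) (plane_spine_weight ps * H (map shape ps))%:E.
Proof.
move=> H0; rewrite [RHS](@esum_partition _ _ _ _ (all_in finite_tree) (map shape)); last 2 first.
- move=> ps fps i t; rewrite onth_map; case E : (onth ps i) => [p|] //= [<-].
  by apply/finite_tree_shape; exact: fps E.
- by move=> ps _; rewrite lee_fin mulr_ge0 ?plane_spine_weight_ge0.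
apply: eq_esum => ts fts.
pose c := ((size ts).+1%:R * x (size ts).+1 * H ts)%R.
have c0 : (0 <= c)%R by rewrite !mulr_ge0 ?offspring_ge0.
transitivity (\esum_(ps in all_in finite_plane `&` [set ps | map shape ps = ts])
   (c%:E * forest_weight xi ps)); last first.
  apply: eq_esum => ps [_ /= ps_ts]; rewrite forest_weightE -EFinM; congr EFin.
  by rewrite /plane_spine_weight ps_ts /c -ps_ts size_map; ring.
rewrite esumZl//; last exact: forest_weight_ge0.
rewrite esum_forest_shapes// /spine_weight /size_biased offspringE prod_GW_massE//.
by rewrite /c -!EFinM; congr EFin; ring.
Qed.

Hypothesis mean_xi : \int[xi]_k (k%:R)%:E = 1.

Lemma esum_spine_weight1 : \esum_(ts in all_in finite_tree) spine_weight ts = 1.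
Proof.
transitivity (\esum_(ts in all_in finite_tree) spine_weight ts * (1%R)%:E).
  by apply: eq_esum => ts _; rewrite mule1.
rewrite (esum_spine_weight (H := fun=> 1%R))//.
rewrite (@esum_partition _ _ _ _ setT size)//; last first.
  by move=> ps _; rewrite lee_fin mulr1 plane_spine_weight_ge0.
transitivity (\esum_(k in setT) ((k.+1)%:R * x k.+1)%:E).
  apply: eq_esum => k _.
  transitivity (\esum_(ps in forests k) (((k.+1)%:R * x k.+1)%:E * forest_weight xi ps)).
    apply: eq_esum => ps [_ /= <-]; rewrite mulr1 forest_weightE -EFinM.
    by [].
  rewrite esumZl ?mulr_ge0 ?offspring_ge0//; last exact: forest_weight_ge0.
  by rewrite forest_mass1// mule1.
rewrite -[RHS](esum_mean mean_xi) [RHS](@esum_support _ _ _ [set k | (0 < k)%N]); last first.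
  by move=> [|k] _ //= _; rewrite mul0r.
apply/esym/(@reindex_esum _ _ _ setT _ S); split => //.
- by move=> i j _ _ [].
- by move=> [|k] [_ //]; exists k.
Qed.

Lemma kesten_mass_le1 k B : kesten_mass k B <= 1.
Proof.
elim: k B => [|k IH] B /=; first by case: ifP.
rewrite -esum_spine_weight1; apply: le_esum => ts _.
by rewrite -[leRHS]mule1 lee_wpmul2l// spine_weight_ge0.
Qed.

Definition kesten_prob k B : R := fine (kesten_mass k B).

Lemma kesten_probE k B : kesten_mass k B = (kesten_prob k B)%:E.
Proof.
by rewrite fineK// ge0_fin_numE ?kesten_mass_ge0// (le_lt_trans (kesten_mass_le1 k B)) ?ltry.
Qed.

Lemma kesten_prob_ge0 k B : (0 <= kesten_prob k B)%R.
Proof. exact/fine_ge0/kesten_mass_ge0. Qed.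

Lemma kesten_massS k B : kesten_mass k.+1 B =
  \esum_(ps in all_in finite_plane)
     (plane_spine_weight ps * kesten_prob k (extend B (map shape ps)))%:E.
Proof.
rewrite -(esum_spine_weight (H := fun ts => kesten_prob k (extend B ts))) /=.
  by apply: eq_esum => ts _; rewrite kesten_probE.
by move=> ts; exact: kesten_prob_ge0.
Qed.

Section SizeConditioning.
Hypothesis xi1_lt1 : xi [set 1%N] < 1.
Variable w : pred nat.
Hypothesis w0 : w 0%N.
Local Notation msize := (marked_size w).
Local Notation fsize := (forest_size w).
Local Notation a := (size_mass xi w).

Definition spine_size (ps : seq planeTree) := (w (size ps).+1 + fsize ps)%N.

(** If n > 2 m, a subtree of size n - r with r <= m is larger than all the
    trees of a bush of size at most m. It can be inserted at |ps| + 1 places of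
    the bush ps; the resulting plane trees have the same shape up to
    isomorphism and the same weight, and they are all different, even for
    different bushes, because the big subtree is recognised by its size. *)
Lemma GW_big_subtree (X : set (seq planeTree)) (B : set tree) (m n : nat) :
  X `<=` all_in finite_plane -> (forall ps, X ps -> (spine_size ps <= m)%N) ->
  (m + m < n)%N ->
  \esum_(ps in X) (plane_spine_weight ps)%:E *
     GW xi (extend B (map shape ps) `&` sized w (n - spine_size ps)) <=
  GW xi (B `&` sized w n).
Proof.
move=> Xfin Xm mn; pose p0 := pbracket [::].
have GWE C l : GW xi (C `&` sized w l) =
    \esum_(p in finite_plane `&` [set p | C (shape p) /\ msize p = l]) W p.
  rewrite GW_esum; congr esum; apply/seteqP; split=> p /= [fp [Cp]].
    by move=> /sized_shape[_ pl].
  by move=> pl; split=> //; split=> //; exact/sized_shape.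
pose P ps : set planeTree :=
  finite_plane `&` [set p | extend B (map shape ps) (shape p) /\ msize p = (n - spine_size ps)%N].
pose I : set (seq planeTree * (nat * planeTree)) :=
  X `*`` (fun ps => `I_(size ps).+1 `*`` (fun=> P ps)).
pose ins (k : seq planeTree * (nat * planeTree)) :=
  take k.2.1 k.1 ++ k.2.2 :: drop k.2.1 k.1.
pose big p := (m < msize p)%N.
have small ps : X ps -> ~~ has big ps.
  move=> /Xm psm; apply/hasPn => p pps; rewrite /big -leqNgt.
  apply: leq_trans psm; rewrite /spine_size /forest_size (big_rem p)//=.
  by rewrite addnCA leq_addr.
have bigp ps p : X ps -> P ps p -> big p.
  by move=> /Xm psm [_ [_ pn]]; rewrite /big pn; lia.
have perm_ins ps i p : (i <= size ps)%N -> perm_eq (ins (ps, (i, p))) (p :: ps).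
  by move=> i_s; rewrite /ins /= perm_catC /= perm_cons perm_catC cat_take_drop.
have weight_ins k : I k ->
    W (pbracket (ins k)) = (x (size k.1).+1 * fine (forest_weight xi k.1))%:E * W k.2.2.
  case: k => ps [i p] [/= Xps [/= i_s [fp _]]].
  have pe := perm_ins ps i p i_s.
  have fins : all_in finite_plane (ins (ps, (i, p))).
    by rewrite (perm_all_in _ pe); apply/all_in_cons; split => //; exact: Xfin.
  rewrite plane_weight_pbracket// (perm_size pe) /= EFinM -forest_weightE -muleA.
  by rewrite [forest_weight xi ps * _]muleC -forest_weight_cons /forest_weight (perm_big _ pe).
have sub_ins : (pbracket \o ins) @` I `<=`
    finite_plane `&` [set p | B (shape p) /\ msize p = n].
  move=> _ [[ps [i p]] [/= Xps [/= i_s [fp [Bp pn]]]] <-] /=.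
  have pe := perm_ins ps i p i_s.
  have fins : all_in finite_plane (ins (ps, (i, p))).
    by rewrite (perm_all_in _ pe); apply/all_in_cons; split => //; exact: Xfin.
  split; first exact/finite_pbracket.
  split.
    by rewrite shape_pbracket (perm_bracket (perm_map shape pe)).
  rewrite marked_size_pbracket// (perm_size pe) (perm_big _ pe) big_cons /=.
  rewrite -/(forest_size w ps) pn addnCA -/(spine_size ps) addnC subnKC//.
  by have := Xm _ Xps; lia.
have inj_ins : set_inj I (pbracket \o ins).
  (* The inserted tree is found again as the only one of size larger than m. *)
  pose del qs := (take (find big qs) qs ++ drop (find big qs).+1 qs,
                  (find big qs, nth p0 qs (find big qs))).
  have delK k : I k -> del (ins k) = k.
    case: k => ps [i p] [/= Xps [/= i_s Pp]]; rewrite /del /ins /=.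
    rewrite find_insert// ?small// ?(bigp ps)//.
    rewrite take_size_cat ?size_takel// nth_cat size_takel// ltnn subnn /=.
    by rewrite -cat_rcons drop_size_cat ?size_rcons ?size_takel// cat_take_drop.
  move=> k l; rewrite !inE => Ik Il /= e.
  rewrite -(delK k Ik) -(delK l Il); congr del.
  by rewrite -(children_pbracket (ins k)) e children_pbracket.
apply: le_trans (_ : \esum_(k in I) W (pbracket (ins k)) <= _); last first.
  rewrite GWE -(@esum_image _ _ _ I (pbracket \o ins))//.
  exact: esum_subset.
rewrite (eq_esum weight_ins).
rewrite -(@esum_esum _ _ _ X (fun ps => `I_(size ps).+1 `*`` (fun=> P ps))
  (fun ps ip => (x (size ps).+1 * fine (forest_weight xi ps))%:E * W ip.2)); last first.
  move=> ps [i p] _ _; rewrite mule_ge0 ?plane_weight_ge0// lee_fin.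
  by rewrite mulr_ge0 ?offspring_ge0 ?fine_ge0 ?forest_weight_ge0.
apply: le_esum => ps Xps /=.
have c0 : (0 <= x (size ps).+1 * fine (forest_weight xi ps))%R.
  by rewrite mulr_ge0 ?offspring_ge0 ?fine_ge0 ?forest_weight_ge0.
rewrite -(@esum_esum _ _ _ `I_(size ps).+1 (fun=> P ps)
  (fun _ p => (x (size ps).+1 * fine (forest_weight xi ps))%:E * W p)); last first.
  by move=> i p _ _; rewrite mule_ge0 ?plane_weight_ge0.
rewrite esum_ord; last first.
  by move=> i; apply: esum_ge0 => p _; rewrite mule_ge0 ?plane_weight_ge0.
rewrite GWE esumZl//; last exact: plane_weight_ge0.
rewrite -(@fineK _ (\esum_(p in P ps) W p)); last by rewrite -GWE GW_fin.
by rewrite -!EFinM sumEFin lee_fin sumr_const card_ord -mulr_natl !mulrA.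
Qed.

Definition sized_prob n B : R := fine (GW xi (B `&` sized w n)).

Lemma sized_probE n B : GW xi (B `&` sized w n) = (sized_prob n B)%:E.
Proof. by rewrite fineK// GW_fin. Qed.

Lemma sized_prob_ge0 n B : (0 <= sized_prob n B)%R.
Proof. exact/fine_ge0/measure_ge0. Qed.

Local Notation F := (within [set n : nat | (0 < a n)%R] \oo).

Lemma plane_spine_weight_gt0 ps : all_in finite_plane ps -> (0 < plane_spine_weight ps)%R ->
  ratio_stable a (spine_size ps).
Proof.
move=> fps c0.
have [xk fw] : (0 < x (size ps).+1)%R /\ (0 < fine (forest_weight xi ps))%R.
  split; rewrite lt_neqAle ?offspring_ge0 ?fine_ge0 ?forest_weight_ge0// andbT;
    apply: contraTN c0 => /eqP; rewrite /plane_spine_weight => <-;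
    by rewrite ?mulr0 ?mul0r ?ltxx.
have := @size_ratio _ xi mass1 mean_xi xi1_lt1 w w0 (map msize ps).
rewrite size_map => /(_ xk); rewrite /spine_size /forest_size sumnE big_map; apply.
move=> _ /mapP[p p_ps ->]; rewrite -lte_fin -size_massE// GW_sized.
have Wp : 0 < W p.
  rewrite plane_weightE lte_fin lt_neqAle fine_plane_weight_ge0 andbT.
  apply: contraTN fw => /eqP Wp0.
  by rewrite /forest_weight (big_rem p)//= plane_weightE -Wp0 mul0e ltxx.
apply: lt_le_trans Wp _; rewrite -[leLHS](esum_set1 (plane_weight_ge0 _ _)).
apply: esum_subset => _ ->; split => //.
by move/all_inP : fps; exact.
Qed.

(** The event that the root carries a bush from a finite list and one big
    subtree decreases the radius by one, up to the size n - r left to the big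
    subtree. The ratio theorem replaces n - r by n, and the finite lists
    exhaust [kesten_mass]. *)
Lemma local_lower k B (rho : R) : is_local k B -> (0 <= rho < 1)%R ->
  \forall n \near F, (rho * a n * kesten_prob k B <= sized_prob n B)%R.
Proof.
elim: k B rho => [|k IH] B rho lB /andP[rho0 rho1].
  apply: nearW => n; rewrite /kesten_prob /=; case: ifPn => [/asboolP B0|_] /=; last first.
    by rewrite mulr0 sized_prob_ge0.
  rewrite mulr1 /sized_prob (_ : B `&` _ = sized w n).
    by rewrite size_massE//= ler_piMl ?size_mass_ge0 ?ltW.
  apply/seteqP; split=> t [] // ft nt; split=> //.
  exact: (lB _ _ (trunc_root _ _) B0).
have [K0|Kpos] := eqVneq (kesten_prob k.+1 B) 0%R.
  by apply: nearW => n; rewrite K0 mulr0 sized_prob_ge0.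
have {}Kpos : (0 < kesten_prob k.+1 B)%R by rewrite lt_neqAle eq_sym Kpos kesten_prob_ge0.
(* A factor l is lost when keeping finitely many bushes, another one in the
   ratio of sizes, a third one in the induction hypothesis. *)
pose d := ((1 - rho) / 3)%R; pose l := (1 - d)%R.
have d0 : (0 < d)%R by rewrite divr_gt0// subr_gt0.
have d1 : (d <= 3^-1)%R by rewrite /d ler_piMl// lerBlDr lerDl.
have l1 : (l < 1)%R by rewrite /l; lra.
have l0 : (0 < l)%R by rewrite /l; lra.
have lrho : (rho <= l * l * l)%R.
  have -> : rho = (1 - 3 * d)%R by rewrite /d; field.
  by rewrite /l; nra.
pose c ps := (plane_spine_weight ps * kesten_prob k (extend B (map shape ps)))%R.
have c0 ps : (0 <= c ps)%R by rewrite mulr_ge0 ?plane_spine_weight_ge0 ?kesten_prob_ge0.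
have [X [finX Xfin] lX] : exists2 X, fsets (all_in finite_plane) X &
    (l * kesten_prob k.+1 B)%:E < \sum_(ps \in X) (c ps)%:E.
  have : (l * kesten_prob k.+1 B)%:E < kesten_mass k.+1 B.
    by rewrite kesten_probE lte_fin gtr_pMl.
  by rewrite kesten_massS => /ereal_sup_gt[_ [X hX <-] lt]; exists X.
have near_terms ps : X ps -> \forall n \near F,
    (l * l * a n * c ps <=
     plane_spine_weight ps * sized_prob (n - spine_size ps) (extend B (map shape ps)))%R.
  move=> /Xfin fps; have [c00|cpos] := eqVneq (plane_spine_weight ps) 0%R.
    by apply: nearW => n; rewrite /c c00 !mul0r mulr0.
  have stable : ratio_stable a (spine_size ps).
    by apply: plane_spine_weight_gt0; rewrite // lt_neqAle eq_sym cpos plane_spine_weight_ge0.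
  have loc : is_local k (extend B (map shape ps)) := is_local_extend lB.
  have := IH _ l loc; rewrite l1 (ltW l0) => /(_ erefl) IHps.
  have nearIH := ratio_stable_shift stable IHps.
  have nearR : \forall n \near F, (l * a n <= a (n - spine_size ps)%N)%R.
    move/cvgrPdist_le : stable => /(_ _ d0) stable.
    have an := a_near a.
    near=> n; have apos : (0 < a n)%R by near: n.
    rewrite -ler_pdivlMr//.
    have : (`|1 - a (n - spine_size ps)%N / a n| <= d)%R by near: n.
    by rewrite ler_norml /l => /andP[_]; lra.
  near=> n.
  have h1 : (l * a (n - spine_size ps)%N * kesten_prob k (extend B (map shape ps)) <=
     sized_prob (n - spine_size ps) (extend B (map shape ps)))%R by near: n.
  have h2 : (l * a n <= a (n - spine_size ps)%N)%R by near: n.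
  rewrite mulrCA ler_wpM2l ?plane_spine_weight_ge0//; apply: le_trans h1.
  by rewrite ler_wpM2r ?kesten_prob_ge0// -mulrA ler_wpM2l// ltW.
have [m Xm] : exists m, forall ps, X ps -> (spine_size ps <= m)%N.
  exists (\max_(ps <- fset_set X) spine_size ps)%N => ps Xps.
  by apply: leq_bigmax_seq; rewrite // in_fset_set// inE.
have nearX : \forall n \near F, forall ps, X ps -> (l * l * a n * c ps <=
     plane_spine_weight ps * sized_prob (n - spine_size ps) (extend B (map shape ps)))%R.
  exact: near_forall_finite finX near_terms.
near=> n.
have hX : forall ps, X ps -> (l * l * a n * c ps <=
     plane_spine_weight ps * sized_prob (n - spine_size ps) (extend B (map shape ps)))%R.
  by near: n.
have mn : (m + m < n)%N by near: n; exact: pos_near.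
have := GW_big_subtree B Xfin Xm mn; rewrite sized_probE -lee_fin; apply: le_trans.
rewrite esum_fset//; last first.
  by move=> ps _; rewrite mule_ge0 ?lee_fin ?plane_spine_weight_ge0.
apply: (@le_trans _ _ ((l * l * a n)%:E * \sum_(ps \in X) (c ps)%:E)).
  have a0 : (0 <= a n)%R by exact: size_mass_ge0.
  apply: (@le_trans _ _ ((l * l * a n)%:E * (l * kesten_prob k.+1 B)%:E)).
    rewrite -EFinM lee_fin.
    have -> : (l * l * a n * (l * kesten_prob k.+1 B) = 
       (l * l * l) * a n * kesten_prob k.+1 B)%R by ring.
    by rewrite ler_wpM2r ?kesten_prob_ge0// ler_wpM2r.
  by rewrite lee_wpmul2l ?(ltW lX)// lee_fin !mulr_ge0 ?(ltW l0).
rewrite ge0_mule_fsumr; last by move=> ps; rewrite lee_fin.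
apply: lee_fsum => // ps Xps.
by rewrite sized_probE -!EFinM lee_fin hX.
Unshelve. all: by end_near. Qed.

End SizeConditioning.
End KestenMass.

(** * Upper bound for Kesten's tree *)

Definition tree_code (t : tree) : nat := @choice.pickle {fset (seq nat)} (fset_set (verts (repr t))).

Lemma tree_code_inj t s : finite_tree t -> finite_tree s -> tree_code t = tree_code s -> t = s.
Proof.
move=> ft fs /(pcan_inj (@choice.pickleK {fset (seq nat)}))/(fset_set_inj ft fs)/planeTree_eq e.
by rewrite -[t]shape_repr -[s]shape_repr e.
Qed.

(** Countability of the set of finite trees makes countable unions over bushes
    measurable. *)
Definition forest_code (ts : seq tree) : nat := choice.pickle (map tree_code ts).

Lemma forest_code_inj : {in all_in finite_tree &, injective forest_code}.
Proof.
move=> ts ss; rewrite !inE => fts fss /(pcan_inj choice.pickleK) e.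
elim: ts ss fts fss e => [|t ts IH] [|s ss] // /all_in_cons[ft fts] /all_in_cons[fs fss] [e es].
by rewrite (tree_code_inj ft fs e) (IH ss).
Qed.

Section CountableUnion.
Context d (T : measurableType d) (R : realType) (mu : {measure set T -> \bar R}).
Variables (I : choiceType) (D : set I) (code : I -> nat).
Hypothesis code_inj : {in D &, injective code}.
Variable E : I -> set T.
Hypothesis mE : forall i, D i -> measurable (E i).

Let E' n := \bigcup_(i in D `&` [set i | code i = n]) E i.

Let E'P n : E' n = set0 \/ exists2 i, D i & code i = n /\ E' n = E i.
Proof.
have [[i Di ci]|none] := pselect (exists2 i, D i & code i = n); [right|left].
  exists i => //; split=> //; apply/seteqP; split=> w; last by exists i.
  move=> [j [Dj /= cj] Ej]; suff -> : i = j by [].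
  by apply: code_inj; rewrite ?inE// ci cj.
by apply/seteqP; split=> w // [j [Dj cj] _]; apply: none; exists j.
Qed.

Let mE' n : measurable (E' n).
Proof. by have [->|[i Di [_ ->]]] := E'P n; [exact: measurable0|exact: mE]. Qed.

Let bigcupE' : \bigcup_(i in D) E i = \bigcup_n E' n.
Proof.
apply/seteqP; split=> w [i Di Ei]; first by exists (code i) => //; exists i.
by case: Ei => j [Dj _] Ej; exists j.
Qed.

Lemma countable_bigcup_measurable : measurable (\bigcup_(i in D) E i).
Proof. by rewrite bigcupE'; exact: bigcup_measurable. Qed.

Lemma measure_countable_bigcup_le : mu (\bigcup_(i in D) E i) <= \esum_(i in D) mu (E i).
Proof.
rewrite bigcupE'; apply: (@le_trans _ _ (\sum_(0 <= n <oo) mu (E' n))).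
  by apply: measure_sigma_subadditive => //; exact: bigcup_measurable.
rewrite nneseries_esumT// (@esum_partition _ _ _ D setT code)//.
apply: le_esum => n _; have [->|[i Di [ci ->]]] := E'P n.
  by rewrite measure0 esum_ge0.
rewrite -[leLHS](@esum_set1 R I i (fun i => mu (E i)) (measure_ge0 mu (E i))).
by apply: esum_subset => _ ->.
Qed.

End CountableUnion.

Lemma bounded_depth p : finite_plane p -> exists h, forall u, verts p u -> (size u <= h)%N.
Proof.
move=> fin; exists (\max_(u <- fset_set (verts p)) size u)%N => u pu.
by apply: leq_bigmax_seq; rewrite // in_fset_set// inE.
Qed.

Lemma ptrunc_id k p : (forall u, verts p u -> (size u <= k)%N) -> ptrunc k p = p.
Proof.
move=> h; apply: planeTree_eq; apply/seteqP; split=> u; first by case.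
by move=> pu; split => //; exact: h.
Qed.

(** If t has height h, a tree with the same truncation at h + 1 has no vertex at
    depth h + 1, hence none deeper, and is therefore equal to t. *)
Lemma finite_tree_local t : finite_tree t -> exists k, is_local k [set t].
Proof.
move=> ft; have [h hp] := bounded_depth ft; exists h.+1 => t1 s e /= t1t.
have tE : t = shape (ptrunc h.+1 (repr s)).
  rewrite -trunc_shape shape_repr -e t1t -[in RHS](shape_repr t) trunc_shape.
  by rewrite ptrunc_id ?shape_repr// => u /hp/leqW.
have small u : verts (repr s) u -> (size u <= h.+1)%N.
  move=> su; rewrite leqNgt; apply/negP => hu.
  have [f isof] := (eq_shape (repr t) (ptrunc h.+1 (repr s))).1 (etrans (shape_repr t) tE).
  have sv : verts (ptrunc h.+1 (repr s)) (take h.+1 u).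
    split; last by rewrite size_takel// ltnW.
    by move: su; rewrite -{1}(cat_take_drop h.+1 u) => /verts_prefix.
  have [[_ _ f3] _ _] := isof; have [v tv fv] := f3 _ sv.
  have := is_tree_iso_size isof tv; rewrite fv size_takel; last exact: ltnW.
  by move=> sz; have := hp _ tv; rewrite -sz ltnn.
by rewrite ptrunc_id ?shape_repr in tE.
Qed.

Section Kesten.
Variables (R : realType) (xi : probability nat R).
Context d (Omega : measurableType d) (P : probability Omega R).
Variables (X : nat -> {RV P >-> nat}) (T : nat -> nat -> {RV P >-> locTree R}).
Hypothesis lawX : forall n k, P [set w | (X n w).+1 = k] = size_biased xi k.
Hypothesis lawT : forall n k B, measurable B -> distribution P (T n k) B = GW xi B.
Hypothesis indep : mutually_independent P (fun i : nat + nat * nat => match i with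
          | inl n => g_sigma_algebra_preimage (X n)
          | inr nk => g_sigma_algebra_preimage (T nk.1 nk.2) end).

(** The trees of the bushes have a probability law, so [GW] has mass 1. *)
Lemma kesten_mass1 : \esum_(p in finite_plane) plane_weight xi p = 1.
Proof.
have := lawT 0 0 measurableT; rewrite probability_setT GW_esum => ->.
by congr esum; apply/seteqP; split=> p; [split|case].
Qed.

Definition kesten_from i w : tree :=
  kesten_tree (fun n => X (n + i)%N w) (fun n k => T (n + i)%N k w).

Lemma kesten_fromE i w : kesten_from i w =
  bracket (kesten_from i.+1 w :: mkseq (fun k => T i k w : tree) (X i w)).
Proof.
rewrite {1}/kesten_from kesten_treeE; congr (bracket (_ :: _)).
by rewrite /kesten_from; congr kesten_tree; apply/funext => n /=; rewrite addnS.
Qed.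

Lemma measurable_X i k : measurable [set w | X i w = k].
Proof.
have -> : [set w | X i w = k] = setT `&` X i @^-1` [set k] by rewrite setTI.
exact: measurable_funPT.
Qed.

Lemma measurable_T i j (B : set (locTree R)) : measurable B ->
  measurable [set w | B (T i j w)].
Proof.
move=> mB; have -> : [set w | B (T i j w)] = setT `&` T i j @^-1` B by rewrite setTI.
exact: measurable_funPT.
Qed.

Lemma measurable_forall n (A : nat -> set Omega) : (forall j, measurable (A j)) ->
  measurable [set w | forall j, (j < n)%N -> A j w].
Proof.
move=> mA; have -> : [set w | forall j, (j < n)%N -> A j w] =
    \bigcap_j (if (j < n)%N then A j else setT).
  apply/seteqP; split=> w h j; first by move=> _; case: ifP => [/h|].
  by move=> jn; have := h j I; rewrite jn.
by apply: bigcapT_measurable => j; case: ifP.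
Qed.

Lemma local_measurable k (B : set tree) : is_local k B -> measurable (B : set (locTree R)).
Proof. by move=> lB; apply: open_measurable_locTree; apply: local_open lB. Qed.

Let t0 := bracket [::].

(** Only the truncations of the trees in the first bush matter, and truncations
    are finite trees, hence there are countably many cases. *)
Lemma measurable_kesten_from k i B : is_local k B ->
  measurable [set w | B (kesten_from i w)].
Proof.
elim: k i B => [|k IH] i B lB.
  have [Bt|nBt] := pselect (B t0).
    rewrite (_ : [set _ | _] = setT); first exact: measurableT.
    by apply/seteqP; split=> w // _; exact: (lB _ _ (trunc_root _ _) Bt).
  rewrite (_ : [set _ | _] = set0); first exact: measurable0.
  apply/seteqP; split=> w // Bw; apply: nBt.
  exact: (lB _ _ (trunc_root _ _) Bw).
pose E ts := [set w | X i w = size ts] `&`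
  [set w | forall j, (j < size ts)%N -> trunc k (T i j w) = nth t0 ts j] `&`
  [set w | extend B ts (kesten_from i.+1 w)].
have key ts w : X i w = size ts ->
    (forall j, (j < size ts)%N -> trunc k (T i j w) = nth t0 ts j) ->
    trunc k.+1 (kesten_from i w) = trunc k.+1 (bracket (kesten_from i.+1 w :: ts)).
  move=> Xi Tij; rewrite kesten_fromE Xi !trunc_bracket /=; congr (bracket (_ :: _)).
  apply: (@eq_from_nth _ t0); rewrite !size_map ?size_iota// => j j_s.
  rewrite (nth_map t0) ?size_mkseq// nth_mkseq// (nth_map t0)//.
  by rewrite -Tij// trunc_trunc.
have -> : [set w | B (kesten_from i w)] = \bigcup_(ts in all_in finite_tree) E ts.
  apply/seteqP; split=> w /=.
    move=> Bw; pose ts := map (trunc k) (mkseq (fun k => T i k w : tree) (X i w)).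
    have Xts : X i w = size ts by rewrite !size_map size_iota.
    have Tts j : (j < size ts)%N -> trunc k (T i j w) = nth t0 ts j.
      by rewrite -Xts => j_s; rewrite (nth_map t0) ?size_mkseq// nth_mkseq.
    exists ts.
      by apply/all_inP => t /mapP[s _ ->]; exact: finite_trunc.
    by split=> //; apply: (lB _ _ (key ts w Xts Tts) Bw).
  move=> [ts _ [[Xts Tts] Bw]]; exact: (lB _ _ (esym (key ts w Xts Tts)) Bw).
apply: (countable_bigcup_measurable forest_code_inj) => ts _.
apply: measurableI; first apply: measurableI.
- exact: measurable_X.
- apply: measurable_forall => j; apply: (@measurable_T i j [set t | trunc k t = nth t0 ts j]).
  apply: (@local_measurable k) => t s ts_eq /= <-.
  by rewrite ts_eq.
- by apply: IH; exact: is_local_extend lB.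
Qed.

Definition level_event i ts : set Omega :=
  [set w | X i w = size ts /\ forall j, (j < size ts)%N -> T i j w = nth t0 ts j].

Definition history_event (D : seq (seq tree)) : set Omega :=
  [set w | forall i, (i < size D)%N -> level_event i (nth [::] D i) w].

Lemma measurable_finite_set1 t : finite_tree t -> measurable ([set t] : set (locTree R)).
Proof. by move=> /finite_tree_local[k]; exact: local_measurable. Qed.

(** The independence hypothesis is used here, for the finitely many variables
    which describe the first bushes. *)
Lemma history_event_prob D : all_in (all_in finite_tree) D ->
  P (history_event D) = \prod_(ts <- D) spine_weight xi ts.
Proof.
move=> fD.
have fDn i j : finite_tree (nth t0 (nth [::] D i) j).
  have ft0 : finite_tree t0 by apply/finite_tree_shape/finite_pbracket; exact: all_in_nil.
  case: (ltnP i (size D)) => i_s; last by rewrite (nth_default [::] i_s) nth_nil.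
  case: (ltnP j (size (nth [::] D i))) => j_s; last by rewrite nth_default.
  by apply: (fD _ _ (onth_nthP [::] i_s)); exact: onth_nthP.
pose idx n : seq (nat + nat * nat) :=
  inl n :: [seq inr (n, k) | k <- iota 0 (size (nth [::] D n))].
pose J := [seq j | n <- iota 0 (size D), j <- idx n].
pose E (j : nat + nat * nat) : set Omega := match j with
  | inl n => [set w | X n w = size (nth [::] D n)]
  | inr nk => [set w | T nk.1 nk.2 w = nth t0 (nth [::] D nk.1) nk.2] end.
have idx_tag n j : j \in idx n -> (match j with inl m => m | inr mk => mk.1 end) = n.
  by rewrite in_cons => /predU1P[->//|/mapP[k _ ->]].
have uJ : uniq J.
  apply: allpairs_uniq_dep; first exact: iota_uniq.
    move=> n _; rewrite /= map_inj_uniq ?iota_uniq ?andbT; last by move=> ? ? [].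
    by apply/mapP => -[].
  move=> [n j] [m l] /allpairsPdep[? [? [_ jn [-> ->]]]] /allpairsPdep[? [? [_ lm [-> ->]]]] /= e.
  by rewrite -(idx_tag _ _ jn) -(idx_tag _ _ lm) /= e.
have -> : history_event D = \bigcap_(j in [set` [fset j in J]%fset]) E j.
  apply/seteqP; split=> w /=.
    move=> h j /=; rewrite inE => /allpairsPdep[n [l [+ + ->]]].
    rewrite mem_iota /= => n_s; have [Xn Tn] := h n n_s.
    rewrite in_cons => /predU1P[->//|/mapP[k]].
    by rewrite mem_iota /= => k_s ->; exact: Tn.
  move=> h n n_s; split.
    apply: (h (inl n)); rewrite /= inE; apply/allpairsPdep; exists n, (inl n).
    by rewrite mem_iota n_s mem_head.
  move=> k k_s; apply: (h (inr (n, k))); rewrite /= inE; apply/allpairsPdep.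
  exists n, (inr (n, k)); rewrite mem_iota n_s; split=> //.
  by rewrite in_cons; apply/orP; right; apply: map_f; rewrite mem_iota.
rewrite (@indep _ E); last first.
  move=> [n|[n k]] _ /=.
    by exists [set size (nth [::] D n)] => //; rewrite setTI.
  exists [set nth t0 (nth [::] D n) k]; last by rewrite setTI.
  exact: measurable_finite_set1.
have pJ : perm_eq [fset j in J]%fset J.
  by apply: uniq_perm; [exact: fset_uniq|exact: uJ|move=> j; rewrite inE].
rewrite (perm_big _ pJ) /= big_allpairs_dep.
rewrite (big_nth [::]) /index_iota subn0 big_seq [RHS]big_seq.
apply: eq_bigr => n; rewrite mem_iota /= => n_s.
rewrite big_cons big_map /spine_weight; congr (_ * _).
  rewrite -(lawX n); congr (P _); apply/seteqP; split=> w /=; first by move=> ->.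
  by move=> [].
rewrite (big_nth t0) /index_iota subn0 big_seq [RHS]big_seq.
apply: eq_bigr => k; rewrite mem_iota /= => k_s.
have ft := fDn n k.
by rewrite -GW_set1// -(lawT n k)//; exact: measurable_finite_set1.
Qed.

Lemma measurable_level i ts : all_in finite_tree ts -> measurable (level_event i ts).
Proof.
move=> fts; have -> : level_event i ts = [set w | X i w = size ts] `&`
    [set w | forall j, (j < size ts)%N ->
       (if (j < size ts)%N then [set w | T i j w = nth t0 ts j] else setT) w].
  apply/seteqP; split=> w /= [h1 h2]; split=> // j j_s.
    by rewrite j_s; exact: h2.
  by have := h2 j j_s; rewrite j_s.
apply: measurableI; first exact: measurable_X.
apply: measurable_forall => j; case: ifP => // j_s.
apply: (@measurable_T i j [set nth t0 ts j]); apply: measurable_finite_set1.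
exact: fts (onth_nthP _ _).
Qed.

Lemma history_event_rcons D ts :
  history_event (rcons D ts) = history_event D `&` level_event (size D) ts.
Proof.
apply/seteqP; split=> w /=.
  move=> h; split=> [i i_s|].
    by have := h i; rewrite size_rcons nth_rcons i_s; apply; exact: ltnW.
  by have := h (size D); rewrite size_rcons nth_rcons ltnn eqxx; apply.
move=> [h1 h2] i; rewrite size_rcons ltnS leq_eqVlt nth_rcons.
case: ltnP => [i_s _|_]; first exact: h1.
by rewrite orbF => /eqP ->; rewrite eqxx.
Qed.

Lemma measurable_history D : all_in (all_in finite_tree) D -> measurable (history_event D).
Proof.
elim/last_ind: D => [|D ts IH] fD.
  rewrite (_ : history_event _ = setT); first exact: measurableT.
  by apply/seteqP; split=> w // _ i.
rewrite history_event_rcons; apply: measurableI.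
  apply: IH; apply/all_inP => ss sD; move/all_inP : fD; apply.
  by rewrite mem_rcons in_cons sD orbT.
apply: measurable_level; move/all_inP : fD; apply.
by rewrite mem_rcons mem_head.
Qed.

Lemma measurable_infinite_trees : measurable ([set t | ~ finite_tree t] : set (locTree R)).
Proof.
have -> : ([set t | ~ finite_tree t] : set (locTree R)) =
    ~` \bigcup_n (trees_with_vertices n : set (locTree R)).
  apply/seteqP; split=> t /=.
    by move=> nft [n _ /= tn]; apply: nft; apply/finite_setP; exists n.
  by move=> h ft; apply: h; have /finite_setP[n tn] := ft; exists n.
apply: measurableC; apply: bigcup_measurable => n _.
exact: measurable_trees_with_vertices.
Qed.

Lemma infinite_bush0 i : P (\bigcup_j [set w | ~ finite_tree (T i j w)]) = 0.
Proof.
apply/eqP; rewrite eq_le measure_ge0 andbT.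
have mfin := measurable_infinite_trees.
apply: (@le_trans _ _ (\esum_(j in setT) P [set w | ~ finite_tree (T i j w)])).
  apply: (@measure_countable_bigcup_le _ _ _ P _ setT id) => // j _.
  exact: (measurable_T i j mfin).
rewrite esum1// => j _.
have := lawT i j mfin; rewrite /distribution /= /pushforward => ->.
by rewrite /GW (_ : _ `&` _ = set0) ?esum_set0//; apply/seteqP; split=> t // [].
Qed.

(** Given the bushes D at the first spine vertices, the next bush is finite
    almost surely, so that the event is covered by the countably many cases for
    this bush, up to a negligible set. *)
Lemma kesten_history_le k D B : all_in (all_in finite_tree) D -> is_local k B ->
  P (history_event D `&` [set w | B (kesten_from (size D) w)]) <=
  (\prod_(ts <- D) spine_weight xi ts) * kesten_mass xi k B.
Proof.
elim: k D B => [|k IH] D B fD lB.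
  rewrite /=; case: asboolP => [Bt|nBt].
    rewrite mule1 -history_event_prob//; apply: le_measure; rewrite ?inE.
    - apply: measurableI; first exact: measurable_history.
      exact: measurable_kesten_from lB.
    - exact: measurable_history.
    - exact: subIsetl.
  rewrite (_ : _ `&` _ = set0) ?measure0 ?mule0//; apply/seteqP; split=> w // [_ /= Bw].
  by apply: nBt; exact: (lB _ _ (trunc_root _ _) Bw).
pose i := size D.
pose E ts := history_event (rcons D ts) `&`
   [set w | extend B ts (kesten_from (size (rcons D ts)) w)].
pose N := \bigcup_j [set w | ~ finite_tree (T i j w)].
have frcons ts : all_in finite_tree ts -> all_in (all_in finite_tree) (rcons D ts).
  move=> fts; apply/all_inP => ss; rewrite mem_rcons in_cons => /predU1P[->//|].
  by move/all_inP : fD; exact.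
have mE ts : all_in finite_tree ts -> measurable (E ts).
  move=> fts; apply: measurableI; first by apply: measurable_history; exact: frcons.
  by apply: (@measurable_kesten_from k); exact: is_local_extend lB.
have mN : measurable N.
  by apply: bigcup_measurable => j _; exact: (measurable_T i j measurable_infinite_trees).
have mU := countable_bigcup_measurable forest_code_inj mE.
apply: (@le_trans _ _ (P (\bigcup_(ts in all_in finite_tree) E ts `|` N))).
  apply: le_measure; rewrite ?inE.
  - apply: measurableI; first exact: measurable_history.
    exact: measurable_kesten_from lB.
  - exact: measurableU.
  move=> w [hw /= Bw]; have [fT|] := pselect (forall j, finite_tree (T i j w)); last first.
    by move=> /existsNP[j nf]; right; exists j.
  left; pose ts := mkseq (fun k => T i k w : tree) (X i w).
  have fts : all_in finite_tree ts by apply/all_inP => t /mapP[j _ ->]; exact: fT.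
  exists ts => //; split.
    rewrite history_event_rcons; split=> //; split; first by rewrite size_mkseq.
    by rewrite size_mkseq => j j_s; rewrite nth_mkseq.
  by rewrite size_rcons /extend /= -kesten_fromE.
apply: (@le_trans _ _ (P (\bigcup_(ts in all_in finite_tree) E ts) + P N)).
  exact: measureU2.
rewrite infinite_bush0 adde0.
apply: (le_trans (measure_countable_bigcup_le P forest_code_inj mE)).
have prodE : \prod_(ts <- D) spine_weight xi ts =
    (fine (\prod_(ts <- D) spine_weight xi ts))%:E.
  by rewrite fineK// -history_event_prob// fin_num_measure//; exact: measurable_history.
rewrite [kesten_mass _ _ _]/= prodE -esumZl; last 2 first.
- by apply/fine_ge0/prode_ge0 => ts _; exact: spine_weight_ge0.
- by move=> ts; rewrite mule_ge0 ?spine_weight_ge0 ?kesten_mass_ge0.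
apply: le_esum => ts fts.
apply: (le_trans (IH _ _ (frcons _ fts) (is_local_extend lB))).
by rewrite -cats1 big_cat big_seq1 -prodE muleA.
Qed.

Lemma kesten_local_le k B : is_local k B ->
  P [set w | B (kesten_tree (fun n => X n w) (fun n j => T n j w))] <= kesten_mass xi k B.
Proof.
move=> lB; have nilD : all_in (all_in finite_tree) [::] by exact: all_in_nil.
have := kesten_history_le nilD lB; rewrite big_nil mul1e; congr (P _ <= _).
have kesten0 w : kesten_from 0 w = kesten_tree (fun n => X n w) (fun n j => T n j w).
  by congr kesten_tree; apply/funext => n; rewrite addn0.
apply/seteqP; split=> w /=; rewrite kesten0; first by case.
by move=> Bw; split=> // i.
Qed.

End Kesten.

(** * Local limits *)

(** Vertices and leaves only differ by w and by the events A n, which need to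
    agree with [sized w n] on finite trees since [GW] charges only these. *)
Lemma conditioned_weak (R : realType) (xi : probability nat R)
    (mean_xi : \int[xi]_k (k%:R)%:E = 1) (xi1_lt1 : xi [set 1%N] < 1)
    (GW_infty : probability (locTree R) R) (kestenP : kesten_law xi GW_infty)
    (w : pred nat) (A : nat -> set (locTree R)) (mA : forall n, measurable (A n)) :
  w 0%N -> (forall n, A n `&` finite_tree = sized w n) ->
  converges_weakly (within [set n | 0 < GW xi (A n)] \oo)
    (fun n => mnormalize (mrestr (GW xi) (mA n)) (dirac point)) GW_infty.
Proof.
move=> w0 AE; have [d [Om [P [X [T [lawX lawT indep lawK]]]]]] := kestenP.
have mass1 := kesten_mass1 lawT.
have GWA B n : GW xi (B `&` A n) = GW xi (B `&` sized w n).
  rewrite /GW -AE; congr esum; apply/seteqP; split=> t.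
    by move=> [[Bt At] ft]; split.
  by move=> [[Bt [At _]] ft].
have GWAn n : GW xi (A n) = (size_mass xi w n)%:E.
  by rewrite -size_massE// -[A n]setTI GWA setTI.
have -> : [set n | 0 < GW xi (A n)] = [set n | (0 < size_mass xi w n)%R].
  by apply/seteqP; split=> n /=; rewrite GWAn lte_fin.
apply: local_liminf_weak => k B lB e e0.
have mB : measurable (B : set (locTree R)) by exact: local_measurable lB.
have muK : (fine (GW_infty B) <= kesten_prob xi k B)%R.
  rewrite -lee_fin -kesten_probE// fineK ?fin_num_measure// lawK//.
  exact: (kesten_local_le lawX lawT indep lB).
have [e1|e1] := leP 1%R e.
  apply: nearW => n; apply: (@le_trans _ _ 0%R); last exact/fine_ge0/measure_ge0.
  rewrite subr_le0 (le_trans _ e1)// -lee_fin fineK ?fin_num_measure//.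
  exact: probability_le1.
have rho : (0 <= 1 - e < 1)%R by rewrite subr_ge0 (ltW e1) ltrBlDr ltrDl.
have low := local_lower mass1 mean_xi xi1_lt1 w0 lB rho.
have apos := a_near (size_mass xi w).
apply: filterS2 apos low => n an low.
have -> : fine (mnormalize (mrestr (GW xi) (mA n)) (dirac point) B) =
    (sized_prob xi w n B / size_mass xi w n)%R.
  rewrite /mnormalize /= /mrestr setTI GWAn eqe gt_eqF//= GWA sized_probE//.
rewrite ler_pdivlMr//; apply: le_trans low.
have muB1 : (fine (GW_infty B) <= 1)%R.
  by rewrite -lee_fin fineK ?fin_num_measure// probability_le1.
rewrite mulrAC ler_wpM2r ?(ltW an)//.
apply: (@le_trans _ _ ((1 - e) * fine (GW_infty B))%R); last first.
  by rewrite ler_wpM2l// subr_ge0 ltW.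
by rewrite mulrBl mul1r lerD2l lerN2 ler_piMr// ltW.
Qed.

Theorem proposition5p1 (R : realType) (xi : probability nat R)
    (mean_xi : \int[xi]_k (k%:R)%:E = 1) (xi1_lt1 : xi [set 1%N] < 1)
    (GW_infty : probability (locTree R) R)
    (kestenP : kesten_law xi GW_infty) :
  converges_weakly
    (within [set n | 0 < GW xi (trees_with_vertices n)] \oo)
    (GW_vertices xi) GW_infty /\
  converges_weakly
    (within [set n | 0 < GW xi (trees_with_leaves n)] \oo)
    (GW_leaves xi) GW_infty.
Proof.
split.
- by apply: (conditioned_weak mean_xi xi1_lt1 kestenP _ (w := xpredT)) => // n;
    exact: trees_with_verticesE.
- by apply: (conditioned_weak mean_xi xi1_lt1 kestenP _ (w := pred1 0%N)) => // n;
    exact: trees_with_leavesE.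
Qed.
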